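(* Let $M$ be a five-dimensional contact manifold with a $G_2$ contact structure with spin bundle $S$. Given a scale, i.e. a nowhere vanishing section $\sigma\in\Gamma(\Lambda^2S)$, there is a unique partial connection on $S$ such that (i) the induced partial connection on $\Lambda^2S$ annihilates $\sigma$; (ii) the partial torsion of the induced partial connection on $\Lambda^1_H=\bigodot^3S\otimes(\Lambda^2S)^{-2}$ lies in the summand $\bigodot^7S\otimes(\Lambda^2S)^{-4}$ of $$\textstyle\mathrm{Hom}(\Lambda^1_H,\Lambda^2_{H\perp})=\big(\bigodot^7S\otimes(\Lambda^2S)^{-4}\big)\oplus\big(\bigodot^5S\otimes(\Lambda^2S)^{-3}\big)\oplus\big(\bigodot^3S\otimes(\Lambda^2S)^{-2}\big)\oplus\big(S\otimes(\Lambda^2S)^{-1}\big).$$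
   Context: Everything is smooth and real. $M$ is a 5-manifold with contact distribution $H\subset TM$ (rank 4, maximally non-integrable), $L\subset\Lambda^1$ is the annihilator of $H$, $\Lambda^k_H=\Lambda^kH^*$. The Levi form is the injective bundle map $L\to\Lambda^2_H$, $\alpha\mapsto d\alpha|_H$, with nondegenerate values. Write $\Lambda^2_H=\Lambda^2_{H\perp}\oplus L$, where $\Lambda^2_{H\perp}$ consists of 2-forms on $H$ that are trace-free with respect to the Levi form. The Rumin operator $d_\perp:\Lambda^1_H\to\Lambda^2_{H\perp}$ is: lift $\omega\in\Lambda^1_H$ to a 1-form $\tilde\omega$ on $M$ and project $d\tilde\omega|_H$ to $\Lambda^2_{H\perp}$ (independent of the lift). A partial connection on a vector bundle $V$ is a linear differential operator $\nabla_H:V\to\Lambda^1_H\otimes V$ with $\nabla_H(fs)=f\nabla_Hs+(df|_H)\otimes s$. A partial connection on $\Lambda^1_H$ gives $\nabla_\perp:\Lambda^1_H\to\Lambda^2_{H\perp}$, the composition of $\nabla_H$ with $\Lambda^1_H\otimes\Lambda^1_H\to\Lambda^2_H\to\Lambda^2_{H\perp}$; its partial torsion is the bundle homomorphism $\nabla_\perp-d_\perp:\Lambda^1_H\to\Lambda^2_{H\perp}$. A $G_2$ contact structure on $M$ is a rank 2 vector bundle $S$ (the spin bundle) with an isomorphism $\bigodot^3S\cong\Lambda^1_H[2]$, where densities $\Lambda^0[w]$ are normalised by $\Lambda^5=\Lambda^0[-3]$ and $V[w]=V\otimes\Lambda^0[w]$, which is Levi-compatible: the Levi form $L[4]\to\Lambda^2_H[4]=\Lambda^2(\bigodot^3S)=(\bigodot^4S\otimes\Lambda^2S)\oplus(\Lambda^2S)^3$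 has its range in the second summand. It follows that canonically $\Lambda^2S=\Lambda^0[1]$ and $L=\Lambda^0[-1]$, so $\Lambda^1_H=\bigodot^3S\otimes(\Lambda^2S)^{-2}$ and $\Lambda^2_{H\perp}=\bigodot^4S\otimes(\Lambda^2S)^{-3}$. The displayed decomposition of $\mathrm{Hom}(\Lambda^1_H,\Lambda^2_{H\perp})\cong\bigodot^3S\otimes\bigodot^4S\otimes(\Lambda^2S)^{-4}$ is the decomposition into $GL(2,\mathbb R)$-irreducible bundles (Clebsch–Gordan), using $S^*=S\otimes(\Lambda^2S)^{-1}$. *)

(* Defs.v *)
From HB Require Import structures.
From mathcomp Require Import all_boot all_order all_algebra perm.
From mathcomp Require Import all_classical all_reals all_analysis.

Set Implicit Arguments.
Unset Strict Implicit.
Unset Printing Implicit Defensive.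

Import Order.TTheory GRing.Theory Num.Theory.
Import numFieldNormedType.Exports.

Local Open Scope classical_set_scope.
Local Open Scope ring_scope.

(** * Smooth manifolds *)

Section Smooth.
Context {R : realType} {n : nat}.

(* All partial derivatives of order <= k exist and are continuous at the points
   of the open set U. *)
Fixpoint Ck (k : nat) (U : set 'rV[R]_n) (f : 'rV[R]_n -> R) : Prop :=
  (forall x, U x -> {for x, continuous f}) /\
  match k with
  | 0%N => True
  | k'.+1 => forall i : 'I_n,
      (forall x, U x -> derivable f x (delta_mx 0 i)) /\
      Ck k' U (fun x => 'D_(delta_mx 0 i) f x)
  end.

Definition smooth_on (U : set 'rV[R]_n) (f : 'rV[R]_n -> R) : Prop :=
  forall k, Ck k U f.

End Smooth.

Record chart (R : realType) (n : nat) (T : topologicalType) := Chart {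
  cdom : set T;
  cimg : set 'rV[R]_n;
  cto :> T -> 'rV[R]_n;
  cof : 'rV[R]_n -> T;
  cdom_open : open cdom;
  cimg_open : open cimg;
  cto_img : forall p, cdom p -> cimg (cto p);
  cof_dom : forall x, cimg x -> cdom (cof x);
  ctoK : forall p, cdom p -> cof (cto p) = p;
  cofK : forall x, cimg x -> cto (cof x) = x;
  cto_continuous : forall p, cdom p -> {for p, continuous cto};
  cof_continuous : forall x, cimg x -> {for x, continuous cof} }.

Record manifold (R : realType) (n : nat) := Manifold {
  mcarrier :> topologicalType;
  mhausdorff : hausdorff_space mcarrier;
  msecond_countable : @second_countable mcarrier;
  atlas : set (chart R n mcarrier);
  atlas_cover : forall p, exists c, atlas c /\ cdom c p;
  atlas_compat : forall c d, atlas c -> atlas d -> forall i : 'I_n,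
    smooth_on (cimg c `&` cof c @^-1` cdom d) (fun x => d (cof c x) 0 i) }.

(* Functions (and sections of bundles) are total on M; only their germs matter:
   "smooth at p" always means smooth on some neighbourhood of p. *)
Definition smooth_fun (R : realType) (n : nat) (M : manifold R n)
    (f : M -> R) (p : M) : Prop :=
  exists U : set M, [/\ open U, U p &
    forall c, atlas c -> smooth_on (cimg c `&` cof c @^-1` U) (f \o cof c)].

(** * Linear subspaces as modules *)

Section Subspaces.
Context {R : realType}.

Record lin_subspace (V : lmodType R) := LinSubspace {
  sub_set :> V -> Prop;
  sub_set0 : sub_set 0;
  sub_setP : forall a u v, sub_set u -> sub_set v -> sub_set (a *: u + v) }.

Definition sub_pred (V : lmodType R) (W : lin_subspace V) : {pred V} :=
  fun v => `[< W v >].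

Lemma sub_pred_closed V (W : lin_subspace V) : submod_closed (sub_pred W).
Proof.
split; first by apply/asboolP/sub_set0.
by move=> a u v /asboolP Wu /asboolP Wv; apply/asboolP/sub_setP.
Qed.

HB.instance Definition _ V (W : lin_subspace V) :=
  GRing.isSubmodClosed.Build R V (sub_pred W) (sub_pred_closed W).

Record elt (V : lmodType R) (W : lin_subspace V) := Elt {
  elt_val : V; elt_mem : elt_val \in sub_pred W }.

HB.instance Definition _ V (W : lin_subspace V) := [isSub for @elt_val V W].
HB.instance Definition _ V (W : lin_subspace V) := [Choice of elt W by <:].
HB.instance Definition _ V (W : lin_subspace V) :=
  [SubChoice_isSubLmodule of elt W by <:].

(* v as an element of W; the junk value 0 if v does not belong to W. *)
Definition to_elt (V : lmodType R) (W : lin_subspace V) (v : V) : elt W :=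
  insubd 0 v.

Lemma elt_set V (W : lin_subspace V) (u : elt W) : W (elt_val u).
Proof. exact/asboolP/elt_mem. Qed.

Lemma to_eltK V (W : lin_subspace V) v : W v -> elt_val (to_elt W v) = v.
Proof. by move=> Wv; apply: (@insubdK _ _ (elt W)); apply/asboolP. Qed.

End Subspaces.

(** * Multilinear forms *)

Variant form_kind := Any | Sym | Alt.

Section Forms.
Context {R : realType}.

Definition upd (T : Type) (k : nat) (v : 'I_k -> T) (i : 'I_k) (x : T) :
  'I_k -> T := fun j => if j == i then x else v j.

Definition is_form (kd : form_kind) (k : nat) (V W : lmodType R)
    (A : ('I_k -> V) -> W) : Prop :=
  (forall v i a x y,
     A (upd v i (a *: x + y)) = a *: A (upd v i x) + A (upd v i y)) /\
  match kd with
  | Any => True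
  | Sym => forall (s : 'S_k) v, A (v \o s) = A v
  | Alt => forall v i j, i != j -> v i = v j -> A v = 0
  end.

Lemma is_form0 kd k (V W : lmodType R) : @is_form kd k V W 0.
Proof. by split; [move=> *; rewrite scaler0 addr0 | case: kd]. Qed.

Lemma is_formP kd k (V W : lmodType R) a (A B : ('I_k -> V) -> W) :
  is_form kd A -> is_form kd B -> is_form kd (a *: A + B).
Proof.
have E (v : 'I_k -> V) : (a *: A + B) v = a *: A v + B v by [].
move=> [mA kA] [mB kB]; split=> [v i b x y|].
  rewrite !E mA mB !scalerDr !scalerA [b * a]mulrC -!addrA; congr (_ + _).
  by rewrite addrCA.
case: kd kA kB => // kA kB; first by move=> s v; rewrite !E kA kB.
by move=> v i j ij vij; rewrite E (kA v i j) ?(kB v i j) // scaler0 addr0.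
Qed.

Definition forms kd k (V W : lmodType R) : lin_subspace (('I_k -> V) -> W) :=
  LinSubspace (@is_form0 kd k V W) (@is_formP kd k V W).

Definition fapp kd k (V W : lmodType R) (A : elt (forms kd k V W)) :
  ('I_k -> V) -> W := elt_val A.

Definition mk_form kd k (V W : lmodType R) (A : ('I_k -> V) -> W) :
  elt (forms kd k V W) := to_elt _ A.

End Forms.

Notation "[ 'args' x ; .. ; z ]" :=
  (tnth (cons_tuple x .. (cons_tuple z (nil_tuple _)) ..)) : ring_scope.

(** * Vector bundles *)

(* A bundle is a family of vector spaces together with the germs of its smooth
   sections; [is_bundle] is local triviality. *)
Record prebundle (R : realType) (n : nat) (M : manifold R n) := Prebundle {
  fib :> M -> lmodType R;
  smooth_sec : (forall p, fib p) -> M -> Prop }.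

Section Bundles.
Context {R : realType} {n : nat} {M : manifold R n}.
Implicit Types E F : prebundle M.

Definition section E := forall p, E p.

Definition is_frame E r (U : set M) (e : 'I_r -> section E) : Prop :=
  [/\ open U,
      forall q, U q -> forall v : E q,
        exists! c : 'I_r -> R, v = \sum_i c i *: e i q &
      forall (s : section E) q, U q ->
        (smooth_sec s q <->
         exists2 c : 'I_r -> M -> R, forall i, smooth_fun (c i) q &
           \forall x \near q, s x = \sum_i c i x *: e i x)].

Definition is_bundle (r : nat) E : Prop :=
  forall p, exists U : set M, exists2 e : 'I_r -> section E,
    is_frame U e & U p.

Definition trivb : prebundle M :=
  @Prebundle R n M (fun=> (R^o : lmodType R)) (fun f p => smooth_fun f p).

Definition formb kd k E F : prebundle M :=
  @Prebundle R n M (fun p => elt (forms kd k (E p) (F p)) : lmodType R)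
    (fun A p => forall s : 'I_k -> section E,
       (forall i, smooth_sec (s i) p) ->
       smooth_sec (fun q => fapp (A q) (s^~ q)) p).

Definition subb E (W : forall p, lin_subspace (E p)) : prebundle M :=
  @Prebundle R n M (fun p => elt (W p) : lmodType R)
    (fun s p => smooth_sec (fun q => elt_val (s q)) p).

(* E^* (x) F as Hom(E, F) *)
Definition homb E F := formb Any 1 E F.
Definition dualb E := homb E trivb.
(* The k-th symmetric, exterior and tensor powers of E, as k-linear forms on
   the dual of E; the powers of E^* are written directly as forms on E. *)
Definition symb k E := formb Sym k (dualb E) trivb.
Definition extb k E := formb Alt k (dualb E) trivb.
Definition tensb k E := formb Any k (dualb E) trivb.

Definition happ E F p (A : homb E F p) (v : E p) : F p := fapp A [args v].

Record bundle_iso E F := BundleIso {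
  iso_to : forall p, E p -> F p;
  iso_of : forall p, F p -> E p;
  iso_linear : forall p a (u v : E p),
    iso_to (a *: u + v) = a *: iso_to u + iso_to v;
  iso_toK : forall p (u : E p), iso_of (iso_to u) = u;
  iso_ofK : forall p (v : F p), iso_to (iso_of v) = v;
  iso_smooth : forall (s : section E) p,
    smooth_sec (fun q => iso_to (s q)) p <-> smooth_sec s p }.

End Bundles.

(** * Tangent vectors, 1-forms and the exterior derivative *)

Section Tangent.
Context {R : realType} {n : nat} {M : manifold R n}.

(* Derivations at p of the algebra of germs of smooth functions; the value on
   functions which are not smooth at p is set to 0. *)
Definition is_derivation (p : M) (v : (M -> R) -> R^o) : Prop :=
  [/\ forall f g, smooth_fun f p -> smooth_fun g p ->
        (\forall q \near p, f q = g q) -> v f = v g,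
      forall a f g, smooth_fun f p -> smooth_fun g p ->
        v (fun q => a * f q + g q) = a * v f + v g,
      forall f g, smooth_fun f p -> smooth_fun g p ->
        v (fun q => f q * g q) = f p * v g + g p * v f &
      forall f, ~ smooth_fun f p -> v f = 0].

Lemma is_derivation0 p : is_derivation p 0.
Proof.
have E f : (0 : (M -> R) -> R^o) f = 0 by [].
by split=> *; rewrite !E ?mulr0 ?addr0.
Qed.

Lemma is_derivationP p (a : R) u v :
  is_derivation p u -> is_derivation p v -> is_derivation p (a *: u + v).
Proof.
have E f : (a *: u + v) f = a * u f + v f by [].
move=> [u1 u2 u3 u4] [v1 v2 v3 v4]; split.
- by move=> f g sf sg fg; rewrite !E (u1 f g) // (v1 f g).
- move=> b f g sf sg; rewrite !E u2 // v2 // !mulrDr !mulrA [b * a]mulrC.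
  by rewrite -!addrA; congr (_ + _); rewrite addrCA.
- move=> f g sf sg; rewrite !E u3 // v3 // !mulrDr !mulrA ![_ * a]mulrC.
  by rewrite -!addrA; congr (_ + _); rewrite addrCA.
- by move=> f sf; rewrite E u4 // v4 // mulr0 addr0.
Qed.

Definition tangent (p : M) : lin_subspace ((M -> R) -> R^o) :=
  LinSubspace (is_derivation0 p) (@is_derivationP p).

Definition tapp p (v : elt (tangent p)) (f : M -> R) : R := elt_val v f.

Definition TM : prebundle M :=
  @Prebundle R n M (fun p => elt (tangent p) : lmodType R)
    (fun X p => forall f, smooth_fun f p ->
       smooth_fun (fun q => tapp (X q) f) p).

Definition bracket (X Y : section TM) : section TM := fun p =>
  xget 0 [set Z : TM p | forall f, smooth_fun f p ->
    tapp Z f = tapp (X p) (fun q => tapp (Y q) f)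
               - tapp (Y p) (fun q => tapp (X q) f)].

(* d w (X, Y) = X (w Y) - Y (w X) - w [X, Y] *)
Definition extd (w : section (dualb TM)) : section (formb Alt 2 TM trivb) :=
  fun p => xget 0 [set b : formb Alt 2 TM trivb p |
    forall X Y : section TM, smooth_sec X p -> smooth_sec Y p ->
      fapp b [args X p; Y p] =
        tapp (X p) (fun q => happ (w q) (Y q))
        - tapp (Y p) (fun q => happ (w q) (X q))
        - happ (w p) (bracket X Y p)].

End Tangent.

(** * Contact distributions *)

Section Contact.
Context {R : realType} {M : manifold R 5}.
Variable H : forall p : M, lin_subspace (@TM R 5 M p).

(* H is a smooth subbundle of rank 4 of TM. *)
Definition is_distribution4 : Prop :=
  forall p, exists U : set M, exists2 e : 'I_5 -> section TM,
    is_frame U e /\ U p &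
    forall q, U q -> forall v : TM q,
      H q v <-> exists c : 'I_4 -> R,
        v = \sum_i c i *: e (widen_ord (leqnSn 4) i) q.

Definition Hb : prebundle M := subb H.
Definition L1H : prebundle M := dualb Hb.
Definition L2H : prebundle M := formb Alt 2 Hb trivb.

Definition annihilates p (a : dualb (@TM R 5 M) p) : Prop :=
  forall v, H p v -> happ a v = 0.

Lemma annihilates0 p : @annihilates p 0.
Proof. by []. Qed.

Lemma annihilatesP p c (a b : dualb (@TM R 5 M) p) :
  annihilates a -> annihilates b -> annihilates (c *: a + b).
Proof.
move=> ha hb v Hv.
have -> : happ (c *: a + b) v = c *: happ a v + happ b v by [].
by rewrite ha // hb // scaler0 addr0.
Qed.

Definition Lb : prebundle M :=
  subb (fun p => LinSubspace (@annihilates0 p) (@annihilatesP p)).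

Definition restr1 p (w : dualb (@TM R 5 M) p) : L1H p :=
  mk_form Any (fun v : 'I_1 -> Hb p => fapp w (fun i => elt_val (v i)) : R^o).

Definition restr2 p (b : formb Alt 2 (@TM R 5 M) trivb p) : L2H p :=
  mk_form Alt (fun v : 'I_2 -> Hb p => fapp b (fun i => elt_val (v i)) : R^o).

Definition levi p (a : Lb p) : L2H p :=
  xget 0 [set b : L2H p | exists s : section Lb,
    [/\ smooth_sec s p, s p = a &
        b = restr2 (extd (fun q => elt_val (s q)) p)]].

Definition nondegenerate p (b : L2H p) : Prop :=
  forall X : Hb p, (forall Y : Hb p, fapp b [args X; Y] = 0) -> X = 0.

Definition is_contact : Prop :=
  is_distribution4 /\
  forall p (a : Lb p), a != 0 -> nondegenerate (levi a).

(* The trace of b with respect to l is the sum of the b(e_i, f_i) over l-dual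
   bases; scaling l scales the trace, so any non-zero value l of the Levi form
   may be used. *)
Definition trace_free p (b : L2H p) : Prop :=
  forall (a : Lb p) (e f : 'I_4 -> Hb p),
    (forall i j, fapp (levi a) [args e i; f j] = (i == j)%:R) ->
    \sum_i (fapp b [args e i; f i] : R) = 0.

Lemma trace_free0 p : @trace_free p 0.
Proof. by move=> a e f _; apply: big1. Qed.

Lemma trace_freeP p (c : R) (b b' : L2H p) :
  trace_free b -> trace_free b' -> trace_free (c *: b + b').
Proof.
move=> hb hb' a e f ef.
have E v : (fapp (c *: b + b') v : R) = c * fapp b v + fapp b' v by [].
under eq_bigr do rewrite E.
by rewrite big_split /= -mulr_sumr (hb a) // (hb' a) // mulr0 addr0.
Qed.

Definition L2perp : prebundle M :=
  subb (fun p => LinSubspace (@trace_free0 p) (@trace_freeP p)).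

(* The projection of L2H onto its trace-free part along the image of L. *)
Definition proj_perp p (b : L2H p) : L2perp p :=
  xget 0 [set b' : L2perp p | exists a : Lb p, b = elt_val b' + levi a].

Definition rumin (w : section L1H) : section L2perp := fun p =>
  xget 0 [set b : L2perp p | exists w' : section (dualb TM),
    [/\ smooth_sec w' p, (\forall q \near p, restr1 (w' q) = w q) &
        b = proj_perp (restr2 (extd w' p))]].

(** ** Partial connections *)

(* D p X s is the derivative at p, in the direction X, of a section s of E
   which is smooth at p (its value for other s is irrelevant). *)
Definition operator (E : prebundle M) := forall p, Hb p -> section E -> E p.

Definition Hderiv p (X : Hb p) (f : M -> R) : R := tapp (elt_val X) f.

Record is_pconn (E : prebundle M) (D : operator E) : Prop := IsPconn {
  pconn_linear : forall p a (X Y : Hb p) s, smooth_sec s p ->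
    D p (a *: X + Y) s = a *: D p X s + D p Y s;
  pconn_local : forall p (X : Hb p) s t, smooth_sec s p -> smooth_sec t p ->
    (\forall q \near p, s q = t q) -> D p X s = D p X t;
  pconn_add : forall p (X : Hb p) s t, smooth_sec s p -> smooth_sec t p ->
    D p X (fun q => s q + t q) = D p X s + D p X t;
  pconn_leibniz : forall p (X : Hb p) f s, smooth_fun f p -> smooth_sec s p ->
    D p X (fun q => f q *: s q) = f p *: D p X s + Hderiv X f *: s p;
  pconn_smooth : forall p (X : section Hb) s, smooth_sec X p -> smooth_sec s p ->
    smooth_sec (fun q => D q (X q) s) p }.

Definition triv_op : operator trivb := fun p X f => Hderiv X f.

(* The operator induced on F-valued multilinear forms on E:
   (D_X A)(s_1, ..., s_k) =
     D_X (A (s_1, ..., s_k)) - \sum_i A (s_1, ..., D_X s_i, ..., s_k). *)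
Definition form_op kd k (E F : prebundle M) (DE : operator E) (DF : operator F) :
  operator (formb kd k E F) := fun p X A =>
  xget 0 [set B : formb kd k E F p | forall s : 'I_k -> section E,
    (forall i, smooth_sec (s i) p) ->
    fapp B (s^~ p) =
      DF p X (fun q => fapp (A q) (s^~ q))
      - \sum_i fapp (A p) (upd (s^~ p) i (DE p X (s i)))].

Definition dual_op (E : prebundle M) (D : operator E) : operator (dualb E) :=
  form_op D triv_op.

Definition sym_op k (E : prebundle M) (D : operator E) : operator (symb k E) :=
  form_op (dual_op D) triv_op.

Definition ext_op k (E : prebundle M) (D : operator E) : operator (extb k E) :=
  form_op (dual_op D) triv_op.

(* Skew-symmetrisation of D w, then projection to the trace-free part. *)
Definition nabla_perp (D : operator L1H) (w : section L1H) : section L2perp :=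
  fun p => proj_perp (mk_form Alt (fun v : 'I_2 -> Hb p =>
    (happ (D p (v 0) w) (v 1) - happ (D p (v 1) w) (v 0) : R^o))).

Definition torsion (D : operator L1H) (p : M) : homb L1H L2perp p :=
  xget 0 [set t : homb L1H L2perp p | forall w : section L1H, smooth_sec w p ->
    happ t (w p) = nabla_perp D w p - rumin w p].

End Contact.

Arguments form_op {R M H kd k E F} DE DF p X A.
Arguments dual_op {R M H E} D p X A.
Arguments sym_op {R M H} k {E} D p X A.
Arguments ext_op {R M H} k {E} D p X A.

(** * G2 contact structures *)

Section G2.
Context {R : realType} {M : manifold R 5}.
Variable H : forall p : M, lin_subspace (@TM R 5 M p).

(* w (x) d1 (x) d2 in L1H (x) D^2 = Hom(H, D^2) *)
Definition twist (D : prebundle M) p (w : L1H H p) (d1 d2 : D p) :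
    homb (Hb H) (tensb 2 D) p :=
  mk_form Any (fun v : 'I_1 -> Hb H p =>
    mk_form Any (fun z : 'I_2 -> dualb D p =>
      (happ w (v 0) : R) * (happ (z 0) d1 * happ (z 1) d2) : R^o) :
        tensb 2 D p).

(* For a in L and d in D, a (x) d^4 is sent by the Levi form to an element of
   L2H (x) D^4 = Ext^2 (Sym^3 S), that is to a skew form on the dual of Sym^3 S,
   the space spanned by the evaluations x^3 : A |-> A (x, x, x), x in S^*. The
   vector h below is the one corresponding to x^3. The second summand
   (Ext^2 S)^3 of Ext^2 (Sym^3 S) is spanned by the skew form which takes the
   value l(x, y)^3 at (x^3, y^3), where l spans Ext^2 S. *)
Definition levi_compatible (S D : prebundle M)
    (phi : bundle_iso (symb 3 S) (homb (Hb H) (tensb 2 D))) : Prop :=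
  forall p (a : Lb H p) (d : D p), exists (c : R) (l : extb 2 S p),
  forall (x y : dualb S p) (h k : Hb H p),
    (forall w : L1H H p,
       happ w h = fapp (iso_of phi (twist w d d)) [args x; x; x]) ->
    (forall w : L1H H p,
       happ w k = fapp (iso_of phi (twist w d d)) [args y; y; y]) ->
    fapp (levi a) [args h; k] = c * (fapp l [args x; y] : R) ^+ 3.

(* [dens] is the density bundle of weight 1: Ext^5 T^*M is its power -3, i.e.
   the trilinear forms on it. *)
Record g2_contact := G2Contact {
  spin : prebundle M;
  spin_bundle : is_bundle 2 spin;
  dens : prebundle M;
  dens_bundle : is_bundle 1 dens;
  vol : bundle_iso (formb Alt 5 (@TM R 5 M) trivb) (formb Any 3 dens trivb);
  spin_iso : bundle_iso (symb 3 spin) (homb (Hb H) (tensb 2 dens));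
  spin_levi : levi_compatible spin_iso }.

Variable G : g2_contact.
Let S := spin G.
Let D := dens G.

Definition wedge2 p (s t : S p) : extb 2 S p :=
  mk_form Alt (fun x : 'I_2 -> dualb S p =>
    (happ (x 0) s : R) * happ (x 1) t
    - (happ (x 0) t : R) * happ (x 1) s : R^o).

Definition sym_prod k p (v : 'I_k -> S p) : symb k S p :=
  mk_form Sym (fun x : 'I_k -> dualb S p =>
    (k`!%:R)^-1 * \sum_(g : 'S_k) \prod_i (happ (x i) (v (g i)) : R) : R^o).

Definition wedge5 p (w : 'I_5 -> dualb (@TM R 5 M) p) :
    formb Alt 5 (@TM R 5 M) trivb p :=
  mk_form Alt (fun v : 'I_5 -> TM p =>
    \det (\matrix_(i, j) (happ (w i) (v j) : R)) : R^o).

(* The canonical isomorphism Ext^2 S = dens. If s, t is a basis of S and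
   d = theta (s ^ t), the isomorphism Sym^3 S = L1H (x) dens^2 takes
   s^3, s^2 t, s t^2, t^3 to w_i (x) d^2; then w_0 ^ w_3 - 3 w_1 ^ w_2 spans
   the image of (Ext^2 S)^3, so it is the Levi form of some a in L, and
   a ^ w_0 ^ w_1 ^ w_2 ^ w_3 is a volume form, which has to be d^-3. Replacing
   d by c d multiplies the volume form by c^-12, so that d is determined by an
   equation c^9 = const. The choice of constants in these normalisations
   multiplies theta by a constant, which does not affect the partial
   connections induced through theta. *)
Definition is_canonical p (theta : extb 2 S p -> D p) : Prop :=
  (forall a u v, theta (a *: u + v) = a *: theta u + theta v) /\
  forall s t : S p, wedge2 s t != 0 ->
  let d := theta (wedge2 s t) in
  exists (a : Lb H p) (w0 w1 w2 w3 : dualb (@TM R 5 M) p),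
    let corresponds (x y z : S p) (w : dualb TM p) :=
      iso_to (spin_iso G) (sym_prod [args x; y; z]) = twist (restr1 H w) d d in
    let wedge (w w' : dualb TM p) (X Y : Hb H p) : R :=
      happ (restr1 H w) X * happ (restr1 H w') Y
      - happ (restr1 H w) Y * happ (restr1 H w') X in
    [/\ [/\ corresponds s s s w0, corresponds s s t w1,
            corresponds s t t w2 & corresponds t t t w3],
        forall X Y : Hb H p,
          fapp (levi a) [args X; Y] = wedge w0 w3 X Y - 3 * wedge w1 w2 X Y &
        fapp (iso_to (vol G) (wedge5 [args elt_val a; w0; w1; w2; w3]))
          [args d; d; d] = 1].

Definition theta p : extb 2 S p -> D p :=
  xget (fun=> 0) [set f | is_canonical f].

(* Sym^3 S (x) (Ext^2 S)^-2, as bilinear maps from Ext^2 S to Sym^3 S *)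
Definition S32 : prebundle M := formb Any 2 (extb 2 S) (symb 3 S).

(* The isomorphism from L1H to S32. *)
Definition psi p (w : L1H H p) : S32 p :=
  mk_form Any (fun l : 'I_2 -> extb 2 S p =>
    iso_of (spin_iso G) (twist w (theta (l 0)) (theta (l 1)))).

Definition L1H_op (nabla : operator H S) : operator H (L1H H) := fun p X w =>
  xget 0 [set u : L1H H p |
    psi u = form_op (ext_op 2 nabla) (sym_op 3 nabla) p X (fun q => psi (w q))].

(* The inclusion of Sym^7 S (x) (Ext^2 S)^-4 in Hom(L1H, L2perp), a non-zero l
   in Ext^2 S being given.
   - L1H = Sym^3 S (x) l^-2 is spanned by the elements w corresponding to cubes
     (y _| l)^3 (x) l^-2, y in S^*; this uses S = S^* (x) Ext^2 S.
   - L2perp = Sym^4 S (x) l^-3: a bilinear form b on H = (Sym^3 S)^* (x) l^2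
     corresponds to the quartic Q with
       b (x x a (x) l^2, x x a' (x) l^2) = l (a, a') Q (x, x, x, x);
     this is the contraction Ext^2 (Sym^3 S) -> Sym^4 S (x) Ext^2 S, whose
     kernel is (Ext^2 S)^3.
   A homomorphism t is therefore an element of Sym^3 S (x) Sym^4 S, whose value
   at (y, y, y; x, x, x, x) is the value of Q for b = t w. It belongs to Sym^7 S
   iff it is the restriction of a symmetric 7-linear form K. If l is multiplied
   by c then K is multiplied by c^4. *)
Definition in_sym7 p (t : homb (L1H H) (L2perp H) p) : Prop :=
  forall l : extb 2 S p, exists K : symb 7 S p,
  forall (y x a a' : dualb S p) (w : L1H H p) (h h' : Hb H p),
    (forall z : 'I_3 -> dualb S p,
       fapp (fapp (psi w) [args l; l]) z =
         \prod_i (fapp l [args y; z i] : R)) ->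
    (forall u : L1H H p,
       happ u h = fapp (fapp (psi u) [args l; l]) [args x; x; a]) ->
    (forall u : L1H H p,
       happ u h' = fapp (fapp (psi u) [args l; l]) [args x; x; a']) ->
    fapp (elt_val (happ t w)) [args h; h'] =
      (fapp l [args a; a'] : R) * fapp K [args y; y; y; x; x; x; x].

End G2.

(* Main.v *)
From Pilot Require Import Defs.
From mathcomp Require Import all_boot all_order all_algebra.
From mathcomp Require Import all_classical all_reals all_analysis.
From mathcomp Require Import perm ring lra.
Import Pilot.Defs.

(** At a point, the two conditions form a square system of linear equations with
    constant coefficients for the connection forms. The system is invertible, so the
    partial connection exists and is unique at each point; it is smooth, being a fixed
    linear combination of smooth functions.

    Let (f_0, f_1) be a local frame of S with sigma = f_0 ^ f_1. Levi compatibility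
    provides a frame h_0, ..., h_3 of H, dual to the cubic monomials in f_0 and f_1, in
    which the Levi form is a multiple of the invariant skew form on binary cubics
    ([lam_levi], [adapted_basis]). A partial connection on S is given by four 1-forms
    on H, the entries of its connection matrix. Everything it induces at p depends on
    it at p only ([pconn_at], [form_opE]). The first condition says that the matrix is
    trace-free ([ext_op_trace]); there remain the values of three 1-forms at the four
    vectors h_i, that is, twelve unknowns.

    The induced derivatives of the coframe w_n dual to h_n are given by the action of
    sl(2) on binary cubics ([kco_L1H]). The torsion maps w_n to the skew part of its
    derivative minus the restriction of d w_n to H, up to a multiple of the Levi form
    ([torsionE]). Two-forms on H modulo the Levi form are binary quartics ([quartic],
    [xxa_quartic]), so the torsion is a 4 x 5 array of numbers, an element of
    Sym^3 (x) Sym^4 ([torsion_quartic]). It lies in Sym^7 if and only if, up to signs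
    and binomial coefficients, the entry (i, m) is a function k of i + m ([in_sym7E]).
    This gives twenty equations in the twelve unknowns and the eight values of k, and
    there is exactly one solution ([sym7_exists], [sym7_unique]). In terms of
    representations, trace-free connection matrices form Sym^3 (x) Sym^2, which the
    torsion maps isomorphically to the complement Sym^5 + Sym^3 + S of Sym^7.

    The isomorphism theta of the exterior square of S with the densities is not
    algebraic: in frames it is multiplication by a ninth root of a function
    ([canonical_coord], [canonical_exists]). Real ninth roots exist and are unique, and
    this one is smooth because the function has no zeros ([smooth_theta]).

    Finally, the connection is defined at each point by the formula of an adapted frame
    around it ([conn_loc]); by uniqueness, the formula of any such frame is valid
    throughout its domain ([adaptedE], [nab_comb]), which gives smoothness. *)

Set Implicit Arguments.
Unset Strict Implicit.
Unset Printing Implicit Defensive.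

Import Order.TTheory GRing.Theory Num.Theory.
Import numFieldNormedType.Exports.

Local Open Scope classical_set_scope.
Local Open Scope ring_scope.

(** * Smooth functions *)

Section CkTheory.
Context {R : realType} {n : nat}.
Implicit Types (U V : set 'rV[R]_n) (f g : 'rV[R]_n -> R).

Lemma near_open U x (P : 'rV[R]_n -> Prop) :
  open U -> U x -> (forall y, U y -> P y) -> \forall y \near x, P y.
Proof.
move=> oU Ux UP; apply: (@filterS _ _ _ U) => //.
by apply: open_nbhs_nbhs.
Qed.

Lemma Ck_cont k U f : Ck k U f -> forall x, U x -> {for x, continuous f}.
Proof. by case: k => [|k] []. Qed.

Lemma CkW k U f : Ck k.+1 U f -> Ck k U f.
Proof.
elim: k f => [|k IH] f [cf df]; first by split.
by split=> // i; have [df1 df2] := df i; split => //; apply: IH.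
Qed.

Lemma Ck_sub k U V f : (V `<=` U) -> Ck k U f -> Ck k V f.
Proof.
move=> VU; elim: k f => [|k IH] f [cf df].
  by split=> // x /VU; apply: cf.
split=> [x /VU|i]; first exact: cf.
by have [df1 df2] := df i; split => [x /VU|]; [apply: df1 | apply: IH].
Qed.

Lemma Ck_eq k U f g : open U -> (forall x, U x -> f x = g x) ->
  Ck k U f -> Ck k U g.
Proof.
move=> oU.
have nearU x (h h' : 'rV[R]_n -> R) : (forall y, U y -> h y = h' y) -> U x ->
  {near x, h =1 h'} by move=> hh' Ux; apply: near_open oU Ux hh'.
have cont (h h' : 'rV[R]_n -> R) : (forall x, U x -> h x = h' x) ->
    (forall x, U x -> {for x, continuous h}) ->
    forall x, U x -> {for x, continuous h'}.
  move=> hh' ch x Ux; rewrite /prop_for /continuous_at -hh' //.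
  apply: cvg_trans (ch x Ux); apply: (@near_eq_cvg _ _ (nbhs x)).
  by apply: near_open oU Ux _ => y Uy; rewrite hh'.
elim: k f g => [|k IH] f g fg [cf df]; first by split=> //; apply: cont cf.
split; first by apply: cont cf.
move=> i; have [df1 df2] := df i; split.
  by move=> x Ux; apply: near_eq_derivable (df1 x Ux); apply: nearU.
by apply: IH df2 => x Ux; apply: near_eq_derive; apply: nearU.
Qed.

Lemma Ck_cst k U (a : R) : Ck k U (fun=> a).
Proof.
elim: k a => [|k IH] a.
  by split=> // x _; apply: cst_continuous.
split=> [x _|i]; first exact: cst_continuous.
split=> [x _|]; first exact: derivable_cst.
by rewrite [X in Ck _ _ X](_ : _ = fun=> 0) //; apply/funext=> x; rewrite derive_cst.
Qed.

Lemma Ck_add k U f g : open U -> Ck k U f -> Ck k U g ->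
  Ck k U (fun x => f x + g x).
Proof.
move=> oU; elim: k f g => [|k IH] f g [cf df] [cg dg].
  by split=> // x Ux; apply: continuousD; [apply: cf | apply: cg].
split=> [x Ux|i]; first by apply: continuousD; [apply: cf | apply: cg].
have [df1 df2] := df i; have [dg1 dg2] := dg i.
split=> [x Ux|]; first by apply: derivableD; [apply: df1 | apply: dg1].
apply: Ck_eq (IH _ _ df2 dg2) => // x Ux.
by rewrite -deriveD //; [apply: df1 | apply: dg1].
Qed.

Lemma Ck_mul k U f g : open U -> Ck k U f -> Ck k U g ->
  Ck k U (fun x => f x * g x).
Proof.
move=> oU; elim: k f g => [|k IH] f g kf kg.
  by split=> // x Ux; apply: continuousM; [apply: (Ck_cont kf)|apply: (Ck_cont kg)].
split=> [x Ux|i].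
  by apply: continuousM; [apply: (Ck_cont kf)|apply: (Ck_cont kg)].
have [_ df] := kf; have [_ dg] := kg.
have [df1 df2] := df i; have [dg1 dg2] := dg i.
split=> [x Ux|]; first by apply: derivableM; [apply: df1 | apply: dg1].
have := Ck_add oU (IH _ _ (CkW kf) dg2) (IH _ _ (CkW kg) df2).
apply: Ck_eq => // x Ux.
by rewrite -[RHS]/('D_(delta_mx 0 i) (f * g) x) deriveM //;
  [apply: df1 | apply: dg1].
Qed.

Lemma Ck_inv k U f : open U -> (forall x, U x -> f x != 0) ->
  Ck k U f -> Ck k U (fun x => (f x)^-1).
Proof.
move=> oU f0; elim: k => [|k IH] kf.
  by split=> // x Ux; apply: continuousV; [apply: f0 | apply: (Ck_cont kf)].
split=> [x Ux|i].
  by apply: continuousV; [apply: f0|apply: (Ck_cont kf)].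
have [_ /(_ i) [df1 df2]] := kf.
split=> [x Ux|]; first by apply: derivableV; [apply: f0 | apply: df1].
have kV := IH (CkW kf).
have := Ck_mul oU (Ck_cst k U (-1)) (Ck_mul oU (Ck_mul oU kV kV) df2).
apply: Ck_eq => // x Ux.
rewrite deriveV; [|exact: f0|exact: df1].
by rewrite mulN1r -mulNr -invfM -expr2.
Qed.

Lemma is_derive_line (f : 'rV[R]_n -> R) (g : R -> R) x v (dg : R) :
  derivable f x v -> is_derive (f x) 1 g dg ->
  is_derive x v (g \o f) ('D_v f x * dg).
Proof.
move=> df dgf.
have fl : is_derive (0 : R) 1 (fun h : R => f (h *: v + x)) ('D_v f x).
  have := derivableP ((derivable1P f x v).1 df).
  suff -> : 'D_1 (fun h : R => f (h *: v + x)) 0 = 'D_v f x by [].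
  rewrite /derive; set g1 := fun h => h^-1 *: _; set g2 := fun h => h^-1 *: _.
  suff -> : g1 = g2 by [].
  by apply/funext => h; rewrite /g1 /g2 /= addr0 scale0r add0r [_%:A]mulr1.
have E0 : f (0 *: v + x) = f x by rewrite scale0r add0r.
have dgf' : is_derive (f (0 *: v + x)) 1 g dg by rewrite E0.
have := @is_derive1_comp _ g (fun h : R => f (h *: v + x)) 0 _ _ dgf' fl.
move=> [d1 d2].
split; first by apply/derivable1P.
rewrite mulrC -[RHS]d2 /derive.
set g1 := fun h => h^-1 *: _; set g2 := fun h => h^-1 *: _.
suff -> : g1 = g2 by [].
by apply/funext => h; rewrite /g1 /g2 /= addr0 scale0r add0r [_%:A]mulr1.
Qed.

(** The derivative of f^c = exp (c ln f) is c f^c f'/f, so the order of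
    differentiability of f^c grows with that of f. *)
Lemma Ck_expln k U f (c : R) : open U -> (forall x, U x -> 0 < f x) ->
  Ck k U f -> Ck k U (fun x => expR (c * ln (f x))).
Proof.
move=> oU f0.
have D1 (y : R) : 0 < y ->
    is_derive y 1 (fun z : R => expR (c * ln z)) (c * y^-1 * expR (c * ln y)).
  move=> y0.
  have dl := is_derive1_ln y0.
  have dc : is_derive y 1 (fun z : R => c * ln z) (c * y^-1).
    have h := is_deriveZ c dl; exact: h.
  have h := @is_derive1_comp R expR (fun z => c * ln z) y _ _ (is_derive_expR (c * ln y)) dc.
  by rewrite mulrC; exact: h.
have C1 x : U x -> {for x, continuous f} ->
    {for x, continuous (fun x => expR (c * ln (f x)))}.
  move=> Ux cf.
  apply: (@continuous_comp _ _ _ f (fun z : R => expR (c * ln z))) => //.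
  have [dy _] := D1 _ (f0 x Ux).
  exact/differentiable_continuous/derivable1_diffP.
elim: k => [|k IH] kf.
  by split=> // x Ux; apply: C1 => //; apply: (Ck_cont kf).
split=> [x Ux|i]; first by apply: C1 => //; apply: (Ck_cont kf).
have [_ /(_ i) [df1 df2]] := kf.
have D2 x (Ux : U x) := is_derive_line (df1 x Ux) (D1 _ (f0 x Ux)).
split=> [x Ux|]; first by case: (D2 x Ux).
have kV : Ck k U (fun x => (f x)^-1).
  by apply: Ck_inv => //; [move=> x /f0/lt0r_neq0 | apply: CkW].
have := Ck_mul oU df2 (Ck_mul oU (Ck_mul oU (Ck_cst k U c) kV) (IH (CkW kf))).
by apply: Ck_eq => // x Ux; case: (D2 x Ux) => _ <-.
Qed.

End CkTheory.

Section SmoothFun.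
Context {R : realType} {n : nat} {M : manifold R n}.
Implicit Types (f g : M -> R) (p q : M).

Lemma chart_pre_open (c : chart R n M) (U : set M) :
  open U -> open (cimg c `&` cof c @^-1` U).
Proof.
move=> oU; rewrite openE => x [cx Ux]; apply: filterI.
  by apply: open_nbhs_nbhs; split=> //; exact: cimg_open.
by apply: (cof_continuous cx); apply: open_nbhs_nbhs.
Qed.

Lemma smooth_near f p : smooth_fun f p -> \forall q \near p, smooth_fun f q.
Proof.
move=> [U [oU Up sf]]; apply: (@filterS _ _ _ U); last by apply: open_nbhs_nbhs.
by move=> q Uq; exists U.
Qed.

(** Smoothness on a neighbourhood that may be shrunk: the form in which closure
    properties are proved. *)
Lemma smooth_fun_nbhs f p (P : set M) : smooth_fun f p -> (\forall q \near p, P q) ->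
  exists U : set M, [/\ open U, U p, U `<=` P &
    forall c, atlas c -> smooth_on (cimg c `&` cof c @^-1` U) (f \o cof c)].
Proof.
move=> [U [oU Up sf]] nP; exists (U `&` P^°); split.
- by apply: openI => //; apply: open_interior.
- by [].
- by move=> q [_ /interior_subset].
move=> c ac k; apply: Ck_sub (sf c ac k).
by move=> x [cx [Ux _]].
Qed.

Lemma smooth_eq f g p : (\forall q \near p, f q = g q) -> smooth_fun f p ->
  smooth_fun g p.
Proof.
move=> fg sf; have [U [oU Up UP sU]] := smooth_fun_nbhs sf fg.
exists U; split=> // c ac k; apply: Ck_eq (sU c ac k).
  exact: chart_pre_open.
by move=> x [cx Ux] /=; apply: UP.
Qed.

Lemma smooth_cst (a : R) p : smooth_fun (fun=> a : R) p.
Proof.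
by exists setT; split=> //; [exact: openT | move=> c ac k; apply: Ck_cst].
Qed.

Lemma smooth_op2 (op : R -> R -> R) f g p :
  (forall k U (f g : 'rV[R]_n -> R), open U -> Ck k U f -> Ck k U g ->
     Ck k U (fun x => op (f x) (g x))) ->
  smooth_fun f p -> smooth_fun g p -> smooth_fun (fun q => op (f q) (g q)) p.
Proof.
move=> Cop [U [oU Up sf]] [V [oV Vp sg]]; exists (U `&` V); split=> //.
  exact: openI.
move=> c ac k; apply: Cop; first by apply: chart_pre_open; apply: openI.
- by apply: Ck_sub (sf c ac k) => x [cx []].
- by apply: Ck_sub (sg c ac k) => x [cx []].
Qed.

Lemma smooth_add f g p : smooth_fun f p -> smooth_fun g p ->
  smooth_fun (fun q => f q + g q) p.
Proof. by apply: smooth_op2 => *; apply: Ck_add. Qed.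

Lemma smooth_mul f g p : smooth_fun f p -> smooth_fun g p ->
  smooth_fun (fun q => f q * g q) p.
Proof. by apply: smooth_op2 => *; apply: Ck_mul. Qed.

Lemma smooth_opp f p : smooth_fun f p -> smooth_fun (fun q => - f q) p.
Proof.
move=> sf; have := smooth_mul (smooth_cst (-1) p) sf.
by apply: smooth_eq; apply: nearW => q; rewrite mulN1r.
Qed.

Lemma smooth_sub f g p : smooth_fun f p -> smooth_fun g p ->
  smooth_fun (fun q => f q - g q) p.
Proof. by move=> sf sg; apply: smooth_add => //; apply: smooth_opp. Qed.

Lemma smooth_sum I (r : seq I) (P : pred I) (F : I -> M -> R) p :
  (forall i, P i -> smooth_fun (F i) p) ->
  smooth_fun (fun q => \sum_(i <- r | P i) F i q) p.
Proof.
move=> sF; elim: r => [|i r IH].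
  by apply: smooth_eq (smooth_cst 0 p); apply: nearW => q; rewrite big_nil.
have [Pi|nPi] := boolP (P i).
  apply: smooth_eq (smooth_add (sF i Pi) IH).
  by apply: nearW => q; rewrite big_cons Pi.
by apply: smooth_eq IH; apply: nearW => q; rewrite big_cons (negPf nPi).
Qed.

Lemma smooth_prod I (r : seq I) (P : pred I) (F : I -> M -> R) p :
  (forall i, P i -> smooth_fun (F i) p) ->
  smooth_fun (fun q => \prod_(i <- r | P i) F i q) p.
Proof.
move=> sF; elim: r => [|i r IH].
  by apply: smooth_eq (smooth_cst 1 p); apply: nearW => q; rewrite big_nil.
have [Pi|nPi] := boolP (P i).
  apply: smooth_eq (smooth_mul (sF i Pi) IH).
  by apply: nearW => q; rewrite big_cons Pi.
by apply: smooth_eq IH; apply: nearW => q; rewrite big_cons (negPf nPi).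
Qed.

Lemma smooth_continuous f p : smooth_fun f p -> {for p, continuous f}.
Proof.
move=> [U [oU Up sf]]; have [c [ac cp]] := atlas_cover p.
have cf : {for cto c p, continuous (f \o cof c)}.
  apply: (Ck_cont (sf c ac 0)); split; first exact: cto_img.
  by rewrite /= ctoK.
have := continuous_comp (cto_continuous cp) cf.
rewrite /prop_for /continuous_at /= ctoK // => fp.
apply: cvg_trans fp; apply: near_eq_cvg.
apply: (@filterS _ _ _ (cdom c)); first by move=> q cq /=; rewrite ctoK.
by apply: open_nbhs_nbhs; split=> //; exact: cdom_open.
Qed.

Lemma smooth_neq0_near f p : smooth_fun f p -> f p != 0 ->
  \forall q \near p, f q != 0.
Proof.
move=> sf fp0; have cf := smooth_continuous sf.
by apply: (cf [set x | x != 0]); apply: open_nbhs_nbhs; split=> //; exact: open_neq.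
Qed.

Lemma smooth_gt0_near f p : smooth_fun f p -> 0 < f p ->
  \forall q \near p, 0 < f q.
Proof.
move=> sf fp0; have cf := smooth_continuous sf.
by apply: (cf [set x | 0 < x]); apply: open_nbhs_nbhs; split=> //; exact: open_gt.
Qed.

Lemma smooth_inv f p : smooth_fun f p -> f p != 0 ->
  smooth_fun (fun q => (f q)^-1) p.
Proof.
move=> sf fp0; have [U [oU Up UP sU]] := smooth_fun_nbhs sf (smooth_neq0_near sf fp0).
exists U; split=> // c ac k; apply: Ck_inv (sU c ac k).
  exact: chart_pre_open.
by move=> x [cx Ux] /=; apply: UP.
Qed.

Lemma smooth_expln f p (a : R) : smooth_fun f p -> 0 < f p ->
  smooth_fun (fun q => expR (a * ln (f q))) p.
Proof.
move=> sf fp0; have [U [oU Up UP sU]] := smooth_fun_nbhs sf (smooth_gt0_near sf fp0).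
exists U; split=> // c ac k; apply: Ck_expln (sU c ac k).
  exact: chart_pre_open.
by move=> x [cx Ux] /=; apply: UP.
Qed.

Lemma odd_root_inj k (x y : R) : odd k -> x ^+ k = y ^+ k -> x = y.
Proof.
move=> ok; have k0 : (0 < k)%N by case: k ok.
have odN (z : R) : (- z) ^+ k = - z ^+ k by rewrite exprNn -signr_odd ok mulN1r.
wlog x0 : x y / 0 <= x => [W|].
  have [|/ltW x0 xy] := leP 0 x; first exact: W.
  by apply: oppr_inj; apply: W; rewrite ?oppr_ge0 // !odN xy.
have [y0|y0] := leP 0 y; first by move/eqP; rewrite eqrXn2 // => /eqP.
move=> xy; have : 0 < (- y) ^+ k by rewrite exprn_gt0 // oppr_gt0.
by rewrite odN -xy oppr_gt0 => /lt_geF; rewrite exprn_ge0.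
Qed.

Lemma pos_root_exists k (a : R) : (0 < k)%N -> 0 < a ->
  expR (k%:R^-1 * ln a) ^+ k = a.
Proof.
move=> k0 a0; rewrite -expRM_natl mulrA mulfV ?pnatr_eq0 -?lt0n // mul1r.
by rewrite lnK.
Qed.

Lemma odd_root_exists k (a : R) : odd k -> exists x : R, x ^+ k = a.
Proof.
move=> ok; have k0 : (0 < k)%N by case: k ok.
have [a0|a0|->] := ltgtP a 0.
- exists (- expR (k%:R^-1 * ln (- a))).
  by rewrite exprNn -signr_odd ok mulN1r pos_root_exists ?oppr_gt0 ?opprK.
- by exists (expR (k%:R^-1 * ln a)); rewrite pos_root_exists.
- by exists 0; rewrite expr0n; case: k k0 {ok}.
Qed.

(** Near p, where f has constant sign, g is exp (ln |f| / k) up to that sign. *)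
Lemma smooth_odd_root k f g p : odd k -> smooth_fun f p -> f p != 0 ->
  (\forall q \near p, g q ^+ k = f q) -> smooth_fun g p.
Proof.
move=> ok; have k0 : (0 < k)%N by case: k ok.
have odN (z : R) : (- z) ^+ k = - z ^+ k by rewrite exprNn -signr_odd ok mulN1r.
wlog fp0 : f g / 0 < f p => [W|].
  move=> sf fp0 gf; have [|f0|/eqP] := ltgtP 0 (f p).
  - by move=> h; apply: (W f).
  - have := W (fun q => - f q) (fun q => - g q).
    rewrite oppr_gt0 oppr_eq0 => /(_ f0 (smooth_opp sf) fp0) h.
    apply: smooth_eq (smooth_opp (h _)); first by apply: nearW => q; rewrite opprK.
    by apply: filterS gf => q; rewrite odN => ->.
  - by rewrite eq_sym (negPf fp0).
move=> sf _ gf; apply: smooth_eq (smooth_expln k%:R^-1 sf fp0).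
have := smooth_gt0_near sf fp0; apply: filter_app; apply: filterS gf => q gq fq.
by apply: (odd_root_inj ok); rewrite pos_root_exists.
Qed.

End SmoothFun.

(** * Multilinear forms *)

Arguments fapp : simpl never.
Arguments happ : simpl never.

Section FormTheory.
Context {R : realType}.

Section Upd.
Variables (T : Type) (k : nat).
Implicit Types (v : 'I_k -> T) (i j : 'I_k) (x y : T).

Lemma upd_same v i x : upd v i x i = x.
Proof. by rewrite /upd eqxx. Qed.

Lemma upd_other v i j x : j != i -> upd v i x j = v j.
Proof. by rewrite /upd => /negPf->. Qed.

Lemma upd_id v i : upd v i (v i) = v.
Proof. by apply/funext => j; rewrite /upd; case: eqP => // ->. Qed.

Lemma upd_upd v i x y : upd (upd v i x) i y = upd v i y.
Proof. by apply/funext => j; rewrite /upd; case: eqP. Qed.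

Lemma upd_comm v i j x y : i != j ->
  upd (upd v i x) j y = upd (upd v j y) i x.
Proof.
move=> ij; apply/funext => m; rewrite /upd.
by case: (m =P j) => // ->; case: eqP => // ji; rewrite ji eqxx in ij.
Qed.

Lemma upd_map (S : Type) (f : T -> S) v i x :
  f \o upd v i x = upd (f \o v) i (f x).
Proof. by apply/funext => j; rewrite /upd /=; case: eqP. Qed.

Lemma upd_perm v (s : 'S_k) i x : upd v (s i) x \o s = upd (v \o s) i x.
Proof. by apply/funext => j; rewrite /upd /= (inj_eq perm_inj). Qed.

End Upd.

Section Forms.
Variables (kd : form_kind) (k : nat) (V W : lmodType R).
Implicit Types (A B : elt (forms kd k V W)) (v : 'I_k -> V).

Lemma form_eqP A B : (forall v, fapp A v = fapp B v) -> A = B.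
Proof. by move=> AB; apply: val_inj; apply/funext. Qed.

Lemma mk_formE (f : ('I_k -> V) -> W) : is_form kd f ->
  forall v, fapp (mk_form kd f) v = f v.
Proof. by move=> ff v; rewrite /fapp /mk_form to_eltK. Qed.

Lemma fapp_form A : is_form kd (fapp A).
Proof. exact: (elt_set A). Qed.

Section Linear.
Variables (f : ('I_k -> V) -> W) (ff : is_form kd f).

Lemma is_form_lin v i a x y :
  f (upd v i (a *: x + y)) = a *: f (upd v i x) + f (upd v i y).
Proof. by case: ff. Qed.

Lemma is_form_upd0 v i : f (upd v i 0) = 0.
Proof.
have := is_form_lin v i (-1) 0 0.
by rewrite scaler0 addr0 scaleN1r addNr.
Qed.

Lemma is_formD v i x y : f (upd v i (x + y)) = f (upd v i x) + f (upd v i y).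
Proof. by have := is_form_lin v i 1 x y; rewrite !scale1r. Qed.

Lemma is_formZ v i a x : f (upd v i (a *: x)) = a *: f (upd v i x).
Proof. by have := is_form_lin v i a x 0; rewrite is_form_upd0 !addr0. Qed.

Lemma is_form_sum v i I (r : seq I) (F : I -> V) :
  f (upd v i (\sum_(j <- r) F j)) = \sum_(j <- r) f (upd v i (F j)).
Proof.
elim: r => [|j r IH]; first by rewrite !big_nil is_form_upd0.
by rewrite !big_cons is_formD IH.
Qed.

End Linear.

End Forms.

Lemma alt_swap k (V W : lmodType R) (f : ('I_k -> V) -> W) :
  is_form Alt f -> forall v i j x, i != j -> v i = v j ->
  f (upd v i x) = - f (upd v j x).
Proof.
move=> ff v i j x ij vij; have [_ alt] := ff.
apply/eqP; rewrite -addr_eq0; apply/eqP.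
pose w := upd (upd v i x) j x.
have ji : j != i by rewrite eq_sym.
have : f (upd (upd v i (x + v i)) j (x + v i)) = 0.
  by apply: (alt _ i j) => //; rewrite upd_same upd_other // upd_same.
rewrite (is_formD ff) upd_comm // (upd_comm _ _ _ ij) !(is_formD ff).
rewrite -(upd_comm _ _ _ ij) (alt _ i j) //; last first.
  by rewrite upd_same upd_other // upd_same.
rewrite -(upd_comm _ (v i) (v i) ij) (alt (upd (upd v i (v i)) j (v i)) i j) //; last first.
  by rewrite upd_same upd_other // upd_same.
rewrite add0r addr0 -(upd_comm _ (v i) x ij) upd_id.
have -> : upd v j (v i) = v by rewrite vij upd_id.
by rewrite addrC.
Qed.

(** ** Lists of arguments *)

Lemma args1E (V : Type) (v : 'I_1 -> V) : v = [args v 0].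
Proof. by apply/funext => i; rewrite (tnth_nth (v 0)) (ord1 i). Qed.

Lemma args2E (V : Type) (v : 'I_2 -> V) : v = [args v 0; v 1].
Proof.
apply/funext => -[[|[|//]] hi]; rewrite (tnth_nth (v 0)) /=;
  by congr v; apply: val_inj.
Qed.

Lemma args3E (V : Type) (v : 'I_3 -> V) : v = [args v 0; v 1; v 2].
Proof.
apply/funext => -[[|[|[|//]]] hi]; rewrite (tnth_nth (v 0)) /=;
  by congr v; apply: val_inj.
Qed.

Lemma upd1 (V : Type) (v : 'I_1 -> V) i x : upd v i x = [args x].
Proof. by rewrite [LHS]args1E /upd (ord1 i). Qed.

Lemma upd20 (V : Type) (x y z : V) : upd [args x; y] 0 z = [args z; y].
Proof. by rewrite [LHS]args2E /upd /= !(tnth_nth x). Qed.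

Lemma upd21 (V : Type) (x y z : V) : upd [args x; y] 1 z = [args x; z].
Proof. by rewrite [LHS]args2E /upd /= !(tnth_nth x). Qed.

Lemma upd30 (V : Type) (x y z t : V) : upd [args x; y; z] 0 t = [args t; y; z].
Proof. by rewrite [LHS]args3E /upd /= !(tnth_nth x). Qed.

Lemma upd31 (V : Type) (x y z t : V) : upd [args x; y; z] 1 t = [args x; t; z].
Proof. by rewrite [LHS]args3E /upd /= !(tnth_nth x). Qed.

Lemma upd32 (V : Type) (x y z t : V) : upd [args x; y; z] 2 t = [args x; y; t].
Proof. by rewrite [LHS]args3E /upd /= !(tnth_nth x). Qed.

Section Bilinear.
Variables (V W : lmodType R) (kd : form_kind).
Variables (f : ('I_2 -> V) -> W) (ff : is_form kd f).

Lemma form2_updl x z : f [args x; z] = f (upd [args 0; z] 0 x).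
Proof. by rewrite upd20. Qed.

Lemma form2_updr x z : f [args z; x] = f (upd [args z; 0] 1 x).
Proof. by rewrite upd21. Qed.

Lemma form2_linl a x y z :
  f [args a *: x + y; z] = a *: f [args x; z] + f [args y; z].
Proof. by rewrite form2_updl (is_form_lin ff) -!form2_updl. Qed.

Lemma form2_linr a x y z :
  f [args z; a *: x + y] = a *: f [args z; x] + f [args z; y].
Proof. by rewrite form2_updr (is_form_lin ff) -!form2_updr. Qed.

Lemma form2Dl x y z : f [args x + y; z] = f [args x; z] + f [args y; z].
Proof. by rewrite form2_updl (is_formD ff) -!form2_updl. Qed.

Lemma form2Dr x y z : f [args z; x + y] = f [args z; x] + f [args z; y].
Proof. by rewrite form2_updr (is_formD ff) -!form2_updr. Qed.

Lemma form2Zl a x z : f [args a *: x; z] = a *: f [args x; z].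
Proof. by rewrite form2_updl (is_formZ ff) -form2_updl. Qed.

Lemma form2Zr a x z : f [args z; a *: x] = a *: f [args z; x].
Proof. by rewrite form2_updr (is_formZ ff) -form2_updr. Qed.

Lemma form2_suml I (r : seq I) (F : I -> V) z :
  f [args \sum_(j <- r) F j; z] = \sum_(j <- r) f [args F j; z].
Proof.
rewrite form2_updl (is_form_sum ff).
by apply: eq_bigr => j _; rewrite -form2_updl.
Qed.

Lemma form2_sumr I (r : seq I) (F : I -> V) z :
  f [args z; \sum_(j <- r) F j] = \sum_(j <- r) f [args z; F j].
Proof.
rewrite form2_updr (is_form_sum ff).
by apply: eq_bigr => j _; rewrite -form2_updr.
Qed.

End Bilinear.

Lemma is_form1 (V W : lmodType R) (g : V -> W) :
  (forall a x y, g (a *: x + y) = a *: g x + g y) ->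
  is_form Any (fun v : 'I_1 -> V => g (v 0)).
Proof. by move=> gl; split=> // v i a x y; rewrite (ord1 i) !upd_same gl. Qed.

Lemma is_form2 (V W : lmodType R) (g : V -> V -> W) :
  (forall a x y z, g (a *: x + y) z = a *: g x z + g y z) ->
  (forall a x y z, g z (a *: x + y) = a *: g z x + g z y) ->
  is_form Any (fun v : 'I_2 -> V => g (v 0) (v 1)).
Proof.
move=> gl gr; split=> // v i a x y.
have [->|->] : i = 0 \/ i = 1.
  by case: i => -[|[|//]] hi; [left|right]; apply: val_inj.
- by rewrite !upd_same !upd_other.
- by rewrite !upd_same !upd_other.
Qed.

Lemma is_form2_alt (V W : lmodType R) (f : ('I_2 -> V) -> W) :
  is_form Any f -> (forall x, f [args x; x] = 0) -> is_form Alt f.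
Proof.
move=> [fl _] fa; split=> // v i j ij vij.
have v01 : v 0 = v 1.
  have e0 (h : (0 < 2)%N) : Ordinal h = 0 by apply: val_inj.
  have e1 (h : (1 < 2)%N) : Ordinal h = 1 by apply: val_inj.
  by case: i j ij vij => -[|[|//]] hi; case=> -[|[|//]] hj //= _;
    rewrite e0 e1.
by rewrite [v]args2E v01 fa.
Qed.

Lemma alt2_diag (V W : lmodType R) (f : ('I_2 -> V) -> W) (ff : is_form Alt f) x :
  f [args x; x] = 0.
Proof. by case: ff => _ /(_ [args x; x] 0 1); apply; rewrite // !(tnth_nth x). Qed.

Lemma alt2_anti (V W : lmodType R) (f : ('I_2 -> V) -> W) (ff : is_form Alt f) x y :
  f [args x; y] = - f [args y; x].
Proof.
apply/eqP; rewrite -addr_eq0.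
have := alt2_diag ff (x + y).
by rewrite (form2Dl ff) !(form2Dr ff) !(alt2_diag ff) add0r addr0 => ->.
Qed.

Lemma alt2_span2 (V W : lmodType R) (f : ('I_2 -> V) -> W) (ff : is_form Alt f)
    (x y : V) (a b c d : R) :
  f [args a *: x + b *: y; c *: x + d *: y] = (a * d - b * c) *: f [args x; y].
Proof.
rewrite (form2_linl ff) (form2Zl ff) !(form2_linr ff) !(form2Zr ff) !(alt2_diag ff).
rewrite (alt2_anti ff y) !scaler0 add0r addr0 !scalerN scalerBl !scalerA.
by [].
Qed.

(** ** Symmetric forms in two variables *)

(** The value at (a_1 x + b_1 y, ..., a_k x + b_k y) of the symmetric form that takes
    the value c_j on j copies of y and k - j copies of x. *)
Fixpoint pol (W : lmodType R) (l : seq (R * R)) (c : nat -> W) : W :=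
  if l is ab :: l' then ab.1 *: pol l' c + ab.2 *: pol l' (c \o S) else c 0%N.

Section Pol.
Variable W : lmodType R.
Implicit Types (l : seq (R * R)) (c : nat -> W).

Lemma eq_pol l c c' : (forall j, (j <= size l)%N -> c j = c' j) ->
  pol l c = pol l c'.
Proof.
elim: l c c' => [|ab l IH] c c' cc /=; first exact: cc.
congr (_ *: _ + _ *: _); apply: IH => j jl; last exact: cc.
by apply: cc; rewrite ltnW.
Qed.

Lemma pol_swap ab ab' l c : pol [:: ab, ab' & l] c = pol [:: ab', ab & l] c.
Proof.
rewrite /= !scalerDr !scalerA !addrA -!addrA; congr (_ + _); first by rewrite mulrC.
by rewrite addrCA; congr (_ + (_ + _)); rewrite mulrC.
Qed.

Lemma pol_perm l l' c : perm_eq l l' -> pol l c = pol l' c.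
Proof.
have mid ab l1 l2 (d : nat -> W) : pol (l1 ++ ab :: l2) d = pol (ab :: l1 ++ l2) d.
  elim: l1 d => // ab' l1 IH d.
  by rewrite -[RHS]/(pol [:: ab, ab' & l1 ++ l2] d) pol_swap /= !IH.
elim: l l' c => [|ab l IH] l' c pll'.
  by move: pll'; rewrite perm_sym => /perm_nilP ->.
have abl' : ab \in l' by rewrite -(perm_mem pll') mem_head.
case/splitPr: abl' pll' => l1 l2; rewrite mid.
rewrite perm_sym -cat1s perm_catCA /= perm_cons perm_sym => pll'.
by rewrite /= !(IH _ _ pll').
Qed.

Variables (k : nat) (V : lmodType R) (ca cb : V -> R).
Hypothesis ca_lin : forall a x y, ca (a *: x + y) = a * ca x + ca y.
Hypothesis cb_lin : forall a x y, cb (a *: x + y) = a * cb x + cb y.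

Definition polform c (v : 'I_k -> V) : W :=
  pol [seq (ca (v i), cb (v i)) | i <- enum 'I_k] c.

Lemma polform_sym c : is_form Sym (polform c).
Proof.
split=> [v i a x y|s v]; rewrite /polform.
  have E z : pol [seq (ca (upd v i z j), cb (upd v i z j)) | j <- enum 'I_k] c =
    pol ((ca z, cb z) :: [seq (ca (v j), cb (v j)) | j <- rem i (enum 'I_k)]) c.
    have pe := perm_to_rem (mem_enum 'I_k i : i \in enum 'I_k).
    rewrite (pol_perm _ (perm_map _ pe)) map_cons upd_same.
    congr (pol (_ :: _) _); apply/eq_in_map => j; rewrite mem_rem_uniq ?enum_uniq //.
    by rewrite inE => /andP[ji _]; rewrite upd_other.
  rewrite !E /= ca_lin cb_lin !scalerDl !scalerDr !scalerA.
  by rewrite -!addrA; congr (_ + _); rewrite addrCA.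
have -> : [seq (ca ((v \o s) i), cb ((v \o s) i)) | i <- enum 'I_k] =
    [seq (ca (v i), cb (v i)) | i <- [seq s i | i <- enum 'I_k]].
  by rewrite -map_comp.
apply: pol_perm; apply: perm_map; apply: uniq_perm.
- by rewrite map_inj_uniq ?enum_uniq //; apply: perm_inj.
- exact: enum_uniq.
move=> i; rewrite mem_enum; apply/mapP; exists (s^-1%g i); rewrite ?mem_enum //.
by rewrite permKV.
Qed.

End Pol.

Definition vcons (V : Type) k (x : V) (v : 'I_k -> V) : 'I_k.+1 -> V :=
  fun i => if unlift ord0 i is Some j then v j else x.

Lemma vcons0 (V : Type) k (x : V) (v : 'I_k -> V) : vcons x v ord0 = x.
Proof. by rewrite /vcons unlift_none. Qed.

Lemma vconsS (V : Type) k (x : V) (v : 'I_k -> V) j : vcons x v (lift ord0 j) = v j.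
Proof. by rewrite /vcons liftK. Qed.

Lemma vcons_eta (V : Type) k (v : 'I_k.+1 -> V) :
  v = vcons (v ord0) (v \o lift ord0).
Proof. by apply/funext => i; case: (unliftP ord0 i) => [j|] ->; rewrite ?vconsS ?vcons0. Qed.

Lemma vcons_upd (V : Type) k (x y : V) (v : 'I_k -> V) j :
  vcons x (upd v j y) = upd (vcons x v) (lift ord0 j) y.
Proof.
apply/funext => i; case: (unliftP ord0 i) => [m|] ->.
  by rewrite vconsS /upd (inj_eq lift_inj) vconsS.
by rewrite upd_other ?vcons0 // neq_lift.
Qed.

Lemma upd_vcons (V : Type) k (x y : V) (v : 'I_k -> V) :
  upd (vcons x v) ord0 y = vcons y v.
Proof.
apply/funext => i; case: (unliftP ord0 i) => [m|] ->.
  by rewrite upd_other ?vconsS // eq_sym neq_lift.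
by rewrite upd_same vcons0.
Qed.

Definition word (V : Type) (x y : V) k (j : nat) : 'I_k -> V :=
  fun i => if (i < j)%N then y else x.

(** Expand one argument at a time, and sort each resulting word in x and y by
    symmetry. *)
Lemma sym_form_pol k (V W : lmodType R) (f : ('I_k -> V) -> W) (x y : V)
    (a b : 'I_k -> R) : is_form Sym f ->
  f (fun i => a i *: x + b i *: y) =
    pol [seq (a i, b i) | i <- enum 'I_k] (fun j => f (word x y j)).
Proof.
elim: k f a b => [|k IH] f a b ff.
  rewrite (_ : enum 'I_0 = [::]) /=; last by apply: size0nil; rewrite size_enum_ord.
  by congr f; apply/funext => -[].
have fv z : is_form Sym (fun v : 'I_k -> V => f (vcons z v)).
  split=> [v i c u w|s v]; first by rewrite !vcons_upd (is_form_lin ff).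
  have [_ /(_ (lift_perm ord0 ord0 s) (vcons z v)) <-] := ff.
  congr f; apply/funext => i; case: (unliftP ord0 i) => [m|] -> /=.
    by rewrite vconsS lift_perm_lift vconsS.
  by rewrite lift_perm_id !vcons0.
rewrite [X in f X]vcons_eta -(upd_vcons 0) (is_form_lin ff) (is_formZ ff) !upd_vcons.
rewrite enum_ordSl /= -map_comp !(IH _ _ _ (fv _)).
congr (_ *: _ + _ *: _); apply: eq_pol => j; rewrite size_map size_enum_ord => jk.
  pose j' := Ordinal (jk : (j < k.+1)%N).
  have [_ /(_ (tperm ord0 j') (word x y j)) <-] := ff.
  congr f; apply/funext => i; rewrite /word /=.
  case: (unliftP ord0 i) => [m|] ->.
    rewrite vconsS; case: tpermP => [/eqP|e|_ /eqP e].
    - by rewrite eq_sym (negPf (neq_lift _ _)).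
    - have := congr1 val e; rewrite /= /bump leq0n add1n => <-.
      by rewrite ltnSn.
    - rewrite /= /bump leq0n add1n; move: e; rewrite -val_eqE /= /bump leq0n add1n.
      by move=> mj; rewrite [in RHS]ltn_neqAle mj.
  by rewrite vcons0 tpermL /= ltnn.
congr f; apply/funext => i; case: (unliftP ord0 i) => [m|] ->.
  by rewrite vconsS /word /= /bump leq0n add1n.
by rewrite vcons0 /word.
Qed.

End FormTheory.

Global Opaque mk_form.

(** * Smooth sections and frames *)

Section BundleTheory.
Context {R : realType} {n : nat} {M : manifold R n}.
Implicit Types (E F : prebundle M) (p q : M) (U : set M).

(** All that is needed of the bundle in which a form-valued operator takes its
    values. Unlike local triviality, it passes to bundles of forms without a frame at
    hand. *)
Record smooth_module F p : Prop := SmoothModule {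
  sm_eq : forall s t : section F, (\forall q \near p, s q = t q) ->
    smooth_sec s p -> smooth_sec t p;
  sm_zero : smooth_sec (fun q => 0 : F q) p;
  sm_lin : forall f (s t : section F), smooth_fun f p -> smooth_sec s p ->
    smooth_sec t p -> smooth_sec (fun q => f q *: s q + t q) p }.

Section ModuleTheory.
Variables (F : prebundle M) (p : M).
Hypothesis smF : smooth_module F p.

Lemma sm_add s t : smooth_sec s p -> smooth_sec t p ->
  smooth_sec (fun q => s q + t q : F q) p.
Proof.
move=> ss st; apply: sm_eq smF _ _ _ (sm_lin smF (smooth_cst 1 p) ss st).
by apply: nearW => q; rewrite scale1r.
Qed.

Lemma sm_scale f s : smooth_fun f p -> smooth_sec s p ->
  smooth_sec (fun q => f q *: s q : F q) p.
Proof.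
move=> sf ss; apply: sm_eq smF _ _ _ (sm_lin smF sf ss (sm_zero smF)).
by apply: nearW => q; rewrite addr0.
Qed.

Lemma sm_sum I (r : seq I) (s : I -> section F) :
  (forall i, smooth_sec (s i) p) ->
  smooth_sec (fun q => \sum_(i <- r) s i q) p.
Proof.
move=> ss; elim: r => [|i r IH].
  by apply: sm_eq smF _ _ _ (sm_zero smF); apply: nearW => q; rewrite big_nil.
apply: sm_eq smF _ _ _ (sm_add (ss i) IH).
by apply: nearW => q; rewrite big_cons.
Qed.

End ModuleTheory.

Lemma triv_module p : smooth_module (@trivb R n M) p.
Proof.
split; first by move=> s t st; apply: smooth_eq.
  exact: (smooth_cst (0 : R) p).
by move=> f s t sf ss st; apply: smooth_add => //; apply: smooth_mul.
Qed.

Lemma form_module kd k E F p : smooth_module F p ->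
  smooth_module (formb kd k E F) p.
Proof.
move=> smF; split=> [A B AB sA s ss|s ss|f A B sf sA sB s ss].
- apply: sm_eq smF _ _ _ (sA s ss).
  by apply: filterS AB => q ->.
- exact: sm_zero smF.
- by have h := sm_lin smF sf (sA s ss) (sB s ss); exact: h.
Qed.

Lemma sub_module E (W : forall p, lin_subspace (E p)) p :
  smooth_module E p -> smooth_module (subb W) p.
Proof.
move=> smE; split=> [s t st|| f s t sf ss st].
- by apply: sm_eq smE _ _ _; apply: filterS st => q ->.
- exact: sm_zero smE.
- by have h := sm_lin smE sf ss st; exact: h.
Qed.

Lemma happ_lin E F p (A : homb E F p) a u v :
  happ A (a *: u + v) = a *: happ A u + happ A v.
Proof. by rewrite /happ -!(upd1 (fun=> 0) 0) (is_form_lin (fapp_form A)). Qed.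

Lemma happ0 E F p (A : homb E F p) : happ A 0 = 0.
Proof. by rewrite /happ -(upd1 (fun=> 0) 0) (is_form_upd0 (fapp_form A)). Qed.

Lemma happZ E F p (A : homb E F p) a u : happ A (a *: u) = a *: happ A u.
Proof. by rewrite -[a *: u]addr0 happ_lin happ0 addr0. Qed.

Lemma happD E F p (A : homb E F p) u v : happ A (u + v) = happ A u + happ A v.
Proof. by rewrite -[u]scale1r happ_lin !scale1r. Qed.

Lemma happN E F p (A : homb E F p) u : happ A (- u) = - happ A u.
Proof. by rewrite -scaleN1r happZ scaleN1r. Qed.

Lemma happB E F p (A : homb E F p) u v : happ A (u - v) = happ A u - happ A v.
Proof. by rewrite happD happN. Qed.

Lemma happ_sum E F p (A : homb E F p) I (r : seq I) (u : I -> E p) :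
  happ A (\sum_(i <- r) u i) = \sum_(i <- r) happ A (u i).
Proof.
by elim: r => [|i r IH]; rewrite ?big_nil ?happ0 // !big_cons happD IH.
Qed.

Section FormValues.
Variables (kd : form_kind) (k : nat) (E F : prebundle M) (p : M).
Implicit Types (A B : formb kd k E F p) (v : 'I_k -> E p).

Lemma bfappZ a A v : fapp (a *: A) v = a *: fapp A v. Proof. by []. Qed.
Lemma bfappD A B v : fapp (A + B) v = fapp A v + fapp B v. Proof. by []. Qed.
Lemma bfappN A v : fapp (- A) v = - fapp A v. Proof. by []. Qed.
Lemma bfapp0 v : fapp (0 : formb kd k E F p) v = 0. Proof. by []. Qed.
Lemma bfapp_sum I (r : seq I) (A : I -> formb kd k E F p) v :
  fapp (\sum_(i <- r) A i) v = \sum_(i <- r) fapp (A i) v.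
Proof. by elim/big_rec2: _ => // i x y _ <-. Qed.

End FormValues.

Section HomValues.
Variables (E F : prebundle M) (p : M).
Implicit Types (A B : homb E F p) (v : E p).

Lemma happZl a A v : happ (a *: A) v = a *: happ A v. Proof. by []. Qed.
Lemma happDl A B v : happ (A + B) v = happ A v + happ B v. Proof. by []. Qed.
Lemma happNl A v : happ (- A) v = - happ A v. Proof. by []. Qed.
Lemma happ0l v : happ (0 : homb E F p) v = 0. Proof. by []. Qed.
Lemma happ_suml I (r : seq I) (A : I -> homb E F p) v :
  happ (\sum_(i <- r) A i) v = \sum_(i <- r) happ (A i) v.
Proof. by rewrite /happ bfapp_sum. Qed.

End HomValues.

Lemma happ_mk E F p (g : E p -> F p) v :
  (forall a x y, g (a *: x + y) = a *: g x + g y) ->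
  happ (mk_form Any (fun v : 'I_1 -> E p => g (v 0)) : homb E F p) v = g v.
Proof. by move=> gl; rewrite /happ mk_formE //; apply: is_form1. Qed.

Lemma hom_eqP E F p (A B : homb E F p) :
  (forall v, happ A v = happ B v) -> A = B.
Proof. by move=> AB; apply: form_eqP => v; rewrite [v]args1E; apply: AB. Qed.

Lemma smooth_happ E F (A : section (homb E F)) (s : section E) p :
  smooth_sec A p -> smooth_sec s p -> smooth_sec (fun q => happ (A q) (s q)) p.
Proof.
move=> sA ss; have := sA (fun=> s) (fun=> ss).
congr (smooth_sec _ p); apply: functional_extensionality_dep => q.
by rewrite /happ [in LHS](args1E (fun=> s q)).
Qed.

Lemma smooth_happP E F (A : section (homb E F)) p :
  (forall s : section E, smooth_sec s p -> smooth_sec (fun q => happ (A q) (s q)) p) ->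
  smooth_sec A p.
Proof.
move=> sA s ss; have := sA (s 0) (ss 0).
congr (smooth_sec _ p); apply: functional_extensionality_dep => q.
by rewrite /happ [in RHS](args1E (s^~ q)).
Qed.

Lemma smooth_fapp2 kd E F (A : section (formb kd 2 E F)) (s t : section E) p :
  smooth_sec A p -> smooth_sec s p -> smooth_sec t p ->
  smooth_sec (fun q => fapp (A q) [args s q; t q]) p.
Proof.
move=> sA ss st; have := sA [args s; t].
have h : forall i, smooth_sec ([args s; t] i) p.
  by case=> -[|[|//]] hi; rewrite (tnth_nth s).
move=> /(_ h); congr (smooth_sec _ p); apply: functional_extensionality_dep => q.
by congr fapp; rewrite [LHS]args2E !(tnth_nth s).
Qed.

Section Frame.
Context {E : prebundle M} {r : nat} {U : set M} {e : 'I_r -> section E}.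
Hypothesis Fr : is_frame U e.

Definition coord q (v : E q) : 'I_r -> R :=
  xget (fun=> 0) [set c | v = \sum_i c i *: e i q].

Lemma coordK q (v : E q) : U q -> \sum_i coord v i *: e i q = v.
Proof.
move=> Uq; have [_ /(_ q Uq v) [c [vc _]] _] := Fr.
have h : exists c : 'I_r -> R, [set c | v = \sum_i c i *: e i q] c by exists c.
by have /= := xgetPex (fun=> 0) h.
Qed.

Lemma coord_sum q (c : 'I_r -> R) : U q -> coord (\sum_i c i *: e i q) = c.
Proof.
move=> Uq; have [_ /(_ q Uq (\sum_i c i *: e i q)) [c0 [vc cu]] _] := Fr.
by transitivity c0; [symmetry; apply: cu; rewrite coordK | apply: cu].
Qed.

Lemma coord_frame q i j : U q -> coord (e i q) j = (i == j)%:R.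
Proof.
move=> Uq; have -> : e i q = \sum_m (i == m)%:R *: e m q.
  rewrite (bigD1 i) //= eqxx scale1r big1 ?addr0 // => m.
  by rewrite eq_sym => /negPf->; rewrite scale0r.
by rewrite coord_sum.
Qed.

Lemma coord_lin q a (u v : E q) i : U q ->
  coord (a *: u + v) i = a * coord u i + coord v i.
Proof.
move=> Uq; rewrite -{1}(coordK u Uq) -{1}(coordK v Uq).
have -> : a *: (\sum_i coord u i *: e i q) + \sum_i coord v i *: e i q =
    \sum_i (a * coord u i + coord v i) *: e i q.
  rewrite scaler_sumr -big_split /=; apply: eq_bigr => j _.
  by rewrite scalerDl scalerA.
by rewrite coord_sum.
Qed.

Lemma frame_nbhs p : U p -> \forall q \near p, U q.
Proof. by have [oU _ _] := Fr => Up; apply: open_nbhs_nbhs. Qed.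

Lemma smooth_coord (s : section E) q : U q ->
  smooth_sec s q <-> forall i, smooth_fun (fun x => coord (s x) i) q.
Proof.
move=> Uq; have [_ _ /(_ s q Uq) h] := Fr; split.
  move=> /h[c sc sE] i; apply: smooth_eq (sc i).
  have := frame_nbhs Uq; apply: filter_app; apply: filterS sE => x sx Ux.
  by rewrite sx coord_sum.
move=> sc; apply/h; exists (fun i x => coord (s x) i) => //.
by apply: filterS (frame_nbhs Uq) => x Ux; rewrite coordK.
Qed.

Lemma smooth_frame i p : U p -> smooth_sec (e i) p.
Proof.
move=> Up; apply/(smooth_coord _ Up) => j.
apply: smooth_eq (smooth_cst (i == j)%:R p).
by apply: filterS (frame_nbhs Up) => q Uq; rewrite coord_frame.
Qed.

Lemma frame_module p : U p -> smooth_module E p.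
Proof.
move=> Up; split=> [s t st||f s t sf].
- move=> /(smooth_coord _ Up) sc; apply/(smooth_coord _ Up) => i.
  by apply: smooth_eq (sc i); apply: filterS st => q ->.
- apply/(smooth_coord _ Up) => i; apply: smooth_eq (smooth_cst 0 p).
  apply: filterS (frame_nbhs Up) => q Uq.
  rewrite [X in coord X](_ : _ = \sum_i (0 : R) *: e i q) ?coord_sum //.
  by rewrite big1 // => j _; rewrite scale0r.
- move=> /(smooth_coord _ Up) ss /(smooth_coord _ Up) st.
  apply/(smooth_coord _ Up) => i.
  apply: smooth_eq (smooth_add (smooth_mul sf (ss i)) (st i)).
  by apply: filterS (frame_nbhs Up) => q Uq; rewrite coord_lin.
Qed.

Lemma smooth_comb p (c : 'I_r -> M -> R) : U p -> (forall i, smooth_fun (c i) p) ->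
  smooth_sec (fun q => \sum_i c i q *: e i q) p.
Proof.
move=> Up sc; apply/(smooth_coord _ Up) => i; apply: smooth_eq (sc i).
by apply: filterS (frame_nbhs Up) => q Uq; rewrite coord_sum.
Qed.

Lemma smooth_sec_near (s : section E) p : U p -> smooth_sec s p ->
  \forall q \near p, smooth_sec s q.
Proof.
move=> Up /(smooth_coord _ Up) ss.
have : \forall q \near p, forall i, smooth_fun (fun x => coord (s x) i) q.
  by apply: filter_forall => i; apply: smooth_near.
have := frame_nbhs Up; apply: filter_app2; apply: nearW => q Uq sq.
exact/(smooth_coord _ Uq).
Qed.

Definition ext p (v : E p) : section E := fun q => \sum_i coord v i *: e i q.

Lemma ext_at p (v : E p) : U p -> ext v p = v.
Proof. exact: coordK. Qed.

Lemma smooth_ext p (v : E p) q : U q -> smooth_sec (ext v) q.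
Proof. by move=> Uq; apply: smooth_comb => // i; apply: smooth_cst. Qed.

Lemma ext_lin p a (u v : E p) : U p ->
  ext (a *: u + v) = (fun q => a *: ext u q + ext v q).
Proof.
move=> Up; apply/functional_extensionality_dep => q.
rewrite /ext scaler_sumr -big_split /=; apply: eq_bigr => i _.
by rewrite coord_lin // scalerDl scalerA.
Qed.

(** Expanding the arguments in a frame, one after the other, leaves an expression in
    their values at p. *)
Lemma tensorial kd k (W : lmodType R) p (Phi : ('I_k -> section E) -> W) :
  U p ->
  (forall s i f u v, (forall j, smooth_sec (s j) p) -> smooth_fun f p ->
     smooth_sec u p -> smooth_sec v p ->
     Phi (upd s i (fun q => f q *: u q + v q)) =
       f p *: Phi (upd s i u) + Phi (upd s i v)) ->
  (forall s i u v, (forall j, smooth_sec (s j) p) ->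
     smooth_sec u p -> smooth_sec v p -> (\forall q \near p, u q = v q) ->
     Phi (upd s i u) = Phi (upd s i v)) ->
  match kd with
  | Any => True
  | Defs.Sym => forall (g : 'S_k) s, (forall j, smooth_sec (s j) p) ->
      Phi (s \o g) = Phi s
  | Alt => forall s i j, (forall j, smooth_sec (s j) p) -> i != j -> s i = s j ->
      Phi s = 0
  end ->
  exists B : elt (forms kd k (E p) W), forall s, (forall i, smooth_sec (s i) p) ->
    fapp B (fun i => s i p) = Phi s.
Proof.
move=> Up lin loc sym.
have smE := frame_module Up.
have s_upd s i u : (forall j, smooth_sec (s j) p) -> smooth_sec u p ->
    forall j, smooth_sec (@upd (section E) k s i u j) p.
  by move=> ss su j; rewrite /upd; case: ifP.
have Phi0 s i : (forall j, smooth_sec (s j) p) -> Phi (upd s i (fun q => 0)) = 0.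
  move=> ss; have := lin s i _ _ _ ss (smooth_cst (-1) p) (sm_zero smE) (sm_zero smE).
  rewrite scaleN1r addNr => <-; congr (Phi (upd s i _)).
  by apply/functional_extensionality_dep => q; rewrite scaler0 addr0.
have Phi_sum s i (c : 'I_r -> M -> R) : (forall j, smooth_sec (s j) p) ->
    (forall j, smooth_fun (c j) p) ->
    Phi (upd s i (fun q => \sum_j c j q *: e j q)) =
    \sum_j c j p *: Phi (upd s i (e j)).
  move=> ss sc; elim: (index_enum _) => [|j l IH].
    rewrite big_nil -(Phi0 s i ss); congr (Phi (upd s i _)).
    by apply/functional_extensionality_dep => q; rewrite big_nil.
  rewrite big_cons -IH -lin //.
  - congr (Phi (upd s i _)).
    by apply/functional_extensionality_dep => q; rewrite big_cons.
  - exact: smooth_frame.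
  - by apply: sm_sum => // m; apply: sm_scale => //; apply: smooth_frame.
have Phi_ext s i u : (forall j, smooth_sec (s j) p) -> smooth_sec u p ->
    Phi (upd s i u) = Phi (upd s i (ext (u p))).
  move=> ss su; rewrite [RHS]Phi_sum //; last by move=> j; apply: smooth_cst.
  rewrite -(Phi_sum s i (fun j q => coord (u q) j)) //; last first.
    exact/(smooth_coord u Up).
  apply: loc => //; first by apply: smooth_comb => //; apply/(smooth_coord u Up).
  by apply: filterS (frame_nbhs Up) => q Uq; rewrite coordK.
have Phi_all s : (forall j, smooth_sec (s j) p) ->
    Phi s = Phi (fun i => ext (s i p)).
  move=> ss; pose sm m := fun i : 'I_k => if (i < m)%N then ext (s i p) else s i.
  have ssm m j : smooth_sec (sm m j) p.
    by rewrite /sm; case: ifP => // _; apply: smooth_ext.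
  have step m : (m <= k)%N -> Phi (sm m) = Phi s.
    elim: m => [|m IH] mk; first by congr Phi; apply/funext.
    rewrite -IH ?(ltnW mk) //; pose i := Ordinal mk.
    rewrite -[in RHS](upd_id (sm m) i) Phi_ext //; congr Phi.
    apply/funext => j; rewrite /upd /sm ltnS leq_eqVlt -(inj_eq val_inj) /=.
    by case: eqP => //= jm; rewrite ltnn; congr (ext (s _ p)); apply: val_inj.
  rewrite -(step k (leqnn k)); congr Phi; apply/funext => i.
  by rewrite /sm ltn_ord.
have ext_upd (v : 'I_k -> E p) i x :
    (fun j => ext (upd v i x j)) = upd (fun j => ext (v j)) i (ext x).
  by apply/funext => j; rewrite /upd; case: ifP.
have formB : is_form kd (fun v : 'I_k -> E p => Phi (fun i => ext (v i))).
  split=> [v i a x y|].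
    rewrite !ext_upd ext_lin // (lin _ _ (fun=> a)) //;
      try (by move=> *; apply: smooth_ext); exact: smooth_cst.
  case: (kd) sym => // sym.
    by move=> g v; rewrite -[RHS](sym g) // => j; apply: smooth_ext.
  move=> v i j ij vij; apply: (sym _ i j) => //; last by rewrite vij.
  by move=> m; apply: smooth_ext.
exists (mk_form kd (fun v => Phi (fun i => ext (v i)))) => s ss.
by rewrite mk_formE // -Phi_all.
Qed.

Lemma form_eq_smooth kd k (W : lmodType R) p (A B : elt (forms kd k (E p) W)) :
  U p -> (forall s : 'I_k -> section E, (forall i, smooth_sec (s i) p) ->
    fapp A (fun i => s i p) = fapp B (fun i => s i p)) -> A = B.
Proof.
move=> Up AB; apply: form_eqP => v.
have -> : v = (fun i => ext (v i) p) by apply/funext => i; rewrite ext_at.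
by apply: (AB (fun i => ext (v i))) => i; apply: smooth_ext.
Qed.

(** ** The dual frame *)

Definition coframe i : section (dualb E) := fun p =>
  mk_form Any (fun v : 'I_1 -> E p => coord (v 0) i : R^o).

Lemma coframeE i q (v : E q) : U q -> happ (coframe i q) v = coord v i.
Proof.
move=> Uq; rewrite /happ mk_formE ?(tnth_nth v) //.
by apply: (is_form1 (g := fun v => coord v i : R^o)) => a x y; rewrite coord_lin.
Qed.

Lemma dual_sum q (c : 'I_r -> R) j : U q ->
  happ (\sum_i c i *: coframe i q : dualb E q) (e j q) = c j.
Proof.
move=> Uq; rewrite happ_suml (bigD1 j) //=  happZl coframeE // coord_frame // eqxx.
rewrite big1 ?addr0; first by rewrite -[RHS]mulr1.
by move=> i ij; rewrite happZl coframeE // coord_frame // eq_sym (negPf ij) scaler0.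
Qed.

Lemma dual_coordE q (w : dualb E q) : U q ->
  w = \sum_i (happ w (e i q) : R) *: coframe i q.
Proof.
move=> Uq; apply: hom_eqP => v; rewrite -(coordK v Uq) !happ_sum.
apply: eq_bigr => i _; rewrite !happZ; congr (_ *: _).
by rewrite (dual_sum (fun i => happ w (e i q))).
Qed.

Lemma smooth_coframe i p : U p -> smooth_sec (coframe i) p.
Proof.
move=> Up; apply: smooth_happP => s ss.
apply: smooth_eq (((smooth_coord s Up).1 ss) i).
by apply: filterS (frame_nbhs Up) => q Uq; rewrite coframeE.
Qed.

Lemma coframe_frame : is_frame U coframe.
Proof.
have [oU _ _] := Fr; split=> // [q Uq w|w q Uq].
  exists (fun i => happ w (e i q)); split; first exact: dual_coordE.
  by move=> c ->; apply/funext => i; rewrite dual_sum.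
have smD : smooth_module (dualb E) q by apply: form_module; apply: triv_module.
split=> [sw|[c sc wc]].
  exists (fun i x => happ (w x) (e i x)).
    by move=> i; apply: (smooth_happ sw); apply: smooth_frame.
  by apply: filterS (frame_nbhs Uq) => x Ux; apply: dual_coordE.
apply: (sm_eq smD (s := fun x => \sum_i c i x *: coframe i x)).
  by apply: filterS wc.
by apply: sm_sum => // i; apply: sm_scale => //; apply: smooth_coframe.
Qed.

End Frame.

End BundleTheory.

Arguments coord {R n M E r} e {q} v.
Arguments coframe {R n M E r} e i p.
Arguments ext {R n M E r} e {p} v _.

(** * Tangent vectors and the exterior derivative *)

Section TangentTheory.
Context {R : realType} {n : nat} {M : manifold R n}.
Implicit Types (p q : M) (f g : M -> R).

Section TangentVector.
Variables (p : M) (v : @TM R n M p).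

Lemma tapp_eq f g : smooth_fun f p -> (\forall q \near p, f q = g q) ->
  tapp v f = tapp v g.
Proof.
move=> sf fg; have [loc _ _ _] := elt_set v; apply: loc => //.
exact: smooth_eq sf.
Qed.

Lemma tapp_lin a f g : smooth_fun f p -> smooth_fun g p ->
  tapp v (fun q => a * f q + g q) = a * tapp v f + tapp v g.
Proof. by have [_ lin _ _] := elt_set v => sf sg; apply: lin. Qed.

Lemma tapp_mul f g : smooth_fun f p -> smooth_fun g p ->
  tapp v (fun q => f q * g q) = f p * tapp v g + g p * tapp v f.
Proof. by have [_ _ mul _] := elt_set v => sf sg; apply: mul. Qed.

Lemma tapp_add f g : smooth_fun f p -> smooth_fun g p ->
  tapp v (fun q => f q + g q) = tapp v f + tapp v g.
Proof.
move=> sf sg; rewrite -[tapp v f]mul1r -tapp_lin //; apply: tapp_eq.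
  exact: smooth_add.
by apply: nearW => q; rewrite mul1r.
Qed.

Lemma tapp0 : tapp v (fun=> 0) = 0.
Proof.
have := tapp_lin 1 (smooth_cst 0 p) (smooth_cst 0 p).
rewrite (_ : (fun _ : M => 1 * 0 + 0 : R) = fun=> 0); last first.
  by apply/funext => q; rewrite mulr0 addr0.
by rewrite mul1r; lra.
Qed.

Lemma tapp_cst a : tapp v (fun=> a) = 0.
Proof.
have h := tapp_mul (smooth_cst 1 p) (smooth_cst 1 p).
have := tapp_lin a (smooth_cst 1 p) (smooth_cst 0 p).
rewrite (_ : (fun _ : M => a * 1 + 0 : R) = fun=> a); last first.
  by apply/funext => q; rewrite mulr1 addr0.
have {h} -> : tapp v (fun=> 1) = 0.
  move: h; rewrite (_ : (fun _ : M => 1 * 1 : R) = fun=> 1); last first.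
    by apply/funext => q; rewrite mulr1.
  by rewrite mul1r; lra.
by rewrite tapp0 mulr0 addr0.
Qed.

End TangentVector.

Lemma tangent_eqP p (u v : @TM R n M p) :
  (forall f, smooth_fun f p -> tapp u f = tapp v f) -> u = v.
Proof.
move=> uv; apply: val_inj; apply/funext => f.
have [sf|sf] := pselect (smooth_fun f p); first exact: uv.
by have [_ _ _ /(_ f sf) u0] := elt_set u; have [_ _ _ /(_ f sf) v0] := elt_set v;
  rewrite /= [LHS]u0 [RHS]v0.
Qed.

Lemma smooth_tapp (X : section (@TM R n M)) f p : smooth_sec X p -> smooth_fun f p ->
  smooth_fun (fun q => tapp (X q) f) p.
Proof. by move=> sX; apply: sX. Qed.

Section Bracket.
Context {r : nat} {U : set M} {e : 'I_r -> section (@TM R n M)}.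
Hypothesis Fr : is_frame U e.
Implicit Types X Y Z : section (@TM R n M).

Lemma tapp_near X f g p : smooth_fun f p -> (\forall q \near p, f q = g q) ->
  \forall q \near p, tapp (X q) f = tapp (X q) g.
Proof.
move=> sf /near_join fg; have := smooth_near sf.
by apply: filter_app; apply: filterS fg => q fg sq; apply: tapp_eq.
Qed.

Definition lie (X Y : section (@TM R n M)) p f : R :=
  tapp (X p) (fun q => tapp (Y q) f) - tapp (Y p) (fun q => tapp (X q) f).

Lemma second_lin (X Y : section (@TM R n M)) p a f g : smooth_sec Y p ->
  smooth_fun f p -> smooth_fun g p ->
  tapp (X p) (fun q => tapp (Y q) (fun x => a * f x + g x)) =
  a * tapp (X p) (fun q => tapp (Y q) f) + tapp (X p) (fun q => tapp (Y q) g).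
Proof.
move=> sY sf sg; rewrite -tapp_lin; try exact: smooth_tapp.
apply: tapp_eq.
  by apply: (smooth_tapp sY); apply: smooth_add => //; apply: smooth_mul => //; apply: smooth_cst.
have := smooth_near sg; apply: filter_app; apply: filterS (smooth_near sf) => q sfq sgq.
by rewrite tapp_lin.
Qed.

Lemma second_mul (X Y : section (@TM R n M)) p f g : smooth_sec Y p ->
  smooth_fun f p -> smooth_fun g p ->
  tapp (X p) (fun q => tapp (Y q) (fun x => f x * g x)) =
  f p * tapp (X p) (fun q => tapp (Y q) g) + g p * tapp (X p) (fun q => tapp (Y q) f)
  + (tapp (X p) f * tapp (Y p) g + tapp (X p) g * tapp (Y p) f).
Proof.
move=> sY sf sg; have sYf := smooth_tapp sY sf; have sYg := smooth_tapp sY sg.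
transitivity (tapp (X p) (fun q => f q * tapp (Y q) g + g q * tapp (Y q) f)).
  apply: tapp_eq; first by apply: (smooth_tapp sY); apply: smooth_mul.
  have := smooth_near sg; apply: filter_app; apply: filterS (smooth_near sf) => q sfq sgq.
  by rewrite tapp_mul.
rewrite tapp_add ?tapp_mul //; try exact: smooth_mul.
by ring.
Qed.

(** The terms of second order of the two composites cancel. *)
Lemma lie_derivation X Y p : smooth_sec X p -> smooth_sec Y p ->
  exists Z : @TM R n M p, forall f, smooth_fun f p -> tapp Z f = lie X Y p f.
Proof.
move=> sX sY.
pose Z f : R^o := if pselect (smooth_fun f p) then lie X Y p f else 0.
have ZE f : smooth_fun f p -> Z f = lie X Y p f by rewrite /Z; case: pselect.
have dZ : is_derivation p Z.
  split=> [f g sf sg fg|a f g sf sg|f g sf sg|f nsf].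
  - rewrite !ZE //; congr (_ - _); apply: tapp_eq;
      by [apply: smooth_tapp | apply: tapp_near].
  - rewrite !ZE ?second_lin //; last first.
      by apply: smooth_add => //; apply: smooth_mul => //; apply: smooth_cst.
    by rewrite /lie !second_lin //; ring.
  - by rewrite !ZE //; [rewrite /lie !second_mul //; ring | apply: smooth_mul].
  - by rewrite /Z; case: pselect.
exists (to_elt (tangent p) Z) => f sf; rewrite -ZE //.
by rewrite /tapp to_eltK.
Qed.

Lemma bracketE X Y p f : smooth_sec X p -> smooth_sec Y p -> smooth_fun f p ->
  tapp (bracket X Y p) f = lie X Y p f.
Proof. by move=> sX sY; have := xgetPex 0 (lie_derivation sX sY); apply. Qed.

Lemma smooth_lie X Y p f : smooth_sec X p -> smooth_sec Y p -> smooth_fun f p ->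
  smooth_fun (fun q => lie X Y q f) p.
Proof.
move=> sX sY sf; apply: smooth_sub; apply: smooth_tapp => //; exact: smooth_tapp.
Qed.

Lemma smooth_bracket X Y p : U p -> smooth_sec X p -> smooth_sec Y p ->
  smooth_sec (bracket X Y) p.
Proof.
move=> Up sX sY f sf; apply: smooth_eq (smooth_lie sX sY sf).
have := smooth_near sf; apply: filter_app.
have := smooth_sec_near Fr Up sX; apply: filter_app.
apply: filterS (smooth_sec_near Fr Up sY) => q sYq sXq sfq.
by rewrite bracketE.
Qed.

Lemma bracket_anti X Y p : smooth_sec X p -> smooth_sec Y p ->
  bracket X Y p = - bracket Y X p.
Proof.
move=> sX sY; apply: tangent_eqP => f sf.
by rewrite -[RHS]/(- tapp (bracket Y X p) f) !bracketE // /lie opprB.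
Qed.

Lemma bracket_linl X X' Y p g : U p -> smooth_fun g p ->
  smooth_sec X p -> smooth_sec X' p -> smooth_sec Y p ->
  bracket (fun q => g q *: X q + X' q) Y p =
  g p *: bracket X Y p - tapp (Y p) g *: X p + bracket X' Y p.
Proof.
move=> Up sg sX sX' sY; apply: tangent_eqP => f sf.
have smT := frame_module Fr Up.
have sXf := smooth_tapp sX sf; have sXf' := smooth_tapp sX' sf.
have E (a b : R) (u v w : @TM R n M p) :
  tapp (a *: u - b *: v + w) f = a * tapp u f - b * tapp v f + tapp w f by [].
rewrite {}E !bracketE //; last exact: sm_lin.
have {}E q h : tapp (g q *: X q + X' q) h = g q * tapp (X q) h + tapp (X' q) h by [].
rewrite /lie E.
have -> : (fun q => tapp (g q *: X q + X' q) f) =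
  fun q => g q * tapp (X q) f + tapp (X' q) f by apply/funext => q.
rewrite tapp_add ?tapp_mul //; last exact: smooth_mul.
by ring.
Qed.

Lemma bracket_near X X' Y p : U p -> smooth_sec X p -> smooth_sec X' p ->
  smooth_sec Y p -> (\forall q \near p, X q = X' q) ->
  bracket X Y p = bracket X' Y p.
Proof.
move=> Up sX sX' sY XX'; apply: tangent_eqP => f sf.
rewrite !bracketE // /lie (nbhs_singleton XX'); congr (_ - _).
by apply: tapp_eq; [apply: smooth_tapp | apply: filterS XX' => q ->].
Qed.

(** ** The exterior derivative *)

Variables (w : section (dualb (@TM R n M))) (p : M).
Hypotheses (Up : U p) (sw : smooth_sec w p).

Definition dform (X Y : section (@TM R n M)) : R :=
  tapp (X p) (fun q => happ (w q) (Y q)) - tapp (Y p) (fun q => happ (w q) (X q))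
  - happ (w p) (bracket X Y p).

Lemma dform_anti X Y : smooth_sec X p -> smooth_sec Y p -> dform X Y = - dform Y X.
Proof.
move=> sX sY; rewrite /dform bracket_anti // happN.
by have E (a b c : R) : a - b - - c = - (b - a - c) by [ring]; apply: E.
Qed.

Lemma dform_linl X X' Y g : smooth_fun g p ->
  smooth_sec X p -> smooth_sec X' p -> smooth_sec Y p ->
  dform (fun q => g q *: X q + X' q) Y = g p * dform X Y + dform X' Y.
Proof.
move=> sg sX sX' sY.
have swX : smooth_fun (fun q => happ (w q) (X q)) p := smooth_happ sw sX.
have swX' : smooth_fun (fun q => happ (w q) (X' q)) p := smooth_happ sw sX'.
have swY : smooth_fun (fun q => happ (w q) (Y q)) p := smooth_happ sw sY.
rewrite /dform bracket_linl //.
have -> : (fun q => happ (w q) (g q *: X q + X' q)) =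
    (fun q => g q * (happ (w q) (X q) : R) + happ (w q) (X' q)).
  by apply/funext => q; rewrite happ_lin.
rewrite tapp_add ?tapp_mul //; last exact: smooth_mul.
rewrite happD happB !happZ.
have -> : tapp (g p *: X p + X' p) (fun q => happ (w q) (Y q)) =
    g p * tapp (X p) (fun q => happ (w q) (Y q))
    + tapp (X' p) (fun q => happ (w q) (Y q)) by [].
set a := happ (w p) (X p); set b := happ (w p) (bracket X Y p).
set c := happ (w p) (bracket X' Y p).
have -> : g p *: b - tapp (Y p) g *: a + c =
  g p * (b : R) - tapp (Y p) g * (a : R) + (c : R) :> R by [].
by move: (a : R) (b : R) (c : R) => a' b' c'; ring.
Qed.

Lemma dform_near X X' Y : smooth_sec X p -> smooth_sec X' p -> smooth_sec Y p ->
  (\forall q \near p, X q = X' q) -> dform X Y = dform X' Y.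
Proof.
move=> sX sX' sY XX'; rewrite /dform (bracket_near Up sX sX' sY XX').
congr (_ - _ - _); first by rewrite (nbhs_singleton XX').
by apply: tapp_eq; [apply: (smooth_happ sw sX) | apply: filterS XX' => q ->].
Qed.

(** The terms by which the bracket fails to be linear over the smooth functions
    cancel those of the two derivatives, so that the defining formula is tensorial. *)
Lemma extdE X Y : smooth_sec X p -> smooth_sec Y p ->
  fapp (extd w p) [args X p; Y p] = dform X Y.
Proof.
have smT := frame_module Fr Up.
have ord2 (i : 'I_2) : i = 0 \/ i = 1.
  by case: i => -[|[|//]] hi; [left|right]; apply: val_inj.
have [B BE] : exists B : elt (forms Alt 2 (@TM R n M p) R^o),
    forall s, (forall i, smooth_sec (s i) p) ->
    fapp B (fun i => s i p) = dform (s 0) (s 1).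
  apply: (tensorial Fr Up) => [s i f u v ss sf su sv|s i u v ss su sv uv|s i j ss ij sij].
  - have suv := sm_lin smT sf su sv.
    have [->|->] := ord2 i; rewrite !upd_same !upd_other //.
      by rewrite dform_linl.
    rewrite dform_anti // dform_linl // (dform_anti (ss 0) su) (dform_anti (ss 0) sv).
    by rewrite /GRing.scale /=; ring.
  - have [->|->] := ord2 i; rewrite !upd_same !upd_other //; first exact: dform_near.
    by rewrite dform_anti // (dform_near su sv) // -dform_anti.
  - have s01 : s 0 = s 1.
      by have [i0|i0] := ord2 i; have [j0|j0] := ord2 j; subst i j; rewrite ?eqxx in ij.
    have := dform_anti (ss 1) (ss 1); rewrite s01 => /eqP.
    by rewrite -addr_eq0 -mulr2n mulrn_eq0 /= => /eqP.
have h : exists b : formb Alt 2 (@TM R n M) trivb p,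
    [set b : formb Alt 2 (@TM R n M) trivb p |
      forall X Y : section (@TM R n M), smooth_sec X p -> smooth_sec Y p ->
      fapp b [args X p; Y p] = dform X Y] b.
  exists B => X' Y' sX sY.
  have ss i : smooth_sec ([args X'; Y'] i) p by have [->|->] := ord2 i.
  by rewrite -[RHS](BE [args X'; Y'] ss) [in RHS](args2E (fun i => [args X'; Y'] i p)).
by move=> sX sY; have := xgetPex 0 h; apply.
Qed.

End Bracket.

End TangentTheory.

(** * Partial connections at a point *)

Section SubValues.
Context {R : realType}.

Lemma elt_lin (V : lmodType R) (W : lin_subspace V) a (u v : elt W) :
  elt_val (a *: u + v) = a *: elt_val u + elt_val v.
Proof. by []. Qed.

Context {n : nat} {M : manifold R n} {E : prebundle M}.
Context {W : forall p, lin_subspace (E p)} {p : M}.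
Implicit Types u v : subb W p.

Lemma sub_lin a u v : elt_val (a *: u + v) = a *: elt_val u + elt_val v.
Proof. exact: elt_lin. Qed.

Lemma sub0 : elt_val (0 : subb W p) = 0.
Proof. by []. Qed.

Lemma subZ a u : elt_val (a *: u) = a *: elt_val u.
Proof. by have := sub_lin a u 0; rewrite !addr0. Qed.

Lemma subD u v : elt_val (u + v) = elt_val u + elt_val v.
Proof. by have := sub_lin 1 u v; rewrite !scale1r. Qed.

Lemma sub_sum I (r : seq I) (u : I -> subb W p) :
  elt_val (\sum_(i <- r) u i) = \sum_(i <- r) elt_val (u i).
Proof. by elim: r => [|i r IH]; rewrite ?big_nil ?sub0 // !big_cons subD IH. Qed.

Lemma sub_eqP u v : elt_val u = elt_val v -> u = v.
Proof. by move=> uv; apply: val_inj. Qed.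

End SubValues.

Section Pconn.
Context {R : realType} {M : manifold R 5}.
Context {H : forall p : M, lin_subspace (@TM R 5 M p)}.
Implicit Types (E F : prebundle M) (p : M).

(** The operators induced at p by a partial connection involve that connection at p
    only. Recording the axioms pointwise allows to glue connections that are known to
    be unique at each point. *)
Record pconn_at E (D : operator H E) p : Prop := PconnAt {
  at_linear : forall a (X Y : Hb H p) s, smooth_sec s p ->
    D p (a *: X + Y) s = a *: D p X s + D p Y s;
  at_local : forall (X : Hb H p) s t, smooth_sec s p -> smooth_sec t p ->
    (\forall q \near p, s q = t q) -> D p X s = D p X t;
  at_add : forall (X : Hb H p) s t, smooth_sec s p -> smooth_sec t p ->
    D p X (fun q => s q + t q) = D p X s + D p X t;
  at_leibniz : forall (X : Hb H p) f s, smooth_fun f p -> smooth_sec s p ->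
    D p X (fun q => f q *: s q) = f p *: D p X s + Hderiv X f *: s p }.

Lemma is_pconn_at E (D : operator H E) p : is_pconn D -> pconn_at D p.
Proof.
by case=> l loc a b _; split=> *; [apply: l|apply: loc|apply: a|apply: b].
Qed.

Lemma Hderiv_cst p (X : Hb H p) (a : R) : Hderiv X (fun=> a) = 0.
Proof. exact: tapp_cst. Qed.

Lemma Hderiv_lin p a (X Y : Hb H p) f :
  Hderiv (a *: X + Y) f = a * Hderiv X f + Hderiv Y f.
Proof. by rewrite /Hderiv sub_lin. Qed.

Lemma triv_pconn p : pconn_at (@triv_op R M H) p.
Proof.
split=> [a X Y s ss|X s t ss st|X s t ss st|X f s sf ss].
- exact: Hderiv_lin.
- exact: tapp_eq.
- exact: tapp_add.
- by rewrite /triv_op /Hderiv tapp_mul // [s p * _]mulrC.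
Qed.

Section PconnTheory.
Variables (E : prebundle M) (D : operator H E) (p : M).
Arguments D : clear implicits.
Hypotheses (cD : pconn_at D p) (smE : smooth_module E p).
Implicit Types (X : Hb H p) (s t : section E).

Lemma at_lin X f s t : smooth_fun f p -> smooth_sec s p -> smooth_sec t p ->
  D p X (fun q => f q *: s q + t q) =
    f p *: D p X s + Hderiv X f *: s p + D p X t.
Proof.
move=> sf ss st; rewrite (at_add cD) ?(at_leibniz cD) //.
by apply: sm_scale.
Qed.

Lemma at_zero X : D p X (fun q => 0) = 0.
Proof.
have h := at_leibniz cD X (smooth_cst (0 : R) p) (sm_zero smE).
rewrite scale0r scaler0 addr0 in h; rewrite -[RHS]h.
by congr (D p X _); apply: functional_extensionality_dep => q; rewrite scaler0.
Qed.

Lemma at_sum X I (r : seq I) (s : I -> section E) :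
  (forall i, smooth_sec (s i) p) ->
  D p X (fun q => \sum_(i <- r) s i q) = \sum_(i <- r) D p X (s i).
Proof.
move=> ss; elim: r => [|i r IH].
  rewrite big_nil -(at_zero X); congr (D p X _).
  by apply: functional_extensionality_dep => q; rewrite big_nil.
rewrite big_cons -IH -(at_add cD) //; last exact: sm_sum.
congr (D p X _).
by apply: functional_extensionality_dep => q; rewrite big_cons.
Qed.

Lemma at_suml I (r : seq I) (c : I -> R) (X : I -> Hb H p) s : smooth_sec s p ->
  D p (\sum_(i <- r) c i *: X i) s = \sum_(i <- r) c i *: D p (X i) s.
Proof.
move=> ss; elim: r => [|i r IH]; last by rewrite !big_cons (at_linear cD) // IH.
have := at_linear cD (-1) 0 0 ss.
by rewrite !big_nil scaler0 addr0 scaleN1r addNr.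
Qed.

End PconnTheory.

Section FormOp.
Variables (kd : form_kind) (k : nat) (E F : prebundle M).
Variables (DE : operator H E) (DF : operator H F).
Arguments DE : clear implicits.
Arguments DF : clear implicits.
Context {r : nat} {U : set M} {e : 'I_r -> section E}.
Hypothesis Fr : is_frame U e.
Variable p : M.
Hypotheses (Up : U p) (cE : pconn_at DE p) (cF : pconn_at DF p).
Hypothesis smF : smooth_module F p.
Implicit Types (A B : section (formb kd k E F)) (s : 'I_k -> section E) (X : Hb H p).

Let D_form X A s : F p :=
  DF p X (fun q => fapp (A q) (s^~ q))
  - \sum_i fapp (A p) (upd (s^~ p) i (DE p X (s i))).

Lemma upd_at s i (u : section E) q :
  (upd s i u)^~ q = upd (s^~ q) i (u q).
Proof. by apply/funext => j; rewrite /upd; case: ifP. Qed.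

Let upd_smooth s i (u : section E) : (forall j, smooth_sec (s j) p) ->
  smooth_sec u p -> forall j, smooth_sec (upd s i u j) p.
Proof. by move=> ss su j; rewrite /upd; case: ifP. Qed.

Let D_form_lin X A s i f u v : smooth_sec A p ->
  (forall j, smooth_sec (s j) p) -> smooth_fun f p ->
  smooth_sec u p -> smooth_sec v p ->
  D_form X A (upd s i (fun q => f q *: u q + v q)) =
    f p *: D_form X A (upd s i u) + D_form X A (upd s i v).
Proof.
move=> sA ss sf su sv.
have EA q : fapp (A q) (upd (s^~ q) i (f q *: u q + v q)) =
    f q *: fapp (A q) (upd (s^~ q) i (u q)) + fapp (A q) (upd (s^~ q) i (v q)).
  by rewrite (is_form_lin (fapp_form (A q))).
have fun_at (w : section E) : (fun q => fapp (A q) ((upd s i w)^~ q)) =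
    (fun q => fapp (A q) (upd (s^~ q) i (w q))).
  by apply: functional_extensionality_dep => q; rewrite upd_at.
rewrite /D_form !fun_at !upd_at.
have sAw (w : section E) : smooth_sec w p ->
    smooth_sec (fun q => fapp (A q) (upd (s^~ q) i (w q))) p.
  by move=> sw; rewrite -fun_at; apply: sA => j; apply: upd_smooth.
have -> : (fun q => fapp (A q) (upd (s^~ q) i (f q *: u q + v q))) =
    (fun q => f q *: fapp (A q) (upd (s^~ q) i (u q))
              + fapp (A q) (upd (s^~ q) i (v q))).
  by apply: functional_extensionality_dep => q; rewrite EA.
rewrite (at_lin cF smF) //; try exact: sAw.
have sum_at (w : section E) : \sum_j fapp (A p)
      (upd (upd (s^~ p) i (w p)) j (DE p X (upd s i w j))) =
    fapp (A p) (upd (s^~ p) i (DE p X w)) +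
    \sum_(j | j != i) fapp (A p) (upd (upd (s^~ p) j (DE p X (s j))) i (w p)).
  rewrite (bigD1 i) //= upd_upd upd_same; congr (_ + _).
  by apply: eq_bigr => j ji; rewrite upd_comm 1?eq_sym // upd_other.
rewrite (sum_at (fun q => f q *: u q + v q)) (sum_at u) (sum_at v).
rewrite (at_lin cE (frame_module Fr Up)) //.
rewrite !(is_formD (fapp_form (A p))) !(is_formZ (fapp_form (A p))).
under eq_bigr do rewrite (is_form_lin (fapp_form (A p))).
rewrite big_split /= -scaler_sumr !scalerBr !scalerDr.
set a := _ *: DF p X _; set b := Hderiv X f *: _; set c := DF p X _.
set a1 := f p *: fapp _ _; set c1 := fapp _ (upd _ _ (DE p X v)).
set a2 := f p *: \sum_(_ | _) _; set c2 := \sum_(_ | _) _.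
rewrite !opprD -!addrA; congr (_ + _).
rewrite [in LHS]addrCA [in LHS](addrCA _ (- b)) [in LHS](addrCA _ (- b)) addKr.
rewrite [in LHS](addrCA c) [in RHS](addrCA _ c); congr (_ + _).
by rewrite [in LHS](addrCA (- c1)).
Qed.

Let D_form_near X A s i u v : smooth_sec A p ->
  (forall j, smooth_sec (s j) p) -> smooth_sec u p -> smooth_sec v p ->
  (\forall q \near p, u q = v q) ->
  D_form X A (upd s i u) = D_form X A (upd s i v).
Proof.
move=> sA ss su sv uv; rewrite /D_form; congr (_ - _).
  apply: (at_local cF); try by apply: sA => j; apply: upd_smooth.
  by apply: filterS uv => q uq; rewrite !upd_at uq.
rewrite !upd_at (nbhs_singleton uv); apply: eq_bigr => j _.
congr (fapp _ (upd _ _ _)); rewrite /upd; case: ifP => // _.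
exact: (at_local cE).
Qed.

Let D_form_exists X A : smooth_sec A p ->
  exists B : formb kd k E F p, forall s, (forall i, smooth_sec (s i) p) ->
    fapp B (s^~ p) = D_form X A s.
Proof.
move=> sA; apply: (tensorial Fr Up).
- by move=> *; apply: D_form_lin.
- by move=> *; apply: D_form_near.
rewrite /D_form; clear D_form_near D_form_lin D_form; case: kd A sA => // A sA.
  move=> g s ss; congr (_ - _).
    congr (DF p X _); apply: functional_extensionality_dep => q.
    by have [_ /(_ g (s^~ q))] := fapp_form (A q).
  rewrite [RHS](reindex_inj (@perm_inj _ g)) /=; apply: eq_bigr => i _.
  have [_ /(_ g (upd (s^~ p) (g i) (DE p X (s (g i))))) <-] := fapp_form (A p).
  by rewrite upd_perm.
move=> s i j ss ij sij.
have -> : (fun q => fapp (A q) (s^~ q)) = (fun q => 0).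
  apply: functional_extensionality_dep => q.
  by have [_ /(_ (s^~ q) i j ij)] := fapp_form (A q); apply; rewrite sij.
rewrite (at_zero cF smF) sub0r (bigD1 i) //= (bigD1 j) 1?eq_sym //=.
rewrite big1 => [|m /andP[mi mj]]; last first.
  have [_ alt] := fapp_form (A p); apply: (alt _ i j ij).
  by rewrite !upd_other 1?eq_sym // sij.
rewrite addr0 (alt_swap (fapp_form (A p)) _ ij) ?sij //.
by rewrite addNr oppr0.
Qed.

(** The Leibniz terms of the connections on E and on F cancel, so the defining
    formula is tensorial and the form exists. *)
Lemma form_opE X A s : smooth_sec A p -> (forall i, smooth_sec (s i) p) ->
  fapp (form_op DE DF p X A) (s^~ p) =
    DF p X (fun q => fapp (A q) (s^~ q))
    - \sum_i fapp (A p) (upd (s^~ p) i (DE p X (s i))).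
Proof. by move=> sA; have := xgetPex 0 (D_form_exists X sA); apply. Qed.

Lemma form_op_pconn : pconn_at (form_op (kd := kd) (k := k) DE DF) p.
Proof.
have sAs A s : smooth_sec A p -> (forall i, smooth_sec (s i) p) ->
    smooth_sec (fun q => fapp (A q) (s^~ q)) p by move=> sA; apply: sA.
have smA : smooth_module (formb kd k E F) p by apply: form_module.
split=> [a X Y A sA|X A B sA sB AB|X A B sA sB|X f A sf sA];
  apply: (form_eq_smooth Fr Up) => s ss.
- rewrite bfappD bfappZ !form_opE // (at_linear cF); last exact: sAs.
  rewrite scalerBr scaler_sumr addrACA -opprD -big_split /=.
  congr (_ - _); apply: eq_bigr => i _.
  by rewrite (at_linear cE) // (is_form_lin (fapp_form (A p))).
- rewrite !form_opE // (nbhs_singleton AB); congr (_ - _).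
  apply: (at_local cF); try exact: sAs.
  by apply: filterS AB => q ->.
- rewrite bfappD !form_opE //; last exact: sm_add.
  rewrite addrACA -opprD -big_split /= -(at_add cF) //; exact: sAs.
- rewrite bfappD !bfappZ !form_opE //; last exact: sm_scale.
  rewrite (_ : (fun q => fapp (f q *: A q) (s^~ q)) =
    fun q => f q *: fapp (A q) (s^~ q)); last first.
    by apply: functional_extensionality_dep => q.
  rewrite (at_leibniz cF) //; last exact: sAs.
  rewrite scalerBr scaler_sumr addrAC; congr (_ - _ + _).
Qed.

End FormOp.

End Pconn.

(** * Contact distributions *)

Section ContactFrame.
Context {R : realType} {M : manifold R 5}.
Context {H : forall p : M, lin_subspace (@TM R 5 M p)}.
Context {U : set M} {e : 'I_5 -> section (@TM R 5 M)}.
Hypothesis Fr : is_frame U e.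
Hypothesis HU : forall q, U q -> forall v : @TM R 5 M q,
  H q v <-> exists c : 'I_4 -> R,
    v = \sum_i c i *: e (widen_ord (leqnSn 4) i) q.
Implicit Types (p q : M).

Definition wid : 'I_4 -> 'I_5 := widen_ord (leqnSn 4).

Lemma sum_wid q (c : 'I_5 -> R) :
  \sum_i c i *: e i q = \sum_i c (wid i) *: e (wid i) q + c ord_max *: e ord_max q.
Proof. exact: big_ord_recr. Qed.

Lemma coord_H q (v : Hb H q) : U q -> coord e (elt_val v) ord_max = 0.
Proof.
move=> Uq; have [c ->] := (HU Uq (elt_val v)).1 (elt_set v).
pose c5 (i : 'I_5) : R := if unlift ord_max i is Some j then c j else 0.
have wl i : wid i = lift ord_max i by apply: val_inj; rewrite /= /bump leqNgt ltn_ord.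
rewrite (_ : \sum_i _ = \sum_i c5 i *: e i q).
  by rewrite (coord_sum Fr) // /c5 unlift_none.
rewrite sum_wid /c5 unlift_none scale0r addr0; apply: eq_bigr => i _.
by rewrite wl liftK -wl.
Qed.

Definition hframe i : section (Hb H) := fun q => to_elt (H q) (e (wid i) q).

Lemma hframeE i q : U q -> elt_val (hframe i q) = e (wid i) q.
Proof.
move=> Uq; apply: to_eltK; apply/(HU Uq).
exists (fun j => (i == j)%:R); rewrite (bigD1 i) //= eqxx scale1r big1 ?addr0 //.
by move=> j; rewrite eq_sym => /negPf ->; rewrite scale0r.
Qed.

Lemma coord_Hsum q (v : Hb H q) : U q ->
  v = \sum_i coord e (elt_val v) (wid i) *: hframe i q.
Proof.
move=> Uq; apply: sub_eqP; rewrite sub_sum -{1}(coordK Fr (elt_val v) Uq) sum_wid.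
rewrite coord_H // scale0r addr0; apply: eq_bigr => i _.
by rewrite subZ hframeE.
Qed.

Lemma hframe_frame : is_frame U hframe.
Proof.
have [oU _ _] := Fr; split=> // [q Uq v|s q Uq].
  exists (fun i => coord e (elt_val v) (wid i)); split; first exact: coord_Hsum.
  move=> c vc; apply/funext => i.
  pose c5 (i : 'I_5) : R := if unlift ord_max i is Some j then c j else 0.
  have wl j : wid j = lift ord_max j by apply: val_inj; rewrite /= /bump leqNgt ltn_ord.
  have c5E j : c5 (wid j) = c j by rewrite /c5 wl liftK.
  rewrite -[RHS]c5E -(coord_sum Fr c5 Uq) sum_wid /c5 unlift_none scale0r addr0.
  rewrite vc sub_sum; congr (coord e _ _); apply: eq_bigr => j _.
  by rewrite subZ hframeE // -/(c5 (wid j)) c5E.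
have near_e : \forall x \near q, forall i, elt_val (hframe i x) = e (wid i) x.
  by apply: filterS (frame_nbhs Fr Uq) => x Ux i; apply: hframeE.
split=> [ss|[c sc sE]].
  exists (fun i x => coord e (elt_val (s x)) (wid i)).
    by move=> i; apply: ((smooth_coord Fr (fun x => elt_val (s x)) Uq).1 ss).
  by apply: filterS (frame_nbhs Fr Uq) => x Ux; apply: coord_Hsum.
have smH := sub_module H (frame_module Fr Uq).
apply: (sm_eq smH (s := fun x => \sum_i c i x *: hframe i x)).
  by apply: filterS sE => x ->.
apply: (sm_sum smH) => i; apply: (sm_scale smH) => //.
apply: (sm_eq (frame_module Fr Uq) (s := e (wid i))); last first.
  by apply: (smooth_frame Fr).
by apply: filterS near_e => x ->.
Qed.

Definition annih : section (dualb (@TM R 5 M)) := coframe e ord_max.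

Lemma annihP q : U q -> @annihilates R M H q (annih q).
Proof.
move=> Uq v Hv; rewrite /annih (coframeE Fr) //.
by rewrite -(to_eltK Hv) coord_H.
Qed.

Lemma annih_neq0 q : U q -> annih q <> 0.
Proof.
move=> Uq; rewrite /annih => a0; have := coframeE Fr ord_max (e ord_max q) Uq.
rewrite a0 happ0l (coord_frame Fr) // eqxx.
by move/eqP; rewrite eq_sym oner_eq0.
Qed.

Lemma ann_line q (a : Lb H q) : U q ->
  elt_val a = (happ (elt_val a) (e ord_max q) : R) *: annih q.
Proof.
move=> Uq; apply: hom_eqP => v; rewrite happZl /annih (coframeE Fr) //.
rewrite -{1}(coordK Fr v Uq) sum_wid happD happ_sum big1 ?add0r.
  by rewrite happZ; rewrite /GRing.scale /= mulrC.
move=> i _; rewrite happZ -hframeE //.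
by rewrite (elt_set a (elt_val (hframe i q)) (elt_set _)) scaler0.
Qed.

Definition ann_sec (c : R) : section (Lb H) := fun q => to_elt _ (c *: annih q).

Lemma ann_secE c q : U q -> elt_val (ann_sec c q) = c *: annih q.
Proof.
move=> Uq; apply: to_eltK => v Hv.
by rewrite happZl annihP // scaler0.
Qed.

Lemma smooth_annih p : U p -> smooth_sec annih p.
Proof. exact: smooth_coframe. Qed.

Lemma smooth_ann_sec c p : U p -> smooth_sec (ann_sec c) p.
Proof.
move=> Up; have smD : smooth_module (dualb (@TM R 5 M)) p.
  by apply: form_module; apply: triv_module.
apply: (sm_eq smD (s := fun q => c *: annih q)).
  by apply: filterS (frame_nbhs Fr Up) => q Uq; rewrite ann_secE.
by apply: sm_scale => //; [apply: smooth_cst | apply: smooth_annih].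
Qed.

Lemma ann_sec_at p (a : Lb H p) : U p ->
  ann_sec (happ (elt_val a) (e ord_max p)) p = a.
Proof. by move=> Up; apply: sub_eqP; rewrite ann_secE // -ann_line. Qed.

Definition hval (X : section (Hb H)) : section (@TM R 5 M) := fun q => elt_val (X q).

Lemma restr2E p (b : formb Alt 2 (@TM R 5 M) trivb p) (x y : Hb H p) :
  fapp (restr2 H b) [args x; y] = fapp b [args elt_val x; elt_val y].
Proof.
have fb := fapp_form b.
rewrite /restr2 mk_formE.
  by congr fapp; rewrite [LHS]args2E.
have E v : (fun i : 'I_2 => elt_val (v i)) = (elt_val (W := H p)) \o v by [].
split=> [v i a z t|v i j ij vij].
  by rewrite !E !upd_map sub_lin (is_form_lin fb).
by have [_ alt] := fb; apply: (alt _ i j ij) => /=; rewrite vij.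
Qed.

Lemma restr1E p (w : dualb (@TM R 5 M) p) (x : Hb H p) :
  happ (restr1 H w) x = happ w (elt_val x).
Proof.
rewrite {1}/happ /restr1 mk_formE.
  by rewrite /happ; congr fapp; rewrite [LHS]args1E.
have E v : (fun i : 'I_1 => elt_val (v i)) = (elt_val (W := H p)) \o v by [].
split=> // v i a z t.
by rewrite !E !upd_map sub_lin (is_form_lin (fapp_form w)).
Qed.

(** Only the bracket term of the exterior derivative survives: the others are
    derivatives of the zero functions a(X) and a(Y). *)
Lemma leviE p (a : Lb H p) (X Y : section (Hb H)) : U p ->
  smooth_sec X p -> smooth_sec Y p ->
  fapp (levi a) [args X p; Y p] =
    - happ (elt_val a) (bracket (hval X) (hval Y) p).
Proof.
move=> Up sX sY.
have h : exists b : L2H H p, [set b : L2H H p | exists s : section (Lb H),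
    [/\ smooth_sec s p, s p = a &
        b = restr2 H (extd (fun q => elt_val (s q)) p)]] b.
  exists (restr2 H (extd (fun q => elt_val
    (ann_sec (happ (elt_val a) (e ord_max p)) q)) p)).
  exists (ann_sec (happ (elt_val a) (e ord_max p))).
  by rewrite ann_sec_at //; split=> //; apply: smooth_ann_sec.
have := xgetPex 0 h; rewrite -/(levi a) => -[s [ss sa ->]].
rewrite restr2E (extdE Fr Up ss (X := hval X) (Y := hval Y)) // /dform sa.
have z (Z : section (Hb H)) :
    (fun q => happ (elt_val (s q)) (hval Z q)) = fun=> 0 :> R.
  by apply/funext => q; apply: (elt_set (s q)); apply: elt_set.
by rewrite !z !tapp0 subr0 sub0r.
Qed.

Lemma levi_lin p c (a b : Lb H p) : U p ->
  levi (c *: a + b) = c *: levi a + levi b.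
Proof.
move=> Up; apply: (form_eq_smooth hframe_frame Up) => s ss.
rewrite bfappD bfappZ (args2E (s^~ p)) !leviE // sub_lin happDl happZl.
by have E (x y : R) : - (c * x + y) = c * - x + - y by [ring]; apply: E.
Qed.

Lemma leviZ p c (a : Lb H p) : U p -> levi (c *: a) = c *: levi a.
Proof.
move=> Up; have := levi_lin c a 0 Up; have := levi_lin (-1) 0 0 Up.
by rewrite scaler0 addr0 scaleN1r addNr => ->; rewrite !addr0.
Qed.

End ContactFrame.

Arguments hframe {R M H} e i p.
Arguments annih {R M} e p.
Arguments ann_sec {R M H} e c p.

(** ** The projection to trace-free forms *)

(** The SL(2)-invariant skew form on binary cubics, in the basis dual to the cubic
    monomials. *)
Definition omega_mx {R : realType} (i j : 'I_4) : R :=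
  if (i == 0 :> nat) && (j == 3 :> nat) then 1 else
  if (i == 3 :> nat) && (j == 0 :> nat) then -1 else
  if (i == 1 :> nat) && (j == 2 :> nat) then - 3^-1 else
  if (i == 2 :> nat) && (j == 1 :> nat) then 3^-1 else 0.

Section Trace.
Context {R : realType} {M : manifold R 5}.
Context {H : forall p : M, lin_subspace (@TM R 5 M p)} {p : M}.

(** What the projection along the Levi form uses of the frames of H adapted to the
    cubic monomials. *)
Record levi_basis (h : 'I_4 -> Hb H p) (w : 'I_4 -> L1H H p) (lam : Lb H p -> R) :
    Prop := LeviBasis {
  lb_dual : forall i j, happ (w i) (h j) = (i == j)%:R :> R;
  lb_span : forall v : Hb H p, v = \sum_i (happ (w i) v : R) *: h i;
  lb_levi : forall a i j, fapp (levi a) [args h i; h j] = lam a * omega_mx i j :> R;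
  lb_levi_lin : forall c (a b : Lb H p), levi (c *: a + b) = c *: levi a + levi b;
  lb_neq0 : forall a, a != 0 -> lam a != 0;
  lb_nontrivial : exists a : Lb H p, a != 0 }.

Lemma form2_exp (h : 'I_4 -> Hb H p) (b : L2H H p) (x y : 'I_4 -> R) :
  fapp b [args \sum_i x i *: h i; \sum_j y j *: h j] =
  \sum_i \sum_j x i * y j * (fapp b [args h i; h j] : R) :> R.
Proof.
have fb := fapp_form b.
rewrite (form2_suml fb); apply: eq_bigr => i _.
rewrite (form2Zl fb) (form2_sumr fb) scaler_sumr; apply: eq_bigr => j _.
by rewrite (form2Zr fb) scalerA.
Qed.

Context {h : 'I_4 -> Hb H p} {w : 'I_4 -> L1H H p} {lam : Lb H p -> R}.
Hypothesis B : levi_basis h w lam.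

Definition o4 k (hk : (k < 4)%N) : 'I_4 := Ordinal hk.
Notation i0 := (@o4 0 isT).
Notation i1 := (@o4 1 isT).
Notation i2 := (@o4 2 isT).
Notation i3 := (@o4 3 isT).

Lemma sum4 (V : nmodType) (F : 'I_4 -> V) :
  \sum_i F i = F i0 + F i1 + F i2 + F i3.
Proof.
rewrite !big_ord_recl big_ord0 addr0 !addrA.
by congr (F _ + F _ + F _ + F _); apply: val_inj.
Qed.

Lemma ord4 (P : 'I_4 -> Prop) : P i0 -> P i1 -> P i2 -> P i3 -> forall i, P i.
Proof.
move=> P0 P1 P2 P3 [m hi]; case: m hi => [|[|[|[|//]]]] hi.
- by have -> : Ordinal hi = i0 by apply: val_inj.
- by have -> : Ordinal hi = i1 by apply: val_inj.
- by have -> : Ordinal hi = i2 by apply: val_inj.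
- by have -> : Ordinal hi = i3 by apply: val_inj.
Qed.

Lemma form2_eq_basis (b c : L2H H p) :
  (forall i j, fapp b [args h i; h j] = fapp c [args h i; h j]) -> b = c.
Proof.
move=> bc; apply: form_eqP => v; rewrite (args2E v).
rewrite (lb_span B (v 0)) (lb_span B (v 1)) !form2_exp.
by apply: eq_bigr => i _; apply: eq_bigr => j _; rewrite bc.
Qed.

Lemma form2_anti (b : L2H H p) i j :
  fapp b [args h i; h j] = - (fapp b [args h j; h i] : R) :> R.
Proof. exact: (alt2_anti (fapp_form b)). Qed.

(** Traces over different Levi-dual bases agree, as all of them are the contraction
    with the inverse matrix of the Levi form. *)
Lemma trace_freeE (b : L2H H p) : trace_free b <->
  fapp b [args h i0; h i3] = 3 * (fapp b [args h i1; h i2] : R) :> R.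
Proof.
have fb := fapp_form b.
split=> [tb|b03 a x y xy].
  have [a a0] := lb_nontrivial B; have l0 := lb_neq0 B a0.
  pose l := (lam a)^-1.
  (* The basis that is Levi-dual to h. *)
  pose y (i : 'I_4) : Hb H p := match nat_of_ord i with
    | 0 => l *: h i3 | 1 => (- 3 * l) *: h i2 | 2 => (3 * l) *: h i1
    | _ => (- l) *: h i0 end.
  have : forall i j, fapp (levi a) [args h i; y j] = (i == j)%:R.
    have ll : lam a * l = 1 by rewrite /l mulfV.
    have E i c j : fapp (levi a) [args h i; c *: h j] = c * (lam a * omega_mx i j) :> R.
      by rewrite (form2Zr (fapp_form (levi a))) (lb_levi B).
    apply: ord4; apply: ord4; rewrite /y /= [LHS]E /omega_mx /=;
      by rewrite ?mulr0 ?mulr1 ?mulrN1 ?mulrN ?mulNr ?opprK //= ?[l * _]mulrC ?ll //;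
        rewrite -?mulrA ?[l * _]mulrC ?[_ / 3]mulrC -?mulrA ?ll; field.
  move=> /tb; rewrite sum4 /y /= !(form2Zr fb) [X in _ + X]/=.
  have := form2_anti b i2 i1; have := form2_anti b i3 i0.
  set b03 := fapp b [args h i0; h i3]; set b12 := fapp b [args h i1; h i2].
  move=> -> ->; have l0' : l != 0 by rewrite invr_eq0.
  move=> E; have {}E : l * (b03 : R) + - 3 * l * (b12 : R) + 3 * l * - (b12 : R)
    + - l * - (b03 : R) = 0 by exact: E.
  apply: (mulfI l0'); move: (b03 : R) (b12 : R) E => s t E; lra.
have fl := fapp_form (levi a).
pose X : 'M[R]_4 := \matrix_(i, j) happ (w j) (x i).
pose Y : 'M[R]_4 := \matrix_(i, j) happ (w j) (y i).
pose Om : 'M[R]_4 := \matrix_(i, j) (lam a * omega_mx i j).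
pose Bm : 'M[R]_4 := \matrix_(i, j) fapp b [args h i; h j].
have valE (c : L2H H p) (C : 'M[R]_4) i j :
    (forall i j, fapp c [args h i; h j] = C i j :> R) ->
    fapp c [args x i; y j] = (X *m C *m Y^T) i j :> R.
  move=> cC; rewrite (lb_span B (x i)) (lb_span B (y j)) form2_exp !mxE.
  rewrite exchange_big /=; apply: eq_bigr => n _.
  rewrite !mxE mulr_suml; apply: eq_bigr => m _.
  by rewrite !mxE cC mulrAC.
have XOY : X *m (Om *m Y^T) = 1%:M.
  apply/matrixP => i j; rewrite mulmxA -(valE (levi a)) ?xy ?mxE //.
  by move=> m n; rewrite mxE (lb_levi B).
have OYX := mulmx1C XOY; rewrite -mulmxA in OYX.
set P := Y^T *m X in OYX.
have -> : \sum_i (fapp b [args x i; y i] : R) = \tr (X *m Bm *m Y^T).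
  by apply: eq_bigr => i _; rewrite (valE b Bm) // => m n; rewrite mxE.
rewrite mxtrace_mulC mulmxA -/P.
clearbody P.
have PE i j := congr1 (fun A : 'M[R]_4 => A i j) OYX.
have l0 : lam a != 0.
  apply/eqP => l0; have := PE i0 i0; rewrite !mxE sum4 !mxE l0 !mul0r !addr0.
  by move/eqP; rewrite eq_sym oner_eq0.
have E (c t d : R) : c != 0 -> lam a * c * t = d -> t = d / c / lam a.
  by move=> c0 <-; field; apply/andP.
have e0 j : P i3 j = (i0 == j)%:R / lam a.
  have := PE i0 j; rewrite !mxE sum4 !mxE /omega_mx /= !(mulr0, mul0r, add0r, addr0).
  by move/E => -> //; rewrite ?oner_eq0 // divr1.
have e3 j : P i0 j = - (i3 == j)%:R / lam a.
  have := PE i3 j; rewrite !mxE sum4 !mxE /omega_mx /= !(mulr0, mul0r, add0r, addr0).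
  by move/E => ->; rewrite ?oppr_eq0 ?oner_eq0 // invrN1 mulrN1.
have e1 j : P i2 j = - 3 * (i1 == j)%:R / lam a.
  have := PE i1 j; rewrite !mxE sum4 !mxE /omega_mx /= !(mulr0, mul0r, add0r, addr0).
  by move/E => ->; rewrite ?oppr_eq0 ?invr_eq0 ?pnatr_eq0 // invrN invrK; ring.
have e2 j : P i1 j = 3 * (i2 == j)%:R / lam a.
  have := PE i2 j; rewrite !mxE sum4 !mxE /omega_mx /= !(mulr0, mul0r, add0r, addr0).
  by move/E => ->; rewrite ?invr_eq0 ?pnatr_eq0 // invrK; ring.
rewrite /mxtrace sum4 !mxE !sum4 !mxE !e0 !e1 !e2 !e3 /=.
rewrite (form2_anti b i2 i1) (form2_anti b i3 i0) b03.
by ring.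
Qed.

(** ** Projection along the Levi form *)

(** The multiple of the Levi form that the projection subtracts. *)
Definition omega_part (b : L2H H p) : R :=
  ((fapp b [args h i0; h i3] : R) - 3 * (fapp b [args h i1; h i2] : R)) / 2.

Lemma lam_surj (x : R) : exists a, lam a = x.
Proof.
have [a a0] := lb_nontrivial B; have l0 := lb_neq0 B a0.
exists ((x / lam a) *: a).
have := lb_levi B ((x / lam a) *: a) i0 i3.
have -> : levi ((x / lam a) *: a) = (x / lam a) *: levi a.
  have := lb_levi_lin B (x / lam a) a 0; rewrite addr0 => ->.
  have := lb_levi_lin B (-1) 0 0; rewrite scaler0 addr0 scaleN1r addNr => ->.
  by rewrite addr0.
rewrite bfappZ (lb_levi B) /omega_mx /= !mulr1 => <-.
by rewrite -[RHS](divfK l0).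
Qed.

Lemma proj_perpP (b : L2H H p) :
  exists2 a, lam a = omega_part b & b = elt_val (proj_perp b) + levi a.
Proof.
have [a la] := lam_surj (omega_part b).
have tf : trace_free (b - levi a).
  have E i j : fapp (b - levi a) [args h i; h j] =
    (fapp b [args h i; h j] : R) - omega_part b * omega_mx i j :> R.
    by rewrite bfappD bfappN (lb_levi B) la.
  by apply/trace_freeE; rewrite !E /omega_mx /omega_part /=; field.
have ex : exists b' : L2perp H p,
    [set b' : L2perp H p | exists a : Lb H p, b = elt_val b' + levi a] b'.
  exists (to_elt _ (b - levi a)); exists a.
  by rewrite to_eltK // subrK.
have := xgetPex 0 ex; rewrite -/(proj_perp b) => -[c bE].
exists c => //; rewrite bE /omega_part !bfappD !(lb_levi B).
have := (trace_freeE (elt_val (proj_perp b))).1 (elt_set (proj_perp b)).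
set x := fapp _ [args h i0; _]; set y := fapp _ [args h i1; _] => xy.
have -> : x = 3 * (y : R) by [].
rewrite /omega_mx /=; move: (y : R) => z.
by rewrite -[LHS]/(lam c); have E : lam c = ((3 * z + lam c * 1) - 3 * (z + lam c * - 3^-1)) / 2;
  [field | exact: E].
Qed.

Lemma proj_perpE (b : L2H H p) i j :
  fapp (elt_val (proj_perp b)) [args h i; h j] =
    (fapp b [args h i; h j] : R) - omega_part b * omega_mx i j :> R.
Proof.
have [a la bE] := proj_perpP b.
by rewrite {2}bE bfappD (lb_levi B) la -[RHS]/(_ + _ - _) addrK.
Qed.

Lemma perp_eqP (u v : L2perp H p) :
  (forall i j, fapp (elt_val u) [args h i; h j] = fapp (elt_val v) [args h i; h j]) ->
  u = v.
Proof. by move=> uv; apply: sub_eqP; apply: form2_eq_basis. Qed.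

Lemma proj_perp_lin c (a b : L2H H p) :
  proj_perp (c *: a + b) = c *: proj_perp a + proj_perp b.
Proof.
apply: perp_eqP => i j; rewrite sub_lin bfappD bfappZ [LHS]proj_perpE.
rewrite -[RHS]/(c * (fapp (elt_val (proj_perp a)) [args h i; h j] : R)
  + (fapp (elt_val (proj_perp b)) [args h i; h j] : R)) !proj_perpE.
rewrite /omega_part !bfappD !bfappZ.
have E (x y z t u v : R) : c * x + y - (c * z + t - 3 * (c * u + v)) / 2 * omega_mx i j =
  c * (x - (z - 3 * u) / 2 * omega_mx i j) + (y - (t - 3 * v) / 2 * omega_mx i j).
  by ring.
exact: E.
Qed.

Lemma proj_perp_levi (a : Lb H p) : proj_perp (levi a) = 0.
Proof.
apply: perp_eqP => i j; rewrite [LHS]proj_perpE /omega_part !(lb_levi B) sub0 bfapp0.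
by rewrite /omega_mx /=; field.
Qed.

End Trace.

(** ** The Rumin operator and the partial torsion *)

Section Torsion.
Context {R : realType} {M : manifold R 5}.
Context {H : forall p : M, lin_subspace (@TM R 5 M p)}.
Context {U : set M} {e : 'I_5 -> section (@TM R 5 M)}.
Hypothesis Fr : is_frame U e.
Hypothesis HU : forall q, U q -> forall v : @TM R 5 M q,
  H q v <-> exists c : 'I_4 -> R,
    v = \sum_i c i *: e (widen_ord (leqnSn 4) i) q.
Context {p : M}.
Hypothesis Up : U p.
Context {h : 'I_4 -> Hb H p} {w : 'I_4 -> L1H H p} {lam : Lb H p -> R}.
Hypothesis B : levi_basis h w lam.

Definition lift1 (u : section (L1H H)) : section (dualb (@TM R 5 M)) := fun q =>
  \sum_i (happ (u q) (hframe e i q) : R) *: coframe e (wid i) q.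

Lemma smooth_lift1 (u : section (L1H H)) : smooth_sec u p -> smooth_sec (lift1 u) p.
Proof.
move=> su; have smD : smooth_module (dualb (@TM R 5 M)) p.
  by apply: form_module; apply: triv_module.
apply: (sm_sum smD) => i; apply: (sm_scale smD); last exact: (smooth_coframe Fr).
by apply: (smooth_happ su); apply: (smooth_frame (hframe_frame Fr HU)).
Qed.

Lemma lift1E (u : section (L1H H)) q : U q -> restr1 H (lift1 u q) = u q.
Proof.
move=> Uq; have FH := hframe_frame Fr HU; apply: hom_eqP => v.
rewrite -(coordK FH v Uq) !happ_sum; apply: eq_bigr => i _; rewrite !happZ.
congr (_ *: _); rewrite restr1E (hframeE HU) // happ_suml (bigD1 i) //= big1 ?addr0.
  rewrite happZl (coframeE Fr) // (coord_frame Fr) // eqxx.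
  by rewrite -[RHS]mulr1.
move=> j ji; rewrite happZl (coframeE Fr) // (coord_frame Fr) //.
by rewrite -val_eqE /= val_eqE eq_sym (negPf ji) scaler0.
Qed.

Lemma extd_restr (w' : section (dualb (@TM R 5 M))) (X Y : section (Hb H)) :
  smooth_sec w' p -> smooth_sec X p -> smooth_sec Y p ->
  fapp (restr2 H (extd w' p)) [args X p; Y p] = dform w' p (hval X) (hval Y).
Proof. by move=> sw sX sY; rewrite restr2E (extdE Fr Up sw (X := hval X) (Y := hval Y)). Qed.

(** Two lifts differ at p by an annihilator a of H; their differentials differ on H
    by the Levi form of a. *)
Lemma lift_indep (w' w'' : section (dualb (@TM R 5 M))) :
  smooth_sec w' p -> smooth_sec w'' p ->
  (\forall q \near p, restr1 H (w' q) = restr1 H (w'' q)) ->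
  proj_perp (restr2 H (extd w' p)) = proj_perp (restr2 H (extd w'' p)).
Proof.
move=> sw' sw'' ww; have w0 := nbhs_singleton ww.
pose a : Lb H p := to_elt _ (w' p - w'' p).
have aE : elt_val a = w' p - w'' p.
  apply: to_eltK => v Hv; rewrite happDl happNl -(to_eltK Hv) -!restr1E w0.
  by rewrite subrr.
have FH := hframe_frame Fr HU.
suff -> : restr2 H (extd w' p) = 1 *: levi a + restr2 H (extd w'' p).
  by rewrite (proj_perp_lin B) (proj_perp_levi B) scaler0 add0r.
apply: (form_eq_smooth FH Up) => s ss.
rewrite bfappD bfappZ scale1r (args2E (s^~ p)) !extd_restr //.
rewrite (leviE Fr HU _ Up) // aE happDl happNl /dform.
have E (X Y : section (Hb H)) : smooth_sec Y p -> tapp (hval X p) (fun q => happ (w' q) (hval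
  Y q)) =
    tapp (hval X p) (fun q => happ (w'' q) (hval Y q)).
  move=> sY; apply: tapp_eq.
    by apply: (smooth_happ sw' (s := hval Y)).
  by apply: filterS ww => q wq; rewrite -!restr1E wq.
rewrite !E //.
have E' (x y z t : R) : x - y - z = - (z - t) + (x - y - t) by ring.
exact: E'.
Qed.

Lemma ruminE (u : section (L1H H)) (u' : section (dualb (@TM R 5 M))) :
  smooth_sec u p -> smooth_sec u' p -> (\forall q \near p, restr1 H (u' q) = u q) ->
  rumin u p = proj_perp (restr2 H (extd u' p)).
Proof.
move=> su su' uu'.
have ex : exists b : L2perp H p, [set b : L2perp H p |
    exists w' : section (dualb (@TM R 5 M)),
    [/\ smooth_sec w' p, (\forall q \near p, restr1 H (w' q) = u q) &
        b = proj_perp (restr2 H (extd w' p))]] b.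
  by exists (proj_perp (restr2 H (extd u' p))); exists u'.
have := xgetPex 0 ex; rewrite -/(rumin u p) => -[u'' [su'' uu'' ->]].
apply: lift_indep => //; move: uu'; apply: filter_app; apply: filterS uu''.
by move=> q -> ->.
Qed.

Definition alt_form (D : operator H (L1H H)) (u : section (L1H H)) : L2H H p :=
  mk_form Alt (fun v : 'I_2 -> Hb H p =>
    (happ (D p (v 0) u) (v 1) - happ (D p (v 1) u) (v 0) : R^o)).

Variable D : operator H (L1H H).
Arguments D : clear implicits.
Hypothesis cD : pconn_at D p.

Lemma alt_formE (u : section (L1H H)) x y : smooth_sec u p ->
  fapp (alt_form D u) [args x; y] =
    (happ (D p x u) y : R) - (happ (D p y u) x : R) :> R.
Proof.
move=> su; rewrite mk_formE //; apply: is_form2_alt => [|z]; last first.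
  by rewrite -[LHS]/(_ - _) subrr.
apply: (is_form2 (g := fun x y => (happ (D p x u) y : R^o) - happ (D p y u) x)).
  move=> a x' y' z; rewrite (at_linear cD) // happDl happZl happ_lin.
  by rewrite scalerBr opprD addrACA.
move=> a x' y' z; rewrite (at_linear cD) // happDl happZl happ_lin.
by rewrite scalerBr opprD addrACA.
Qed.

Definition torsion_form (u : section (L1H H)) (u' : section (dualb (@TM R 5 M))) :
    L2H H p := alt_form D u - restr2 H (extd u' p).

Lemma torsion_formE u u' v : fapp (torsion_form u u') v =
  fapp (alt_form D u) v - fapp (restr2 H (extd u' p)) v.
Proof. by rewrite /torsion_form bfappD bfappN. Qed.

Lemma torsion_form_lin f u v u' v' : smooth_fun f p ->
  smooth_sec u p -> smooth_sec v p -> smooth_sec u' p -> smooth_sec v' p ->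
  (\forall q \near p, restr1 H (u' q) = u q) ->
  torsion_form (fun q => f q *: u q + v q) (fun q => f q *: u' q + v' q) =
  f p *: torsion_form u u' + torsion_form v v'.
Proof.
move=> sf su sv su' sv' uu'; have FH := hframe_frame Fr HU.
have smL : smooth_module (L1H H) p by apply: form_module; apply: triv_module.
have smD : smooth_module (dualb (@TM R 5 M)) p.
  by apply: form_module; apply: triv_module.
apply: (form_eq_smooth FH Up) => s ss.
rewrite (args2E (s^~ p)) [in RHS]bfappD [in RHS]bfappZ !torsion_formE.
have sfu := sm_lin smL sf su sv; have sfu' := sm_lin smD sf su' sv'.
rewrite !alt_formE // !extd_restr // /dform.
rewrite !(at_lin cD smL) // !happDl !happZl.
have E (X Y : section (Hb H)) : smooth_sec Y p ->
    tapp (hval X p) (fun q => happ (f q *: u' q + v' q) (hval Y q)) =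
    f p * tapp (hval X p) (fun q => happ (u' q) (hval Y q))
    + (happ (u p) (Y p) : R) * tapp (hval X p) f
    + tapp (hval X p) (fun q => happ (v' q) (hval Y q)).
  move=> sY.
  have s1 : smooth_fun (fun q => happ (u' q) (hval Y q)) p.
    exact: (smooth_happ su' (s := hval Y)).
  have s2 : smooth_fun (fun q => happ (v' q) (hval Y q)) p.
    exact: (smooth_happ sv' (s := hval Y)).
  rewrite -[X in X * tapp _ f](_ : happ (u' p) (hval Y p) = _ :> R); last first.
    by rewrite -(nbhs_singleton uu') restr1E.
  by rewrite -tapp_mul // -tapp_add //; apply: smooth_mul.
rewrite !E // /Hderiv /hval.
have E' (F x1 x2 x3 y1 y2 y3 a1 a3 b1 b3 c1 c2 d1 d2 : R) :
  F * x1 + x2 * x3 + c1 - (F * y1 + y2 * y3 + c2) -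
   (F * a1 + x3 * x2 + a3 - (F * b1 + y3 * y2 + b3) - (F * d1 + d2)) =
  F * (x1 - y1 - (a1 - b1 - d1)) + (c1 - c2 - (a3 - b3 - d2)) by ring.
exact: E'.
Qed.

(** The connection and the Rumin operator obey the same Leibniz rule, so that their
    difference is tensorial. *)
Lemma torsionE (u : section (L1H H)) (u' : section (dualb (@TM R 5 M))) :
  smooth_sec u p -> smooth_sec u' p -> (\forall q \near p, restr1 H (u' q) = u q) ->
  happ (torsion D p) (u p) = proj_perp (torsion_form u u').
Proof.
move=> su su' uu'.
have FH := hframe_frame Fr HU; have FL := coframe_frame FH.
have lift_near (v : section (L1H H)) : \forall q \near p, restr1 H (lift1 v q) = v q.
  by apply: filterS (frame_nbhs Fr Up) => q Uq; apply: lift1E.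
have PhiE v v' : smooth_sec v p -> smooth_sec v' p ->
    (\forall q \near p, restr1 H (v' q) = v q) ->
    nabla_perp D v p - rumin v p = proj_perp (torsion_form v v').
  move=> sv sv' vv'; rewrite (ruminE sv sv' vv') /nabla_perp -/(alt_form D v).
  rewrite /torsion_form; have := proj_perp_lin B (-1) (restr2 H (extd v' p)) (alt_form D v).
  by rewrite !scaleN1r [- _ + alt_form D v]addrC => ->; rewrite addrC.
have [t tE] : exists t : elt (forms Any 1 (L1H H p) (L2perp H p)),
    forall s : 'I_1 -> section (L1H H), (forall i, smooth_sec (s i) p) ->
    fapp t (fun i => s i p) = nabla_perp D (s 0) p - rumin (s 0) p.
  apply: (tensorial FL Up) => // [s i f v v' ss sf sv sv'|s i v v' ss sv sv' vv'].
    rewrite (ord1 i) !upd_same.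
    have sl := smooth_lift1 sv; have sl' := smooth_lift1 sv'.
    have smL : smooth_module (L1H H) p by apply: form_module; apply: triv_module.
    have smD : smooth_module (dualb (@TM R 5 M)) p.
      by apply: form_module; apply: triv_module.
    rewrite (PhiE v _ sv sl (lift_near v)) (PhiE v' _ sv' sl' (lift_near v')).
    rewrite -(proj_perp_lin B) -torsion_form_lin //.
    apply: PhiE; try exact: sm_lin.
    apply: filterS (frame_nbhs Fr Up) => q Uq; apply: hom_eqP => y.
    rewrite restr1E !happDl !happZl; congr (_ *: _ + _);
      by rewrite -restr1E lift1E.
  rewrite (ord1 i) !upd_same.
  have sl := smooth_lift1 sv; have sl' := smooth_lift1 sv'.
  have lv' : \forall q \near p, restr1 H (lift1 v q) = v' q.
    by move: vv'; apply: filter_app; apply: filterS (lift_near v) => q -> ->.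
  rewrite (PhiE v _ sv sl (lift_near v)) (PhiE v' _ sv' sl lv').
  congr (proj_perp (_ - _)); apply: form_eqP => y.
  rewrite (args2E y) !alt_formE //.
  by rewrite !(at_local cD _ sv sv' vv').
have ex : exists t : homb (L1H H) (L2perp H) p, [set t : homb (L1H H) (L2perp H) p |
    forall v : section (L1H H), smooth_sec v p ->
    happ t (v p) = nabla_perp D v p - rumin v p] t.
  exists t => v sv; rewrite -(tE (fun=> v)) // /happ.
  by congr fapp; rewrite [RHS]args1E.
by have := xgetPex 0 ex; rewrite -/(torsion D p) => /(_ u su) ->; apply: PhiE.
Qed.

End Torsion.

Arguments lift1 {R M H} e u p.

(** * Change of frame, bundle isomorphisms and twists *)

Section FrameOps.
Context {R : realType} {n : nat} {M : manifold R n} {E : prebundle M}.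

Lemma is_frame_sub r (U V : set M) (e : 'I_r -> section E) :
  open V -> (V `<=` U) -> is_frame U e -> is_frame V e.
Proof. by move=> oV VU [oU b s]; split=> // [q /VU|w q /VU]; [apply: b|apply: s]. Qed.

Lemma frame_scale r (U : set M) (e : 'I_r -> section E) (g : 'I_r -> M -> R) :
  is_frame U e -> (forall i q, U q -> smooth_fun (g i) q) ->
  (forall i q, U q -> g i q != 0) ->
  is_frame U (fun i q => g i q *: e i q).
Proof.
move=> Fr sg g0; have [oU _ _] := Fr; split=> // [q Uq v|s q Uq].
  exists (fun i => coord e v i / g i q); split.
    rewrite -{1}(coordK Fr v Uq); apply: eq_bigr => i _.
    by rewrite scalerA divfK // g0.
  move=> c vc; apply/funext => i; rewrite vc.
  under eq_bigr do rewrite scalerA.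
  by rewrite (coord_sum Fr (fun i => c i * g i q)) // mulfK // g0.
split=> [/(smooth_coord Fr _ Uq) sc|[c sc sE]].
  exists (fun i x => coord e (s x) i * (g i x)^-1).
    by move=> i; apply: smooth_mul => //; apply: smooth_inv; [apply: sg|apply: g0].
  apply: filterS (frame_nbhs Fr Uq) => x Ux.
  rewrite -{1}(coordK Fr (s x) Ux); apply: eq_bigr => i _.
  by rewrite scalerA divfK // g0.
have smE := frame_module Fr Uq.
apply: (sm_eq smE (s := fun x => \sum_i c i x *: (g i x *: e i x))).
  by apply: filterS sE => x ->.
apply: (sm_sum smE) => i; apply: (sm_scale smE) => //.
by apply: (sm_scale smE); [apply: sg | apply: (smooth_frame Fr)].
Qed.

End FrameOps.

Section PolExtra.
Context {R : realType}.

Lemma pol_linear (V W : lmodType R) (g : V -> W) l (c : nat -> V) :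
  (forall a x y, g (a *: x + y) = a *: g x + g y) ->
  g (pol l c) = pol l (g \o c).
Proof.
move=> gl; elim: l c => //= ab l IH c.
have g0 : g 0 = 0.
  by have := gl (-1) 0 0; rewrite scaler0 addr0 scaleN1r addNr.
have gZ a x : g (a *: x) = a *: g x by rewrite -[a *: x]addr0 gl g0 addr0.
by rewrite gl gZ !IH.
Qed.

Lemma pol_args k (T : Type) (W : lmodType R) (t : k.-tuple T) (F : T -> R * R)
    (c : nat -> W) :
  pol [seq F (tnth t i) | i <- enum 'I_k] c = pol (map F t) c.
Proof. by rewrite -[in RHS](map_tnth_enum t) -map_comp. Qed.

Lemma smooth_pol n (M : manifold R n) k (a b : 'I_k -> M -> R) (c : nat -> R) p :
  (forall i, smooth_fun (a i) p) -> (forall i, smooth_fun (b i) p) ->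
  smooth_fun (fun q => pol [seq (a i q, b i q) | i <- enum 'I_k] (c : nat -> R^o)) p.
Proof.
move=> sa sb; elim: (enum 'I_k) c => [|i l IH] c /=; first exact: smooth_cst.
by apply: smooth_add; apply: smooth_mul => //; apply: IH.
Qed.

Lemma sum2 (V : nmodType) (F : 'I_2 -> V) : \sum_i F i = F 0 + F 1.
Proof. by rewrite !big_ord_recl big_ord0 addr0; congr (_ + F _); apply: val_inj. Qed.

End PolExtra.

Section BundleIso.
Context {R : realType} {n : nat} {M : manifold R n} {E F : prebundle M}.
Variables (phi : bundle_iso E F).

Lemma iso_of_linear p a (u v : F p) :
  iso_of phi (a *: u + v) = a *: iso_of phi u + iso_of phi v.
Proof.
apply: (can_inj (@iso_toK _ _ _ _ _ phi p)).
by rewrite iso_linear !iso_ofK.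
Qed.

Lemma iso_of_smooth (s : section F) p :
  smooth_sec s p -> smooth_sec (fun q => iso_of phi (s q)) p.
Proof.
move=> ss; apply/(iso_smooth phi); move: ss; congr (smooth_sec _ p).
by apply: functional_extensionality_dep => q; rewrite iso_ofK.
Qed.

End BundleIso.

Section Twist.
Context {R : realType} {M : manifold R 5}.
Context {H : forall p : M, lin_subspace (@TM R 5 M p)} {D : prebundle M}.
Implicit Types (p q : M).

Lemma twistE q (w : L1H H q) (d1 d2 : D q) v (z : 'I_2 -> dualb D q) :
  fapp (happ (twist w d1 d2) v) z =
    (happ w v : R) * (happ (z 0) d1 * happ (z 1) d2) :> R.
Proof.
have inner u : is_form Any (fun z : 'I_2 -> dualb D q =>
    (happ w u : R) * (happ (z 0) d1 * happ (z 1) d2) : R^o).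
  apply: (is_form2 (g := fun x y : dualb D q =>
    (happ w u : R) * (happ x d1 * happ y d2) : R^o)) => a x y t.
    rewrite happDl happZl.
    have E (A b c i j : R) : A * ((b * c + i) * j) = b * (A * (c * j)) + A * (i * j) by ring.
    exact: E.
  rewrite happDl happZl.
  have E (A b c i j : R) : A * (j * (b * c + i)) = b * (A * (j * c)) + A * (j * i) by ring.
  exact: E.
rewrite /twist (happ_mk (E := Hb H) (F := tensb 2 D) (g := fun u : Hb H q =>
  mk_form Any (fun z : 'I_2 -> dualb D q =>
    (happ w u : R) * (happ (z 0) d1 * happ (z 1) d2) : R^o) : tensb 2 D q)).
  by rewrite mk_formE.
move=> a x y; apply: form_eqP => u; rewrite bfappD bfappZ !mk_formE // happ_lin.
have E (b c i : R) : (a * b + c) * i = a * (b * i) + c * i by ring.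
exact: E.
Qed.

Lemma twist_eq q (T T' : homb (Hb H) (tensb 2 D) q) :
  (forall v z, fapp (happ T v) z = fapp (happ T' v) z) -> T = T'.
Proof. by move=> TT; apply: hom_eqP => v; apply: form_eqP => z; apply: TT. Qed.

Lemma twist_lin q a (w w' : L1H H q) (d1 d2 : D q) :
  twist (a *: w + w') d1 d2 = a *: twist w d1 d2 + twist w' d1 d2.
Proof.
apply: twist_eq => v z; rewrite happDl happZl bfappD bfappZ !twistE happDl happZl.
have E (b c i : R) : (a * b + c) * i = a * (b * i) + c * i by ring.
exact: E.
Qed.

Lemma twist_linl q a (w : L1H H q) (d d1 d2 : D q) :
  twist w (a *: d + d1) d2 = a *: twist w d d2 + twist w d1 d2.
Proof.
apply: twist_eq => v z; rewrite happDl happZl bfappD bfappZ !twistE (happ_lin (z 0)).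
have E (A b c i : R) : A * ((a * b + c) * i) = a * (A * (b * i)) + A * (c * i) by ring.
exact: E.
Qed.

Lemma twist_linr q a (w : L1H H q) (d d1 d2 : D q) :
  twist w d2 (a *: d + d1) = a *: twist w d2 d + twist w d2 d1.
Proof.
apply: twist_eq => v z; rewrite happDl happZl bfappD bfappZ !twistE (happ_lin (z 1)).
have E (A b c i : R) : A * (i * (a * b + c)) = a * (A * (i * b)) + A * (i * c) by ring.
exact: E.
Qed.

Lemma twist_scale q a (w : L1H H q) (d : D q) :
  twist w (a *: d) (a *: d) = twist ((a ^+ 2) *: w) d d.
Proof.
apply: twist_eq => v z; rewrite !twistE happZl !happZ.
have E (b c i : R) : b * ((a * c) * (a * i)) = (a ^+ 2 * b) * (c * i) by ring.
exact: E.
Qed.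

Lemma smooth_twist (w : section (L1H H)) (d1 d2 : section D) p :
  smooth_sec w p -> smooth_sec d1 p -> smooth_sec d2 p ->
  smooth_sec (fun q => twist (w q) (d1 q) (d2 q)) p.
Proof.
move=> sw s1 s2; apply: smooth_happP => X sX z sz.
apply: smooth_eq (smooth_mul (smooth_happ sw sX)
  (smooth_mul (smooth_happ (sz 0) s1) (smooth_happ (sz 1) s2))).
by apply: nearW => q; rewrite twistE.
Qed.

Context {U : set M} {de : 'I_1 -> section D}.
Hypothesis Fd : is_frame U de.

Definition dcoord q (d : D q) : R := coord de d 0.

Lemma dcoordE q (d : D q) : U q -> d = dcoord d *: de 0 q.
Proof. by move=> Uq; rewrite -{1}(coordK Fd d Uq) big_ord1. Qed.

Lemma dcoord_neq0 q (d : D q) : U q -> d != 0 -> dcoord d != 0.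
Proof.
by move=> Uq; apply: contra => /eqP d0; rewrite (dcoordE d Uq) d0 scale0r.
Qed.

Lemma de_neq0 q : U q -> de 0 q != 0.
Proof.
move=> Uq; apply/eqP => d0; have := coord_frame Fd 0 0 Uq; rewrite d0.
rewrite (_ : 0 = \sum_i (0 : R) *: de i q) ?(coord_sum Fd) //.
  by move/eqP; rewrite eq_sym oner_eq0.
by rewrite big1 // => i _; rewrite scale0r.
Qed.

Lemma dual1E q (z : dualb D q) : U q ->
  z = (happ z (de 0 q) : R) *: coframe de 0 q.
Proof. by move=> Uq; rewrite {1}(dual_coordE Fd z Uq) big_ord1. Qed.

Lemma tens_exp q (T : tensb 2 D q) (z : 'I_2 -> dualb D q) : U q ->
  fapp T z = (happ (z 0) (de 0 q) : R) * (happ (z 1) (de 0 q) : R) *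
    (fapp T [args coframe de 0 q; coframe de 0 q] : R) :> R.
Proof.
move=> Uq; have fT := fapp_form T; rewrite {1}(args2E z).
rewrite {1}(dual1E (z 0) Uq) {1}(dual1E (z 1) Uq) (form2Zl fT) (form2Zr fT).
by rewrite scalerA.
Qed.

(** The inverse of w |-> w d^2. *)
Definition untwist q (d : D q) (T : homb (Hb H) (tensb 2 D) q) : L1H H q :=
  mk_form Any (fun v : 'I_1 -> Hb H q =>
    (fapp (happ T (v 0)) [args coframe de 0 q; coframe de 0 q] : R)
      / dcoord d ^+ 2 : R^o).

Lemma untwistE q (d : D q) T v : happ (untwist d T) v =
  (fapp (happ T v) [args coframe de 0 q; coframe de 0 q] : R) / dcoord d ^+ 2 :> R.
Proof.
rewrite /untwist (happ_mk (E := Hb H) (F := trivb) (g := fun v => (fapp (happ T v)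
  [args coframe de 0 q; coframe de 0 q] : R) / dcoord d ^+ 2 : R^o)) //.
move=> a x y; rewrite happ_lin bfappD bfappZ.
have E (b c i : R) : (a * b + c) / i = a * (b / i) + c / i by ring.
exact: E.
Qed.

Lemma untwistK q (d : D q) T : U q -> d != 0 -> twist (untwist d T) d d = T.
Proof.
move=> Uq d0; apply: twist_eq => v z; rewrite twistE untwistE [RHS]tens_exp //.
rewrite {2 3}(dcoordE d Uq) !happZ; have c0 := dcoord_neq0 Uq d0.
have E (a b c x : R) : c != 0 -> x / c ^+ 2 * ((c * a) * (c * b)) = a * b * x.
  by move=> h; field.
exact: E.
Qed.

Lemma twist_inj q (d : D q) (w w' : L1H H q) : U q -> d != 0 ->
  twist w d d = twist w' d d -> w = w'.
Proof.
move=> Uq d0 ww; have c0 := dcoord_neq0 Uq d0; apply: hom_eqP => v.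
have := congr1 (fun T : homb (Hb H) (tensb 2 D) q =>
  fapp (happ T v) [args coframe de 0 q; coframe de 0 q]) ww.
rewrite /= !twistE !(tnth_nth (coframe de 0 q)) /= (coframeE Fd) // -/(dcoord d).
by move/(mulIf (mulf_neq0 c0 c0)).
Qed.

Lemma smooth_untwist (d : section D) (T : section (homb (Hb H) (tensb 2 D))) p :
  U p -> smooth_sec d p -> d p != 0 -> smooth_sec T p ->
  smooth_sec (fun q => untwist (d q) (T q)) p.
Proof.
move=> Up sd d0 sT; apply: smooth_happP => X sX.
have sc : smooth_fun (fun q => dcoord (d q)) p := (smooth_coord Fd d Up).1 sd 0.
have sTX := smooth_happ sT sX.
have sda := smooth_coframe Fd 0 Up.
have := smooth_fapp2 sTX sda sda => sv.
have c0 := dcoord_neq0 Up d0.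
have := smooth_mul sv (smooth_inv (smooth_mul sc sc) (mulf_neq0 c0 c0)).
by apply: smooth_eq; apply: nearW => q; rewrite untwistE expr2.
Qed.

End Twist.

Arguments dcoord {R M D} de {q} d.
Arguments untwist {R M H D} de {q} d T.

(** Cubes span the binary cubics, so that a skew form is determined by its values on
    finitely many pairs of cubes. *)
Lemma skew_cubes {R : realFieldType} (l01 l02 l03 l12 l13 l23 c : R) :
  (forall x0 x1 y0 y1 : R,
    (x0 ^+ 3 * (3 * y0 ^+ 2 * y1) - (3 * x0 ^+ 2 * x1) * y0 ^+ 3) * l01
    + (x0 ^+ 3 * (3 * y0 * y1 ^+ 2) - (3 * x0 * x1 ^+ 2) * y0 ^+ 3) * l02
    + (x0 ^+ 3 * y1 ^+ 3 - x1 ^+ 3 * y0 ^+ 3) * l03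
    + ((3 * x0 ^+ 2 * x1) * (3 * y0 * y1 ^+ 2)
       - (3 * x0 * x1 ^+ 2) * (3 * y0 ^+ 2 * y1)) * l12
    + ((3 * x0 ^+ 2 * x1) * y1 ^+ 3 - x1 ^+ 3 * (3 * y0 ^+ 2 * y1)) * l13
    + ((3 * x0 * x1 ^+ 2) * y1 ^+ 3 - x1 ^+ 3 * (3 * y0 * y1 ^+ 2)) * l23
    = c * (x0 * y1 - x1 * y0) ^+ 3) ->
  [/\ l01 = 0, l02 = 0, l13 = 0, l23 = 0 & l12 = - l03 / 3].
Proof.
move=> E; move: (E 1 0 0 1) (E 1 0 1 1) (E 1 0 1 (-1)) (E 0 1 1 1) (E 0 1 1 (-1)) (E 1 1 1 (-1)).
by move=> {E} *; split; lra.
Qed.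

(** * Volume forms *)

Section FiveForms.
Context {R : realType} {M : manifold R 5}.
Implicit Types (p q : M).

Lemma wedge5E q (w : 'I_5 -> dualb (@TM R 5 M) q) v :
  fapp (wedge5 w) v = \det (\matrix_(i, j) (happ (w i) (v j) : R)) :> R.
Proof.
rewrite mk_formE //; split=> [z j a x y|z i j ij zij]; last first.
  rewrite -det_tr; apply: (determinant_alternate ij) => k.
  by rewrite !mxE zij.
rewrite -[RHS]/(a * _ + _) -!(det_tr (\matrix_(_, _) _)).
rewrite -[X in _ = _ + X]mul1r; apply: (determinant_multilinear (i0 := j)).
- apply/rowP => k; rewrite !mxE !upd_same happ_lin mul1r.
  by [].
- by apply/matrixP => k l; rewrite !mxE !upd_other // eq_sym neq_lift.
- by apply/matrixP => k l; rewrite !mxE !upd_other // eq_sym neq_lift.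
Qed.

Lemma args5E (V : Type) (a : V) (w : nat -> V) :
  [args a; w 0%N; w 1%N; w 2%N; w 3%N] = vcons a (fun i : 'I_4 => w i).
Proof.
apply/funext => i; case: (unliftP ord0 i) => [j|] ->.
  by rewrite vconsS (tnth_nth a); case: j => -[|[|[|[|//]]]].
by rewrite vcons0 (tnth_nth a).
Qed.

(** The matrix of this change of factors is block triangular. *)
Lemma wedge5_comb q (a : dualb (@TM R 5 M) q) (w : nat -> dualb (@TM R 5 M) q)
    (k : R) (b : nat -> R) (B : nat -> nat -> R) :
  wedge5 (vcons (k *: a) (fun i : 'I_4 => b i *: a + \sum_(j < 4) B i j *: w j)) =
  (k * \det (\matrix_(i < 4, j < 4) B i j)) *: wedge5 (vcons a (fun i : 'I_4 => w i)).
Proof.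
apply: form_eqP => v; rewrite bfappZ !wedge5E -[RHS]/(_ * _).
pose A : 'M[R]_(1 + 4) := block_mx (k%:M : 'M[R]_1) 0
  (\matrix_(i < 4, j < 1) b i) (\matrix_(i < 4, j < 4) B i j).
have detA : \det A = k * \det (\matrix_(i < 4, j < 4) B i j).
  by rewrite (det_lblock (k%:M : 'M[R]_1)) det_scalar expr1.
have l0 : lshift 4 (ord0 : 'I_1) = ord0 :> 'I_5 by apply: val_inj.
have rS (m : 'I_4) : rshift 1 m = lift ord0 m :> 'I_5 by apply: val_inj.
have A00 : A ord0 ord0 = k by rewrite -l0 block_mxEul mxE eqxx mulr1n.
have A0S j : A ord0 (lift ord0 j) = 0 by rewrite -rS -l0 block_mxEur mxE.
have AS0 i : A (lift ord0 i) ord0 = b i by rewrite -rS -l0 block_mxEdl mxE.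
have ASS i j : A (lift ord0 i) (lift ord0 j) = B i j by rewrite -!rS block_mxEdr mxE.
rewrite -detA -det_mulmx; clearbody A; congr (\det _).
apply/matrixP => i j; rewrite mxE [RHS]mxE big_ord_recl [X in _ * X + _]mxE vcons0.
under eq_bigr do rewrite mxE vconsS.
case: (unliftP ord0 i) => [m|] ->.
  rewrite vconsS AS0 happDl happZl happ_suml; congr (_ + _).
  by apply: eq_bigr => l _; rewrite ASS.
rewrite vcons0 A00 happZl big1 ?addr0 // => l _.
by rewrite A0S mul0r.
Qed.

Lemma form3Z kd (V W : lmodType R) (g : ('I_3 -> V) -> W) a b c x y z :
  is_form kd g -> g [args a *: x; b *: y; c *: z] = (a * b * c) *: g [args x; y; z].
Proof.
move=> fg; rewrite -(upd30 0) (is_formZ fg) upd30 -(upd31 _ 0) (is_formZ fg) upd31.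
by rewrite -(upd32 _ _ 0) (is_formZ fg) upd32 !scalerA.
Qed.

Lemma det_nat n (F : nat -> nat -> R) : \det (\matrix_(i < n.+1, j < n.+1) F i j) =
  \sum_(j < n.+1) F 0%N j * ((-1) ^+ j * \det (\matrix_(i < n, k < n) F i.+1 (bump j k))).
Proof.
rewrite (expand_det_row _ ord0); apply: eq_bigr => j _; rewrite mxE /cofactor add0n.
congr (_ * (_ * \det _)); apply/matrixP => i k; rewrite !mxE.
by rewrite /= /bump leq0n add1n.
Qed.

Lemma det2_nat (F : nat -> nat -> R) : \det (\matrix_(i < 2, j < 2) F i j) =
  F 0%N 0%N * F 1%N 1%N - F 0%N 1%N * F 1%N 0%N.
Proof.
rewrite det_nat !big_ord_recl big_ord0 !det_mx11 !mxE /= /bump /=; ring.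
Qed.

Lemma det3_nat (F : nat -> nat -> R) : \det (\matrix_(i < 3, j < 3) F i j) =
  F 0%N 0%N * (F 1%N 1%N * F 2%N 2%N - F 1%N 2%N * F 2%N 1%N)
  - F 0%N 1%N * (F 1%N 0%N * F 2%N 2%N - F 1%N 2%N * F 2%N 0%N)
  + F 0%N 2%N * (F 1%N 0%N * F 2%N 1%N - F 1%N 1%N * F 2%N 0%N).
Proof.
rewrite det_nat !big_ord_recl big_ord0.
rewrite !(det2_nat (fun i k => F i.+1 (bump _ k))) /= /bump /=; ring.
Qed.

Lemma det4_nat (F : nat -> nat -> R) : \det (\matrix_(i < 4, j < 4) F i j) =
  let m3 a b c :=
    F 1%N a * (F 2%N b * F 3%N c - F 2%N c * F 3%N b)
    - F 1%N b * (F 2%N a * F 3%N c - F 2%N c * F 3%N a)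
    + F 1%N c * (F 2%N a * F 3%N b - F 2%N b * F 3%N a) in
  F 0%N 0%N * m3 1%N 2%N 3%N - F 0%N 1%N * m3 0%N 2%N 3%N
  + F 0%N 2%N * m3 0%N 1%N 3%N - F 0%N 3%N * m3 0%N 1%N 2%N.
Proof.
rewrite det_nat !big_ord_recl big_ord0.
rewrite !(det3_nat (fun i k => F i.+1 (bump _ k))) /= /bump /=; ring.
Qed.

End FiveForms.

(** * The linear system for the connection *)

Section LinearSystem.
Context {R : realType}.
Implicit Types (a b c k : nat -> R) (phi q u : nat -> nat -> R).

(** The coefficient (D_(h_i) w_n)(h_j) of the induced connection, where the
    connection forms A, B, C on S take the values a_i, b_i, c_i at h_i. *)
Definition conn_mx a b c (n i j : nat) : R :=
  j%:R * (b i * (n == j.-1)%:R) + (3 - 2 * j%:R) * a i * (n == j)%:R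
  + (3 - j%:R) * c i * (n == j.+1)%:R.

(** The binary quartic that corresponds to the 2-form with entries u, its
    coefficients being divided by the binomial ones. The Levi form corresponds to
    zero. *)
Definition quartic u (m : nat) : R :=
  if m == 0%N then u 0%N 1%N else if m == 1%N then u 0%N 2%N / 2 else
  if m == 2%N then (u 0%N 3%N + 3 * u 1%N 2%N) / 6 else
  if m == 3%N then u 1%N 3%N / 2 else u 2%N 3%N.

(** The array q, as an element of Sym^3 (x) Sym^4, is the polarisation of the septic
    form with coefficients k. The sign and the reversed index come from the
    identification of S with its dual by the scale. *)
Definition sym7_eqs q k : Prop := forall i m, (i < 4)%N -> (m < 5)%N ->
  (-1) ^+ i * q (3 - i)%N m = 'C(3, i)%:R * k (i + m)%N.

Definition conn_quartic a b c n m : R :=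
  quartic (fun i j => conn_mx a b c n i j - conn_mx a b c n j i) m.

(** The solution of the linear system, obtained by elimination. *)
Definition conn_a phi (j : nat) : R :=
  if j == 0%N then - (2 * phi 1%N 0%N + 6 * phi 2%N 1%N + 12 * phi 3%N 2%N) / 7 else
  if j == 1%N then (- 2 * phi 0%N 0%N + 8 * phi 1%N 1%N - 12 * phi 2%N 2%N - 62 * phi 3%N
    3%N) / 105 else
  if j == 2%N then (- 62 * phi 0%N 1%N - 12 * phi 1%N 2%N + 8 * phi 2%N 3%N - 2 * phi 3%N
    4%N) / 105 else
  - (12 * phi 0%N 2%N + 6 * phi 1%N 3%N + 2 * phi 2%N 4%N) / 7.

Definition conn_b phi (j : nat) : R :=
  if j == 0%N then (32 * phi 0%N 0%N + 12 * phi 1%N 1%N - 18 * phi 2%N 2%N - 58 * phi 3%N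
    3%N) / 35 else
  if j == 1%N then (92 * phi 0%N 1%N + 72 * phi 1%N 2%N + 22 * phi 2%N 3%N - 58 * phi 3%N
    4%N) / 105 else
  if j == 2%N then (6 * phi 0%N 2%N + 10 * phi 1%N 3%N + 8 * phi 2%N 4%N) / 21 else
  - (6 * phi 0%N 3%N + 2 * phi 1%N 4%N) / 7.

Definition conn_c phi (j : nat) : R :=
  if j == 0%N then (2 * phi 2%N 0%N + 6 * phi 3%N 1%N) / 7 else
  if j == 1%N then - (8 * phi 1%N 0%N + 10 * phi 2%N 1%N + 6 * phi 3%N 2%N) / 21 else
  if j == 2%N then (58 * phi 0%N 0%N - 22 * phi 1%N 1%N - 72 * phi 2%N 2%N - 92 * phi 3%N
    3%N) / 105 else
  (58 * phi 0%N 1%N + 18 * phi 1%N 2%N - 12 * phi 2%N 3%N - 32 * phi 3%N 4%N) / 35.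

(** The connection terms have no component in Sym^7, so the septic form of the
    torsion is the projection of - phi. *)
Definition sym7_k phi (n : nat) : R :=
  if n == 0%N then - phi 3%N 0%N else
  if n == 1%N then (phi 2%N 0%N - 4 * phi 3%N 1%N) / 7 else
  if n == 2%N then (- phi 1%N 0%N + 4 * phi 2%N 1%N - 6 * phi 3%N 2%N) / 21 else
  if n == 3%N then (phi 0%N 0%N - 4 * phi 1%N 1%N + 6 * phi 2%N 2%N - 4 * phi 3%N 3%N) / 35 else
  if n == 4%N then (4 * phi 0%N 1%N - 6 * phi 1%N 2%N + 4 * phi 2%N 3%N - phi 3%N 4%N) / 35 else
  if n == 5%N then (6 * phi 0%N 2%N - 4 * phi 1%N 3%N + phi 2%N 4%N) / 21 else
  if n == 6%N then (4 * phi 0%N 3%N - phi 1%N 4%N) / 7 else phi 0%N 4%N.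

(** The number of unknowns, twelve, is the codimension 20 - 8 of Sym^7 in Sym^3 (x)
    Sym^4. *)
Lemma sym7_exists phi :
  sym7_eqs (fun n m => conn_quartic (conn_a phi) (conn_b phi) (conn_c phi) n m - phi n m)
    (sym7_k phi).
Proof.
rewrite /sym7_eqs /conn_quartic /quartic /conn_mx /conn_a /conn_b /conn_c /sym7_k.
by case=> [|[|[|[|//]]]] [|[|[|[|[|//]]]]] _ _ /=; rewrite ?binE /=; field.
Qed.

Lemma sym7_unique a b c k phi :
  sym7_eqs (fun n m => conn_quartic a b c n m - phi n m) k ->
  forall j, (j < 4)%N -> [/\ a j = conn_a phi j, b j = conn_b phi j & c j = conn_c phi j].
Proof.
move=> E.
(* The diagonal torus of GL(2) grades the system: the equation (i, m) has weight i +
   m, and involves k_(i + m) and the unknowns of that weight only. *)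
have [a0 c1] : a 0%N = conn_a phi 0%N /\ c 1%N = conn_c phi 1%N.
  move: (E 0%N 2%N isT isT) (E 1%N 1%N isT isT) (E 2%N 0%N isT isT); clear.
  by rewrite /conn_quartic /quartic /conn_mx /conn_a /conn_c /= ?binE /=; split; lra.
have [a1 b0 c2] : [/\ a 1%N = conn_a phi 1%N, b 0%N = conn_b phi 0%N & c 2%N = conn_c phi 2%N].
  move: (E 0%N 3%N isT isT) (E 1%N 2%N isT isT) (E 2%N 1%N isT isT) (E 3%N 0%N isT isT); clear.
  by rewrite /conn_quartic /quartic /conn_mx /conn_a /conn_b /conn_c /= ?binE /=; split; lra.
have [a2 b1 c3] : [/\ a 2%N = conn_a phi 2%N, b 1%N = conn_b phi 1%N & c 3%N = conn_c phi 3%N].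
  move: (E 0%N 4%N isT isT) (E 1%N 3%N isT isT) (E 2%N 2%N isT isT) (E 3%N 1%N isT isT); clear.
  by rewrite /conn_quartic /quartic /conn_mx /conn_a /conn_b /conn_c /= ?binE /=; split; lra.
have [a3 b2] : a 3%N = conn_a phi 3%N /\ b 2%N = conn_b phi 2%N.
  move: (E 1%N 4%N isT isT) (E 2%N 3%N isT isT) (E 3%N 2%N isT isT); clear.
  by rewrite /conn_quartic /quartic /conn_mx /conn_a /conn_b /= ?binE /=; split; lra.
have b3 : b 3%N = conn_b phi 3%N.
  move: (E 2%N 4%N isT isT) (E 3%N 3%N isT isT); clear.
  by rewrite /conn_quartic /quartic /conn_mx /conn_b /= ?binE /=; lra.
have c0 : c 0%N = conn_c phi 0%N.
  move: (E 0%N 1%N isT isT) (E 1%N 0%N isT isT); clear.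
  by rewrite /conn_quartic /quartic /conn_mx /conn_c /= ?binE /=; lra.
by case=> [|[|[|[|//]]]].
Qed.

(** The Levi form corresponds to the zero quartic. *)
Lemma quartic_perp u t phi x m :
  (forall i j, (i < 4)%N -> (j < 4)%N ->
     u i j = t i j - phi i j - x * omega_mx (inord i) (inord j)) ->
  quartic u m = quartic t m - quartic phi m.
Proof.
move=> E; rewrite /quartic !E // /omega_mx !inordK //=.
by do ![case: ifP => _]; field.
Qed.

Lemma conn_quartic_eq a b c a' b' c' n m :
  (forall j, (j < 4)%N -> [/\ a j = a' j, b j = b' j & c j = c' j]) ->
  conn_quartic a b c n m = conn_quartic a' b' c' n m.
Proof.
move=> E; rewrite /conn_quartic /quartic /conn_mx.
have [-> -> ->] := E 0%N isT; have [-> -> ->] := E 1%N isT.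
by have [-> -> ->] := E 2%N isT; have [-> -> ->] := E 3%N isT.
Qed.

End LinearSystem.

Section QuarticForms.
Context {R : realType}.
Implicit Types (k : nat -> R) (u : nat -> nat -> R).

Definition quartic_eval (q : nat -> R) (x0 x1 : R) : R :=
  q 0%N * x0 ^+ 4 + 4 * q 1%N * x0 ^+ 3 * x1 + 6 * q 2%N * x0 ^+ 2 * x1 ^+ 2
  + 4 * q 3%N * x0 * x1 ^+ 3 + q 4%N * x1 ^+ 4.

Lemma quartic_eval_eq (q q' : nat -> R) : (forall x0 x1, quartic_eval q x0 x1 = quartic_eval
  q' x0 x1) ->
  forall m, (m < 5)%N -> q m = q' m.
Proof.
move=> E; move: (E 1 0) (E 0 1) (E 1 1) (E 1 (-1)) (E 1 2); rewrite /quartic_eval.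
by case=> ? ? ? ? ? [|[|[|[|[|//]]]]] _; lra.
Qed.

(** The coordinates of the vector that corresponds to x^2 a. *)
Definition xxa (x0 x1 a0 a1 : R) (j : nat) : R :=
  if j == 0%N then x0 ^+ 2 * a0 else
  if j == 1%N then 2 * x0 * x1 * a0 + x0 ^+ 2 * a1 else
  if j == 2%N then x1 ^+ 2 * a0 + 2 * x0 * x1 * a1 else x1 ^+ 2 * a1.

(** The vectors x^2 a and x^2 a' lie in a plane that only depends on x, whence the
    factor a ^ a'; the other factor is a quartic in x. *)
Lemma xxa_quartic u x0 x1 a0 a1 a0' a1' : (forall i j, u i j = - u j i) ->
  \sum_(i < 4) \sum_(j < 4) xxa x0 x1 a0 a1 i * xxa x0 x1 a0' a1' j * u i j =
  (a0 * a1' - a1 * a0') * quartic_eval (quartic u) x0 x1.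
Proof.
move=> uN; have u0 i : u i i = 0 by have := uN i i; lra.
rewrite !sum4 /= (uN 1%N 0%N) (uN 2%N 0%N) (uN 3%N 0%N) (uN 2%N 1%N) (uN 3%N 1%N) (uN 3%N 2%N).
by rewrite !u0 /quartic_eval /quartic /xxa /=; field.
Qed.

Lemma pol7E k (y0 y1 x0 x1 : R) :
  pol [:: (y0, y1); (y0, y1); (y0, y1); (x0, x1); (x0, x1); (x0, x1); (x0, x1)] (k : nat -> R^o) =
  \sum_(i < 4) 'C(3, i)%:R * (y0 ^+ (3 - i) * y1 ^+ i)
    * quartic_eval (fun m => k (i + m)%N) x0 x1 :> R.
Proof. by rewrite sum4 /quartic_eval /= ?binE /GRing.scale /=; ring. Qed.

(** The coordinates of the 1-form that corresponds to the cube of y _| sigma. *)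
Definition ycube (y0 y1 : R) (n : nat) : R := (- y1) ^+ (3 - n) * y0 ^+ n.

(** Two forms of bidegree (3, 4) in (y, x) agree everywhere only if their
    coefficients do: evaluate at enough points, for y first. *)
Lemma sym7_eqsP (q : nat -> nat -> R) k :
  sym7_eqs q k <->
  forall y0 y1 x0 x1 : R,
    \sum_(n < 4) ycube y0 y1 n * quartic_eval (q n) x0 x1 =
    pol [:: (y0, y1); (y0, y1); (y0, y1); (x0, x1); (x0, x1); (x0, x1); (x0, x1)] (k : nat ->
      R^o).
Proof.
split=> [E y0 y1 x0 x1|E i m i4 m5].
  have Q i : (i < 4)%N -> 'C(3, i)%:R * quartic_eval (fun m => k (i + m)%N) x0 x1 =
      (-1) ^+ i * quartic_eval (q (3 - i)%N) x0 x1.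
    move=> i4; rewrite /quartic_eval.
    move: (E i 0%N i4 isT) (E i 1%N i4 isT) (E i 2%N i4 isT) (E i 3%N i4 isT) (E i 4%N i4 isT).
    set s := (-1) ^+ i; set b := _%:R; set k0 := k _; set k1 := k _; set k2 := k _; set k3 := k _.
    set k4 := k _; move=> e0 e1 e2 e3 e4.
    transitivity (b * k0 * x0 ^+ 4 + 4 * (b * k1) * x0 ^+ 3 * x1 + 6 * (b * k2) * x0 ^+ 2 *
      x1 ^+ 2
      + 4 * (b * k3) * x0 * x1 ^+ 3 + b * k4 * x1 ^+ 4); first by ring.
    by rewrite -e0 -e1 -e2 -e3 -e4; ring.
  rewrite pol7E !sum4 /=; move: (Q 0%N isT) (Q 1%N isT) (Q 2%N isT) (Q 3%N isT).
  rewrite /ycube /=; set A := quartic_eval _ x0 x1; set B := quartic_eval _ x0 x1.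
  set C := quartic_eval _ x0 x1; set D := quartic_eval _ x0 x1.
  set A' := quartic_eval _ x0 x1; set B' := quartic_eval _ x0 x1.
  set C' := quartic_eval _ x0 x1; set D' := quartic_eval _ x0 x1.
  move=> e0 e1 e2 e3.
  transitivity (y0 ^+ 3 * ((-1) ^+ 0 * B) + y0 ^+ 2 * y1 * ((-1) ^+ 1 * D)
     + y0 * y1 ^+ 2 * ((-1) ^+ 2 * B') + y1 ^+ 3 * ((-1) ^+ 3 * D')).
    by ring.
  by rewrite -e0 -e1 -e2 -e3; ring.
have Q x0 x1 : (-1) ^+ i * quartic_eval (q (3 - i)%N) x0 x1 =
    'C(3, i)%:R * quartic_eval (fun m => k (i + m)%N) x0 x1.
  have C y0 y1 : y0 ^+ 3 * quartic_eval (q 3) x0 x1 - y0 ^+ 2 * y1 * quartic_eval (q 2) x0 x1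
      + y0 * y1 ^+ 2 * quartic_eval (q 1%N) x0 x1 - y1 ^+ 3 * quartic_eval (q 0%N) x0 x1 =
      y0 ^+ 3 * quartic_eval (fun m => k (0 + m)%N) x0 x1
      + 3 * y0 ^+ 2 * y1 * quartic_eval (fun m => k (1 + m)%N) x0 x1
      + 3 * y0 * y1 ^+ 2 * quartic_eval (fun m => k (2 + m)%N) x0 x1
      + y1 ^+ 3 * quartic_eval (fun m => k (3 + m)%N) x0 x1.
    have := E y0 y1 x0 x1; rewrite pol7E !sum4 /= /ycube /= ?binE => e.
    by apply: etrans (etrans _ e) _; ring.
  move: (C 1 0) (C 0 1) (C 1 1) (C 1 (-1)); clear E C m5.
  by case: i i4 => [|[|[|[|//]]]] _ /=; rewrite ?binE /=; lra.
apply: (quartic_eval_eq (q := fun m => (-1) ^+ i * q (3 - i)%N m)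
  (q' := fun m => 'C(3, i)%:R * k (i + m)%N)) m5 => x0 x1.
have S (s : R) (g : nat -> R) : quartic_eval (fun m => s * g m) x0 x1 = s * quartic_eval g x0 x1.
  by rewrite /quartic_eval; ring.
by rewrite !S Q.
Qed.

End QuarticForms.

(** * Forms in one or two arguments *)

Section InducedOps.
Context {R : realType} {M : manifold R 5}.
Context {H : forall p : M, lin_subspace (@TM R 5 M p)}.
Variables (kd : form_kind) (E F : prebundle M).
Variables (DE : operator H E) (DF : operator H F).
Arguments DE : clear implicits.
Arguments DF : clear implicits.
Context {r : nat} {U : set M} {e : 'I_r -> section E}.
Hypothesis Fr : is_frame U e.
Variable p : M.
Hypotheses (Up : U p) (cE : pconn_at DE p) (cF : pconn_at DF p).
Hypothesis smF : smooth_module F p.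
Implicit Types (s t : section E) (X : Hb H p).

Lemma form1_opE X (A : section (homb E F)) s : smooth_sec A p -> smooth_sec s p ->
  happ (form_op DE DF p X A) (s p) =
    DF p X (fun q => happ (A q) (s q)) - happ (A p) (DE p X s).
Proof.
move=> sA ss; have h : forall i : 'I_1, smooth_sec ((fun=> s) i) p by [].
have := form_opE Fr Up cE cF smF X sA h.
rewrite big_ord1 /happ.
have at1 q : (fun _ : 'I_1 => s q) = [args s q] by rewrite [LHS]args1E.
rewrite at1 upd1 => ->; congr (DF p X _ - _).
by apply: functional_extensionality_dep => q; rewrite at1.
Qed.

Lemma form2_opE X (A : section (formb kd 2 E F)) s t :
  smooth_sec A p -> smooth_sec s p -> smooth_sec t p ->
  fapp (form_op DE DF p X A) [args s p; t p] =
    DF p X (fun q => fapp (A q) [args s q; t q])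
    - (fapp (A p) [args DE p X s; t p] + fapp (A p) [args s p; DE p X t]).
Proof.
move=> sA ss st; have h : forall i, smooth_sec ([args s; t] i) p.
  by case=> -[|[|//]] hi; rewrite (tnth_nth s).
have := form_opE Fr Up cE cF smF X sA h.
have at2 q : [args s; t]^~ q = [args s q; t q].
  by rewrite [LHS]args2E !(tnth_nth s).
rewrite at2 sum2 upd20 upd21 !(tnth_nth s) /= => ->; congr (DF p X _ - _).
by apply: functional_extensionality_dep => q; rewrite at2.
Qed.

End InducedOps.

Section SmoothForm.
Context {R : realType} {n : nat} {M : manifold R n}.
Context {r : nat} {U : set M} {e : 'I_r -> section (@TM R n M)}.
Hypothesis Fr : is_frame U e.

Lemma smooth_dform (w : section (dualb (@TM R n M))) (X Y : section (@TM R n M)) p :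
  U p -> smooth_sec w p -> smooth_sec X p -> smooth_sec Y p ->
  smooth_fun (fun q => dform w q X Y) p.
Proof.
move=> Up sw sX sY.
have s1 Z : smooth_sec Z p -> smooth_fun (fun q => happ (w q) (Z q) : R) p.
  by move=> sZ; apply: (smooth_happ (F := trivb)).
apply: smooth_sub; last exact: (s1 _ (smooth_bracket Fr Up sX sY)).
by apply: smooth_sub; apply: smooth_tapp => //; apply: s1.
Qed.

End SmoothForm.

(** * Geometry in an adapted frame *)

Section Adapted.
Context {R : realType} {M : manifold R 5}.
Context {H : forall p : M, lin_subspace (@TM R 5 M p)} {G : g2_contact H}.
Notation S := (spin G).
Notation D := (dens G).
Notation phi := (spin_iso G).
Hypothesis nondeg : forall p (a : Lb H p), a != 0 -> nondegenerate (levi a).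
Context {U : set M} {e : 'I_5 -> section (@TM R 5 M)}.
Hypothesis Fr : is_frame U e.
Hypothesis HU : forall q, U q -> forall v : @TM R 5 M q,
  H q v <-> exists c : 'I_4 -> R,
    v = \sum_i c i *: e (widen_ord (leqnSn 4) i) q.
Context {f : 'I_2 -> section S}.
Hypothesis Fs : is_frame U f.
Context {de : 'I_1 -> section D}.
Hypothesis Fd : is_frame U de.
Implicit Types (p q : M).

Notation al := (coframe f).

(** ** The spin bundle *)

Lemma alE i j q : U q -> happ (al i q) (f j q) = (j == i)%:R.
Proof. by move=> Uq; rewrite (coframeE Fs) // (coord_frame Fs). Qed.

Lemma dual2E q (x : dualb S q) : U q ->
  x = (happ x (f 0 q) : R) *: al 0 q + (happ x (f 1 q) : R) *: al 1 q.
Proof. by move=> Uq; rewrite {1}(dual_coordE Fs x Uq) sum2. Qed.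

Lemma spin2E q (s : S q) : U q ->
  s = (happ (al 0 q) s : R) *: f 0 q + (happ (al 1 q) s : R) *: f 1 q.
Proof. by move=> Uq; rewrite -{1}(coordK Fs s Uq) sum2 !(coframeE Fs). Qed.

(** ** Exterior square *)

Lemma wedge2E q (s t : S q) x y : fapp (wedge2 s t) [args x; y] =
  (happ x s : R) * happ y t - (happ x t : R) * happ y s :> R.
Proof.
rewrite mk_formE //; apply: is_form2_alt => [|z]; last first.
  by rewrite -[LHS]/((happ z s : R) * happ z t - (happ z t : R) * happ z s) mulrC subrr.
apply: (is_form2 (g := fun x y : dualb S q => (happ x s : R) * happ y t
    - (happ x t : R) * happ y s : R^o)) => a x' y' z;
  rewrite !happDl !happZl.
- have E (b c d k i j : R) : (a * b + c) * d - (a * k + i) * j =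
    a * (b * d - k * j) + (c * d - i * j) by ring.
  exact: E.
- have E (b c d k i j : R) : d * (a * b + c) - j * (a * k + i) =
    a * (d * b - j * k) + (d * c - j * i) by ring.
  exact: E.
Qed.

Lemma ext2E q (l : extb 2 S q) x y : U q -> fapp l [args x; y] =
  ((happ x (f 0 q) : R) * happ y (f 1 q) - (happ x (f 1 q) : R) * happ y (f 0 q))
  * (fapp l [args al 0 q; al 1 q] : R) :> R.
Proof.
move=> Uq; rewrite {1}(dual2E x Uq) {1}(dual2E y Uq).
exact: (alt2_span2 (fapp_form l)).
Qed.

Lemma ext2_eqP q (l l' : extb 2 S q) : U q ->
  fapp l [args al 0 q; al 1 q] = fapp l' [args al 0 q; al 1 q] -> l = l'.
Proof.
move=> Uq ll; apply: form_eqP => v.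
by rewrite (args2E v) [LHS]ext2E // ll -ext2E.
Qed.

Lemma wedge2_frame q : U q -> fapp (wedge2 (f 0 q) (f 1 q)) [args al 0 q; al 1 q] = 1 :> R.
Proof. by move=> Uq; rewrite wedge2E !alE //= mulr1 mulr0 subr0. Qed.

Lemma ext2_line q (l s : extb 2 S q) : U q ->
  fapp s [args al 0 q; al 1 q] = 1 :> R ->
  l = (fapp l [args al 0 q; al 1 q] : R) *: s.
Proof.
move=> Uq s1; apply: (ext2_eqP Uq); rewrite bfappZ.
by rewrite s1 -[RHS]/((_ : R) * 1) mulr1.
Qed.

Lemma smooth_al i p : U p -> smooth_sec (al i) p.
Proof. exact: (smooth_coframe Fs). Qed.

Lemma smooth_f i p : U p -> smooth_sec (f i) p.
Proof. exact: (smooth_frame Fs). Qed.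

(** This makes the scale available as a frame for the operators induced on forms over
    the exterior square. *)
Lemma ext2_frame (s : section (extb 2 S)) :
  (forall q, U q -> smooth_sec s q) ->
  (forall q, U q -> fapp (s q) [args al 0 q; al 1 q] = 1 :> R) ->
  is_frame U (fun _ : 'I_1 => s).
Proof.
move=> ss s1; have [oU _ _] := Fs; split=> // [q Uq l|l q Uq].
  exists (fun=> fapp l [args al 0 q; al 1 q]); split.
    by rewrite big_ord1; apply: ext2_line => //; apply: s1.
  move=> c ->; apply/funext => i; rewrite big_ord1 bfappZ s1 //.
  by rewrite -[LHS]/(c ord0 * 1) mulr1 (ord1 i).
have smX : smooth_module (extb 2 S) q by apply: form_module; apply: triv_module.
split=> [sl|[c sc lE]].
  exists (fun _ x => fapp (l x) [args al 0 x; al 1 x]).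
    by move=> _; apply: (smooth_fapp2 sl); apply: smooth_al.
  apply: filterS (frame_nbhs Fs Uq) => x Ux; rewrite big_ord1.
  by apply: ext2_line => //; apply: s1.
apply: (sm_eq smX (s := fun x => c ord0 x *: s x)).
  by apply: filterS lE => x ->; rewrite big_ord1.
by apply: (sm_scale smX) => //; apply: ss.
Qed.

(** ** Symmetric powers *)

Definition dword q k j : 'I_k -> dualb S q := word (al 0 q) (al 1 q) j.

Lemma symE q k (K : symb k S q) (z : 'I_k -> dualb S q) : U q ->
  fapp K z = pol [seq (happ (z i) (f 0 q) : R, happ (z i) (f 1 q) : R)
    | i <- enum 'I_k] (fun j => fapp K (dword q j)).
Proof.
move=> Uq; rewrite -(sym_form_pol _ _ _ _ (fapp_form K)); congr fapp.
by apply/funext => i; rewrite -dual2E.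
Qed.

Lemma sym_args q k (K : symb k S q) (t : k.-tuple (dualb S q)) : U q ->
  fapp K (tnth t) = pol [seq (happ z (f 0 q) : R, happ z (f 1 q) : R) | z : dualb S q <- t]
    (fun j => fapp K (dword q j)).
Proof.
by move=> Uq; rewrite symE // (pol_args t (fun z : dualb S q => (happ z (f 0 q) : R, happ z
  (f 1 q) : R))).
Qed.

Lemma sym_eqP q k (K L : symb k S q) : U q ->
  (forall j, (j <= k)%N -> fapp K (dword q j) = fapp L (dword q j)) -> K = L.
Proof.
move=> Uq KL; apply: form_eqP => z; rewrite !symE //; apply: eq_pol => j.
by rewrite size_map size_enum_ord; apply: KL.
Qed.

Definition symk q k (c : nat -> R) : symb k S q :=
  mk_form Defs.Sym (polform (fun x : dualb S q => happ x (f 0 q) : R)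
    (fun x => happ x (f 1 q) : R) (c : nat -> R^o)).

Lemma symkE q k c (z : 'I_k -> dualb S q) :
  fapp (symk q k c) z = pol [seq (happ (z i) (f 0 q) : R, happ (z i) (f 1 q) : R)
    | i <- enum 'I_k] (c : nat -> R^o).
Proof.
rewrite mk_formE //; apply: polform_sym => a x y; by rewrite happDl happZl.
Qed.

Lemma symk_word q k c j : U q -> (j <= k)%N -> fapp (symk q k c) (dword q j) = c j.
Proof.
move=> Uq; rewrite symkE.
have E (i : 'I_k) : (happ (dword q j i) (f 0 q) : R, happ (dword q j i) (f 1 q) : R) =
    if (i < j)%N then (0, 1) else (1, 0) :> R * R.
  by rewrite /dword /word; case: ifP => _; rewrite !alE.
under eq_map do rewrite E.
move=> jk; have -> : [seq (if (i < j)%N then (0, 1) else (1, 0)) : R * R | i : 'I_k <- enum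
  'I_k] =
    [seq (if (i < j)%N then (0, 1) else (1, 0)) : R * R | i <- iota 0 k].
  by rewrite -val_enum_ord -map_comp.
have iotaE r m : (m + r = k)%N ->
    [seq (if (i < j)%N then (0, 1) else (1, 0)) : R * R | i <- iota m r] =
    nseq (j - m) (0, 1) ++ nseq (k - maxn m j) (1, 0).
  elim: r m => [|r IH] m mk /=.
    rewrite addn0 in mk; subst m; rewrite (maxn_idPl jk) subnn.
    by rewrite (_ : j - k = 0)%N //; apply/eqP; rewrite subn_eq0.
  have m_k : (m < k)%N by rewrite -mk -[X in (X < _)%N]addn0 ltn_add2l.
  rewrite IH ?addSnnS //; case: ltnP => mj.
    rewrite -[(j - m)%N]prednK ?subn_gt0 //= -subnS.
    by rewrite (maxn_idPr mj).
  rewrite (_ : j - m.+1 = 0)%N; last by apply/eqP; rewrite subn_eq0 ltnW.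
  rewrite (_ : j - m = 0)%N; last by apply/eqP; rewrite subn_eq0.
  rewrite (maxn_idPl (leqW mj)) /=.
  by rewrite -[(k - m)%N]prednK ?subn_gt0 //= -subnS.
have := iotaE k 0%N (add0n k); rewrite subn0 max0n => ->.
have tailE m (c' : nat -> R^o) : pol (nseq m (1, 0)) c' = c' 0%N.
  by elim: m c' => //= m IH c'; rewrite IH scale1r scale0r addr0.
elim: (j) (k - j)%N (c : nat -> R^o) => [|m IH] r c' /=; first exact: tailE.
by rewrite scale0r add0r scale1r IH.
Qed.

Lemma smooth_symk k c p : U p -> smooth_sec (fun q => symk q k c) p.
Proof.
move=> Up z sz.
have sv i j : smooth_fun (fun q => happ (z i q) (f j q)) p.
  by apply: (smooth_happ (sz i)); apply: smooth_f.
apply: smooth_eq (smooth_pol c (fun i => sv i 0) (fun i => sv i 1)).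
by apply: nearW => q; rewrite symkE.
Qed.

(** ** Symmetric products *)

Lemma sym_prodE q k (v : 'I_k -> S q) (x : 'I_k -> dualb S q) :
  fapp (sym_prod v) x =
    (k`!%:R)^-1 * \sum_(g : 'S_k) \prod_i (happ (x i) (v (g i)) : R) :> R.
Proof.
rewrite mk_formE //; split=> [z i a s t|g z].
  have E y : \sum_(g : 'S_k) \prod_j (happ (upd z i y j) (v (g j)) : R) =
     \sum_(g : 'S_k) (happ y (v (g i)) : R) *
       \prod_(j | j != i) (happ (z j) (v (g j)) : R).
    apply: eq_bigr => g _; rewrite (bigD1 i) //= upd_same; congr (_ * _).
    by apply: eq_bigr => j ji; rewrite upd_other.
  rewrite !E -[RHS]/(a * (_ * _) + _ * _) mulrCA -mulrDr; congr (_ * _).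
  rewrite mulr_sumr -big_split /=; apply: eq_bigr => g _.
  by rewrite happDl happZl -[_ + _ in LHS]/(a * (_ : R) + (_ : R)) mulrDl mulrA.
congr (_ * _); rewrite (reindex_inj (mulgI g)) /=; apply: eq_bigr => g' _.
rewrite [RHS](reindex_inj (@perm_inj _ g)) /=; apply: eq_bigr => i _.
by rewrite permM.
Qed.

Lemma sym_prod_form q k : is_form Defs.Sym (@sym_prod R M H G k q).
Proof.
split=> [v i a s t|g v]; apply: form_eqP => x.
  rewrite bfappD bfappZ !sym_prodE -[RHS]/(a * (_ * _) + _ * _) mulrCA -mulrDr.
  congr (_ * _); rewrite mulr_sumr -big_split /=; apply: eq_bigr => g _.
  pose j := (g^-1)%g i.
  have E y : \prod_m (happ (x m) (upd v i y (g m)) : R) =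
    (happ (x j) y : R) * \prod_(m | m != j) (happ (x m) (v (g m)) : R).
    rewrite (bigD1 j) //= /j permKV upd_same; congr (_ * _).
    apply: eq_bigr => m mj; rewrite upd_other //; apply: contra mj => /eqP <-.
    by rewrite permK.
  by rewrite !E happ_lin -[_ + _ in LHS]/(a * (_ : R) + (_ : R)) mulrDl mulrA.
rewrite !sym_prodE; congr (_ * _).
rewrite [RHS](reindex_inj (mulIg g)) /=; apply: eq_bigr => g' _.
by apply: eq_bigr => i _; rewrite permM.
Qed.

(** Reciprocals of binomial coefficients: the values on words of the products of
    elements of the frame. *)
Definition cub (j : nat) : R := if (j == 1%N) || (j == 2%N) then 3^-1 else 1.

Lemma card_fix (i : 'I_3) : \sum_(g : 'S_3) ((g i == i)%:R : R) = 2.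
Proof.
rewrite -natr_sum (eq_bigr (fun g : 'S_3 => if g i == i then 1 else 0)%N); last first.
  by move=> g _; case: eqP.
rewrite -big_mkcond sum1dep_card.
rewrite (_ : [set g : 'S_3 | g i == i]%SET = [set g | perm_on (~: [set i])%SET g]%SET).
  by rewrite cardsE card_perm cardsC1 card_ord.
apply/setP => g; rewrite !inE /perm_on; apply/eqP/fintype.subsetP => [gi j|/(_ i)].
  by rewrite !inE; apply: contra => /eqP ->; rewrite gi.
by rewrite !inE eqxx => h; apply/eqP; apply: contraT => /h.
Qed.

(** The product of the pairings vanishes unless the permutation matches the two
    words, which leaves j! (3 - j)! of the 3! permutations. *)
Lemma sym_prod_word q j : U q -> (j <= 3)%N ->
  sym_prod (word (f 0 q) (f 1 q) (k := 3) j) =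
  symk q 3 (fun i => if i == j then cub j else 0).
Proof.
move=> Uq j3; apply: (sym_eqP Uq) => i i3; rewrite symk_word // sym_prodE.
have E (g : 'S_3) m : happ (dword q i m) (word (f 0 q) (f 1 q) (k := 3) j (g m)) =
    (((m < i)%N == (g m < j)%N))%:R :> R.
  by rewrite /dword /word; case: ifP => mi; case: ifP => gj; rewrite alE.
under eq_bigr do under eq_bigr do rewrite E.
rewrite (eq_bigr (fun g : 'S_3 => if i == j then
    (if j == 1%N then (g 0 == 0)%:R else if j == 2%N then (g 2 == 2)%:R else 1)
    else 0 : R)) => [|g _].
  case: eqP => [_|_]; last by rewrite big1 ?mulr0.
  rewrite (_ : 3`! = 6)%N // /cub; case: eqP => /= [_|_].
    by rewrite card_fix /=; field.
  case: eqP => /= _; first by rewrite card_fix /=; field.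
  by rewrite sumr_const card_Sn (_ : 3`! = 6)%N //; field.
have g3 : (val (g 0), val (g 1), val (g 2)) \in
    [:: (0, 1, 2); (0, 2, 1); (1, 0, 2); (1, 2, 0); (2, 0, 1); (2, 1, 0)]%N.
  have d01 : g 0 != g 1 by rewrite (inj_eq perm_inj).
  have d02 : g 0 != g 2 by rewrite (inj_eq perm_inj).
  have d12 : g 1 != g 2 by rewrite (inj_eq perm_inj).
  move: (g 0) (g 1) (g 2) d01 d02 d12 => [a ha] [b hb] [d hd].
  by case: a ha => [|[|[|//]]] ha; case: b hb => [|[|[|//]]] hb;
    case: d hd => [|[|[|//]]] hd.
have E3 (F : 'I_3 -> R) : \prod_m F m = F 0 * F 1 * F 2.
  rewrite !big_ord_recl big_ord0 mulr1 mulrA.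
  by congr (_ * F _ * F _); apply: val_inj.
rewrite E3 -[g 0 == 0]/(val (g 0) == 0%N) -[g 2 == 2]/(val (g 2) == 2%N).
rewrite -[nat_of_ord (g 0)]/(val (g 0)) -[nat_of_ord (g 1)]/(val (g 1)).
rewrite -[nat_of_ord (g 2)]/(val (g 2)).
move: (val (g 0)) (val (g 1)) (val (g 2)) g3 => a b d; rewrite !inE.
case: j j3 {E} => [|[|[|[|//]]]] _; case: i i3 => [|[|[|[|//]]]] _;
  by do ![case/orP]; move=> /eqP [-> -> ->] /=; rewrite !(mulr0, mul0r, mulr1).
Qed.
Definition dco q (x : dualb S q) (i : 'I_2) : R := happ x (f i q).

Lemma dco_al i j q : U q -> dco (al i q) j = (j == i)%:R.
Proof. exact: alE. Qed.

Lemma sym3E q (K : symb 3 S q) x y z : U q -> let k j : R := fapp K (dword q j) in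
  fapp K [args x; y; z] =
    dco x 0 * dco y 0 * dco z 0 * k 0%N
    + (dco x 1 * dco y 0 * dco z 0 + dco x 0 * dco y 1 * dco z 0
       + dco x 0 * dco y 0 * dco z 1) * k 1%N
    + (dco x 1 * dco y 1 * dco z 0 + dco x 1 * dco y 0 * dco z 1
       + dco x 0 * dco y 1 * dco z 1) * k 2%N
    + dco x 1 * dco y 1 * dco z 1 * k 3%N :> R.
Proof.
move=> Uq k; rewrite sym_args //.
have E (c : nat -> R^o) (x0 x1 y0 y1 z0 z1 : R) :
    pol [:: (x0, x1); (y0, y1); (z0, z1)] c =
    x0 * y0 * z0 * c 0%N + (x1 * y0 * z0 + x0 * y1 * z0 + x0 * y0 * z1) * c 1%N
    + (x1 * y1 * z0 + x1 * y0 * z1 + x0 * y1 * z1) * c 2%N + x1 * y1 * z1 * c 3%N :> R.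
  by rewrite /= /GRing.scale /=; ring.
exact: (E k).
Qed.

(** An endomorphism of the dual of S acts on cubic monomials as a derivation: each of
    the j factors al_1 and of the 3 - j factors al_0 is replaced in turn. *)
Lemma sym3_derivation q (K : symb 3 S q) (u v : dualb S q) j : U q -> (j < 4)%N ->
  let k j : R := fapp K (dword q j) in
  \sum_i fapp K (upd (dword q j) i (if (i < j)%N then v else u)) =
    j%:R * (dco v 0 * k j.-1 + dco v 1 * k j)
    + (3 - j%:R) * (dco u 0 * k j + dco u 1 * k j.+1) :> R.
Proof.
move=> Uq j4 k.
have c00 : dco (al 0 q) 0 = 1 by rewrite dco_al.
have c01 : dco (al 0 q) 1 = 0 by rewrite dco_al.
have c10 : dco (al 1 q) 0 = 0 by rewrite dco_al.
have c11 : dco (al 1 q) 1 = 1 by rewrite dco_al.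
have sum3 (F : 'I_3 -> R) : \sum_i F i = F 0 + F 1 + F 2.
  rewrite !big_ord_recl big_ord0 addr0 addrA; congr (_ + F _ + F _); exact: val_inj.
rewrite sum3 (args3E (dword q j)) upd30 upd31 upd32 !sym3E //.
rewrite -/(k 0%N) -/(k 1%N) -/(k 2%N) -/(k 3%N).
have dwordE i : dword q j i = if (i < j)%N then al 1 q else al 0 q by [].
have two : (2 : 'I_3) = 2%N :> nat by [].
rewrite !dwordE two /=; clearbody k; clear dwordE.
by case: j j4 => [|[|[|[|//]]]] _ /=; rewrite ?c00 ?c01 ?c10 ?c11; ring.
Qed.

Let FH : is_frame U (hframe (H := H) e) := hframe_frame Fr HU.

(** The binary cubic that corresponds to w (x) d^2. *)
Definition kap q (d : D q) (w : L1H H q) : symb 3 S q := iso_of phi (twist w d d).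

Lemma kap_lin q (d : D q) a (w w' : L1H H q) :
  kap d (a *: w + w') = a *: kap d w + kap d w'.
Proof. by rewrite /kap twist_lin iso_of_linear. Qed.

Lemma kap0 q (d : D q) : kap d 0 = 0.
Proof. by have := kap_lin d (-1) 0 0; rewrite scaler0 addr0 scaleN1r addNr. Qed.

Lemma kapZ q (d : D q) a (w : L1H H q) : kap d (a *: w) = a *: kap d w.
Proof. by have := kap_lin d a w 0; rewrite kap0 !addr0. Qed.

Lemma kap_inj q (d : D q) (w w' : L1H H q) : U q -> d != 0 -> kap d w = kap d w' -> w = w'.
Proof. by move=> Uq d0 /(can_inj (@iso_ofK _ _ _ _ _ phi q)); apply: (twist_inj Fd). Qed.

Definition kco q (d : D q) (w : L1H H q) (j : nat) : R :=
  fapp (kap d w) (dword q j).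

Lemma kco_lin q (d : D q) a (w w' : L1H H q) j :
  kco d (a *: w + w') j = a * kco d w j + kco d w' j.
Proof. by rewrite /kco /kap twist_lin iso_of_linear bfappD bfappZ. Qed.

Lemma kco_sum q (d : D q) I (r : seq I) (c : I -> R) (w : I -> L1H H q) j :
  kco d (\sum_(i <- r) c i *: w i) j = \sum_(i <- r) c i * kco d (w i) j.
Proof.
elim: r => [|i r IH]; last by rewrite !big_cons kco_lin IH.
rewrite !big_nil; have := kco_lin d (-1) 0 0 j.
by rewrite scaler0 addr0 mulN1r addNr.
Qed.

Lemma kco_inj q (d : D q) (w w' : L1H H q) : U q -> d != 0 ->
  (forall j : 'I_4, kco d w j = kco d w' j) -> w = w'.
Proof.
move=> Uq d0 ww; apply: (twist_inj Fd Uq d0).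
apply: (can_inj (@iso_ofK _ _ _ _ _ phi q)); apply: (sym_eqP Uq) => j j3.
exact: (ww (Ordinal (j3 : (j < 4)%N))).
Qed.

(** The 1-form whose cubic takes the value 1 on the j-th word, and 0 on the others. *)
Definition wb q (d : D q) (j : 'I_4) : L1H H q :=
  untwist de d (iso_to phi (symk q 3 (fun i => (i == j :> nat)%:R))).

Lemma kap_wb q (d : D q) j : U q -> d != 0 ->
  kap d (wb d j) = symk q 3 (fun i => (i == j :> nat)%:R).
Proof. by move=> Uq d0; rewrite /kap /wb (untwistK Fd) // iso_toK. Qed.

Lemma kco_wb q (d : D q) (i j : 'I_4) : U q -> d != 0 ->
  kco d (wb d i) j = (i == j)%:R.
Proof.
move=> Uq d0; rewrite /kco kap_wb // symk_word //; last by rewrite -ltnS.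
by rewrite eq_sym.
Qed.

Lemma wb_sum q (d : D q) (w : L1H H q) : U q -> d != 0 ->
  w = \sum_(j : 'I_4) kco d w j *: wb d j.
Proof.
move=> Uq d0; apply: (kco_inj Uq d0) => j.
rewrite kco_sum (bigD1 j) //= kco_wb // eqxx mulr1 big1 ?addr0 // => i ij.
by rewrite kco_wb // (negPf ij) mulr0.
Qed.

(** The vector on which each 1-form takes the j-th coefficient of its cubic. *)
Definition hb q (d : D q) (j : 'I_4) : Hb H q :=
  \sum_i kco d (coframe (hframe e) i q) j *: hframe e i q.

Lemma happ_hb q (d : D q) (w : L1H H q) j : U q -> happ w (hb d j) = kco d w j.
Proof.
move=> Uq; rewrite [in RHS](dual_coordE FH w Uq) kco_sum happ_sum.
by apply: eq_bigr => i _; rewrite happZ -[LHS]/(_ * _) mulrC.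
Qed.

Lemma hb_span q (d : D q) (v : Hb H q) : U q -> d != 0 ->
  v = \sum_i (happ (wb d i) v : R) *: hb d i.
Proof.
move=> Uq d0; rewrite [LHS](_ : v = \sum_i coord (hframe e) v i *: hframe e i q).
  suff E i : coord (hframe e) v i =
      coord (hframe e) (\sum_i (happ (wb d i) v : R) *: hb d i) i.
    rewrite -[RHS](coordK FH _ Uq); apply: eq_bigr => i _.
    by rewrite E.
  rewrite -!(coframeE FH) // happ_sum.
  rewrite {1}(wb_sum (coframe (hframe e) i q) Uq d0) happ_suml.
  apply: eq_bigr => j _; rewrite happZl happZ happ_hb //.
  by rewrite -[LHS]/(_ * _) mulrC.
by rewrite (coordK FH).
Qed.

(** The ratio of the Levi form of a to [omega_mx]. *)
Definition lam q (d : D q) (a : Lb H q) : R :=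
  fapp (levi a) [args hb d (o4 (k := 0) isT); hb d (o4 (k := 3) isT)].

(** The vector of H that corresponds to the cube of x0 al_0 + x1 al_1. *)
Definition cube_vec q (d : D q) (x0 x1 : R) : Hb H q :=
  x0 ^+ 3 *: hb d (o4 (k := 0) isT) + (3 * x0 ^+ 2 * x1) *: hb d (o4 (k := 1) isT)
  + (3 * x0 * x1 ^+ 2) *: hb d (o4 (k := 2) isT) + x1 ^+ 3 *: hb d (o4 (k := 3) isT).

Lemma cube_vecE q (d : D q) (w : L1H H q) x0 x1 : U q ->
  let x := x0 *: coframe f 0 q + x1 *: coframe f 1 q in
  happ w (cube_vec d x0 x1) = fapp (kap d w) [args x; x; x].
Proof.
move=> Uq x; rewrite sym_args //= /x !happDl !happZl !alE //=.
rewrite /cube_vec !happD !happZ !happ_hb // /kco.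
set k0 := fapp _ _; set k1 := fapp _ _; set k2 := fapp _ _; set k3 := fapp _ _.
have E (a b c z : R) : x0 ^+ 3 * a + 3 * x0 ^+ 2 * x1 * b + 3 * x0 * x1 ^+ 2 * c + x1 ^+ 3 * z =
  (x0 * 1 + x1 * 0) * ((x0 * 1 + x1 * 0) * ((x0 * 1 + x1 * 0) * a + (x0 * 0 + x1 * 1) * b)
    + (x0 * 0 + x1 * 1) * ((x0 * 1 + x1 * 0) * b + (x0 * 0 + x1 * 1) * c))
  + (x0 * 0 + x1 * 1) * ((x0 * 1 + x1 * 0) * ((x0 * 1 + x1 * 0) * b + (x0 * 0 + x1 * 1) * c)
    + (x0 * 0 + x1 * 1) * ((x0 * 1 + x1 * 0) * c + (x0 * 0 + x1 * 1) * z)) by ring.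
exact: E.
Qed.

Lemma levi_cubes q (d : D q) (a : Lb H q) : U q ->
  exists c : R, forall x0 x1 y0 y1,
    fapp (levi a) [args cube_vec d x0 x1; cube_vec d y0 y1] =
      c * (x0 * y1 - x1 * y0) ^+ 3 :> R.
Proof.
move=> Uq; have [c [l cl]] := @spin_levi R M H G q a d.
exists (c * (fapp l [args coframe f 0 q; coframe f 1 q] : R) ^+ 3) => x0 x1 y0 y1.
rewrite (cl (x0 *: coframe f 0 q + x1 *: coframe f 1 q)
            (y0 *: coframe f 0 q + y1 *: coframe f 1 q)); last first.
- by move=> w; apply: cube_vecE.
- by move=> w; apply: cube_vecE.
rewrite (alt2_span2 (fapp_form l)) -[_ *: _]/(_ * _) exprMn.
by rewrite [_ ^+ 3 * _]mulrC mulrA.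
Qed.

(** By compatibility, the Levi form takes the value (x0 y1 - x1 y0)^3 on a pair of
    cubes; as cubes span, it is a multiple of [omega_mx]. *)
Lemma lam_levi q (d : D q) (a : Lb H q) i j : U q ->
  fapp (levi a) [args hb d i; hb d j] = lam d a * omega_mx i j :> R.
Proof.
move=> Uq; have [c cE] := levi_cubes d a Uq.
have fl := fapp_form (levi a).
pose L i j : R := fapp (levi a) [args hb d i; hb d j].
have anti m k : L m k = - L k m by apply: (alt2_anti fl).
have diag m : L m m = 0 by apply: (alt2_diag fl).
pose i0 : 'I_4 := o4 (k := 0) isT; pose i1 : 'I_4 := o4 (k := 1) isT.
pose i2 : 'I_4 := o4 (k := 2) isT; pose i3 : 'I_4 := o4 (k := 3) isT.
have cubeE (x0 x1 y0 y1 : R) :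
    (x0 ^+ 3 * (3 * y0 ^+ 2 * y1) - (3 * x0 ^+ 2 * x1) * y0 ^+ 3) * L i0 i1
    + (x0 ^+ 3 * (3 * y0 * y1 ^+ 2) - (3 * x0 * x1 ^+ 2) * y0 ^+ 3) * L i0 i2
    + (x0 ^+ 3 * y1 ^+ 3 - x1 ^+ 3 * y0 ^+ 3) * L i0 i3
    + ((3 * x0 ^+ 2 * x1) * (3 * y0 * y1 ^+ 2)
       - (3 * x0 * x1 ^+ 2) * (3 * y0 ^+ 2 * y1)) * L i1 i2
    + ((3 * x0 ^+ 2 * x1) * y1 ^+ 3 - x1 ^+ 3 * (3 * y0 ^+ 2 * y1)) * L i1 i3
    + ((3 * x0 * x1 ^+ 2) * y1 ^+ 3 - x1 ^+ 3 * (3 * y0 * y1 ^+ 2)) * L i2 i3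
    = c * (x0 * y1 - x1 * y0) ^+ 3.
  rewrite -cE.
  pose x (k : 'I_4) := match nat_of_ord k with 0 => x0 ^+ 3 | 1 => 3 * x0 ^+ 2 * x1
    | 2 => 3 * x0 * x1 ^+ 2 | _ => x1 ^+ 3 end.
  pose y (k : 'I_4) := match nat_of_ord k with 0 => y0 ^+ 3 | 1 => 3 * y0 ^+ 2 * y1
    | 2 => 3 * y0 * y1 ^+ 2 | _ => y1 ^+ 3 end.
  have -> : cube_vec d x0 x1 = \sum_i x i *: hb d i by rewrite sum4.
  have -> : cube_vec d y0 y1 = \sum_i y i *: hb d i by rewrite sum4.
  rewrite form2_exp !sum4 -!/(L _ _) -/i0 -/i1 -/i2 -/i3 !diag.
  rewrite (anti i1 i0) (anti i2 i0) (anti i3 i0) (anti i2 i1) (anti i3 i1) (anti i3 i2).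
  rewrite /x /y /=; ring.
have [v01 v02 v13 v23 v12] := skew_cubes cubeE; clear cubeE.
rewrite -[LHS]/(L i j) -[lam d a]/(L i0 i3).
move: i j; apply: ord4; apply: ord4; rewrite /omega_mx /=
  -/i0 -/i1 -/i2 -/i3 ?diag ?v01 ?v02 ?v13 ?v23 ?v12
  1?(anti i1 i0) 1?(anti i2 i0) 1?(anti i2 i1) 1?(anti i3 i1) 1?(anti i3 i2);
  rewrite ?v01 ?v02 ?v13 ?v23 ?v12; try ring.
by rewrite (anti i3 i0); ring.
Qed.

Lemma hb_neq0 q (d : D q) j : U q -> d != 0 -> hb d j != 0.
Proof.
move=> Uq d0; apply/eqP => h0.
have := happ_hb d (wb d j) j Uq; rewrite h0 happ0 kco_wb // eqxx.
by move/eqP; rewrite eq_sym oner_eq0.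
Qed.

Lemma adapted_basis q (d : D q) : U q -> d != 0 -> levi_basis (hb d) (wb d) (lam d).
Proof.
move=> Uq d0; split.
- by move=> i j; rewrite happ_hb // kco_wb.
- by move=> v; apply: hb_span.
- by move=> a i j; apply: lam_levi.
- by move=> c a b; apply: (levi_lin Fr HU).
- move=> a a0; apply/eqP => l0.
  have := hb_neq0 (o4 (k := 0) isT) Uq d0; case/eqP.
  apply: (nondeg a0) => Y; rewrite (hb_span Y Uq d0) (form2_sumr (fapp_form (levi a))).
  rewrite big1 // => i _.
  by rewrite (form2Zr (fapp_form (levi a))) lam_levi // l0 mul0r scaler0.
- exists (ann_sec e 1 q); apply/eqP => a0; apply: (annih_neq0 Fr Uq).
  by rewrite -[annih e q]scale1r -(ann_secE Fr HU) // a0.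
Qed.

Lemma smooth_wb (d : section D) j p : U p -> smooth_sec d p -> d p != 0 ->
  smooth_sec (fun q => wb (d q) j) p.
Proof.
move=> Up sd d0; apply: (smooth_untwist Fd) => //.
by apply/(iso_smooth phi); apply: smooth_symk.
Qed.

Lemma smooth_kap (d : section D) (w : section (L1H H)) p :
  smooth_sec d p -> smooth_sec w p -> smooth_sec (fun q => kap (d q) (w q)) p.
Proof. by move=> sd sw; apply: iso_of_smooth; apply: smooth_twist. Qed.

Lemma smooth_dword k j p i : U p -> smooth_sec (fun q => dword (k := k) q j i) p.
Proof.
move=> Up; rewrite /dword /word /=; case: (i < j)%N; exact: smooth_al.
Qed.

Lemma smooth_kco (d : section D) (w : section (L1H H)) j p : U p ->
  smooth_sec d p -> smooth_sec w p -> smooth_fun (fun q => kco (d q) (w q) j) p.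
Proof.
move=> Up sd sw; have := smooth_kap sd sw; apply => i.
exact: smooth_dword.
Qed.

Lemma smooth_hb (d : section D) j p : U p -> smooth_sec d p ->
  smooth_sec (fun q => hb (d q) j) p.
Proof.
move=> Up sd; have smH := frame_module FH Up.
apply: (sm_sum smH) => i; apply: (sm_scale smH); last exact: (smooth_frame FH).
by apply: smooth_kco => //; apply: (smooth_coframe FH).
Qed.

(** ** The canonical identification of densities *)

Notation i0 := (@o4 0 isT).
Notation i1 := (@o4 1 isT).
Notation i2 := (@o4 2 isT).
Notation i3 := (@o4 3 isT).

Let AB q (d : D q) (Uq : U q) (d0 : d != 0) := adapted_basis Uq d0.

Lemma lam_lin q (d : D q) c (a b : Lb H q) : U q ->
  lam d (c *: a + b) = c * lam d a + lam d b.
Proof. by move=> Uq; rewrite /lam (levi_lin Fr HU) // bfappD bfappZ. Qed.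

Lemma lamZ q (d : D q) c (a : Lb H q) : U q ->
  lam d (c *: a) = c * lam d a.
Proof. by move=> Uq; rewrite /lam (leviZ Fr HU) // bfappZ. Qed.

Lemma lam_inj q (d : D q) (a b : Lb H q) : U q -> d != 0 ->
  lam d a = lam d b -> a = b.
Proof.
move=> Uq d0 ab; apply/eqP; rewrite -subr_eq0; apply: contraT => /(lb_neq0 (AB Uq d0)).
have -> : a - b = (-1) *: b + a by rewrite scaleN1r addrC.
by rewrite lam_lin // ab mulN1r addNr eqxx.
Qed.

Lemma levi_coords q (d : D q) (a : Lb H q) (X Y : Hb H q) : U q -> d != 0 ->
  let x j := happ (wb d j) X : R in let y j := happ (wb d j) Y : R in
  fapp (levi a) [args X; Y] =
    lam d a * (x i0 * y i3 - x i3 * y i0 - (x i1 * y i2 - x i2 * y i1) / 3) :> R.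
Proof.
move=> Uq d0 x y; have B := AB Uq d0.
have E (l : R) (u v : 'I_4 -> R) : \sum_i \sum_j u i * v j * (l * omega_mx i j) =
    l * (u i0 * v i3 - u i3 * v i0 - (u i1 * v i2 - u i2 * v i1) / 3).
  by rewrite !sum4 /omega_mx /=; ring.
rewrite {1}(lb_span B X) {1}(lb_span B Y) form2_exp -E.
by apply: eq_bigr => i _; apply: eq_bigr => j _; rewrite (lb_levi B).
Qed.

(** The 1-forms w_j that occur in the normalisation of theta, with de_0 in the place
    of d. *)
Definition form_ref (j : nat) q : L1H H q := cub j *: wb (de 0 q) (inord j).

Definition lift_ref (j : nat) q : dualb (@TM R 5 M) q :=
  cub j *: lift1 e (fun q => wb (de 0 q) (inord j)) q.

Lemma restr1_lin q c (u v : dualb (@TM R 5 M) q) :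
  restr1 H (c *: u + v) = c *: restr1 H u + restr1 H v.
Proof. by apply: hom_eqP => x; rewrite happDl happZl !restr1E happDl happZl. Qed.

Lemma restr1Z q c (u : dualb (@TM R 5 M) q) : restr1 H (c *: u) = c *: restr1 H u.
Proof. by apply: hom_eqP => x; rewrite happZl !restr1E happZl. Qed.

Lemma restr1_lift_ref j q : U q -> restr1 H (lift_ref j q) = form_ref j q.
Proof. by move=> Uq; rewrite /lift_ref restr1Z (lift1E Fr HU). Qed.

Lemma cub_neq0 j : cub j != 0 :> R.
Proof. by rewrite /cub; case: ifP; rewrite ?invr_eq0 ?pnatr_eq0 ?oner_eq0. Qed.

Lemma kap_form_ref j q : U q -> (j <= 3)%N ->
  twist (form_ref j q) (de 0 q) (de 0 q) = iso_to phi (sym_prod (word (f 0 q) (f 1 q) (k := 3) j)).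
Proof.
move=> Uq j3; rewrite sym_prod_word //; apply: (can_inj (@iso_ofK _ _ _ _ _ phi q)).
have -> : twist (form_ref j q) (de 0 q) (de 0 q) = cub j *: twist (wb (de 0 q) (inord j)) (de 0 q)
  (de 0 q).
  have := twist_lin (cub j) (wb (de 0 q) (inord j)) 0 (de 0 q) (de 0 q).
  rewrite addr0 => ->; apply: twist_eq => v z.
  by rewrite happDl bfappD !twistE happ0l mul0r addr0.
rewrite iso_toK; apply: (sym_eqP Uq) => i i3'.
have := iso_of_linear phi (cub j) (twist (wb (de 0 q) (inord j)) (de 0 q) (de 0 q)) 0.
have := iso_of_linear phi (-1) 0 (0 : homb (Hb H) (tensb 2 D) q).
rewrite scaler0 addr0 scaleN1r addNr => -> ; rewrite !addr0 => ->.
rewrite bfappZ -/(kap _ _) kap_wb ?(de_neq0 Fd) // !symk_word //.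
rewrite inordK //; case: eqP => _; first by rewrite -[LHS]/(_ * _) mulr1.
by rewrite -[LHS]/(_ * _) mulr0.
Qed.

(** Normalised so that its Levi form is w_0 ^ w_3 - 3 w_1 ^ w_2. *)
Definition ann_ref : section (Lb H) := fun q =>
  (lam (de 0 q) (ann_sec e 1 q))^-1 *: ann_sec e 1 q.

Lemma ann_sec_neq0 q : U q -> ann_sec e 1 q != 0 :> Lb H q.
Proof.
move=> Uq; apply/eqP => a0; apply: (annih_neq0 Fr Uq).
by rewrite -[annih e q]scale1r -(ann_secE Fr HU) // a0.
Qed.

Lemma lam_ann q (d : D q) : U q -> d != 0 -> lam d (ann_sec e 1 q) != 0.
Proof. by move=> Uq d0; apply: (lb_neq0 (AB Uq d0)); apply: ann_sec_neq0. Qed.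

Lemma lam_ann_ref q : U q -> lam (de 0 q) (ann_ref q) = 1.
Proof. by move=> Uq; rewrite lamZ // mulVf // lam_ann // (de_neq0 Fd). Qed.

Lemma levi_ann_ref q (X Y : Hb H q) : U q ->
  let x j := happ (form_ref j q) X : R in let y j := happ (form_ref j q) Y : R in
  fapp (levi (ann_ref q)) [args X; Y] =
    x 0%N * y 3%N - y 0%N * x 3%N - 3 * (x 1%N * y 2%N - y 1%N * x 2%N) :> R.
Proof.
move=> Uq x y; rewrite (levi_coords (d := de 0 q)) ?(de_neq0 Fd) // lam_ann_ref // mul1r.
have E (Z : Hb H q) j (hj : (j < 4)%N) :
    happ (form_ref j q) Z = cub j * (happ (wb (de 0 q) (o4 hj)) Z : R) :> R.
  rewrite /form_ref happZl; congr (_ *: happ (wb _ _) _).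
  by apply: val_inj; rewrite /= inordK.
have F (u v : 'I_4 -> R) (u' v' : nat -> R) :
    (forall j (hj : (j < 4)%N), u' j = cub j * u (o4 hj)) ->
    (forall j (hj : (j < 4)%N), v' j = cub j * v (o4 hj)) ->
    u i0 * v i3 - u i3 * v i0 - (u i1 * v i2 - u i2 * v i1) / 3 =
    u' 0%N * v' 3%N - v' 0%N * u' 3%N - 3 * (u' 1%N * v' 2%N - v' 1%N * u' 2%N).
  move=> uE vE; rewrite (uE 0%N isT) (uE 1%N isT) (uE 2%N isT) (uE 3%N isT).
  rewrite (vE 0%N isT) (vE 1%N isT) (vE 2%N isT) (vE 3%N isT) /cub /=.
  by field.
exact: (F (fun j => happ (wb (de 0 q) j) X) (fun j => happ (wb (de 0 q) j) Y)
  x y (E X) (E Y)).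
Qed.

Definition factors_ref q : 'I_5 -> dualb (@TM R 5 M) q :=
  vcons (elt_val (ann_ref q)) (fun i : 'I_4 => lift_ref i q).

(** The volume form a ^ w_0 ^ w_1 ^ w_2 ^ w_3 measured against de_0. Its ninth root
    is the ratio of the canonical density to de_0. *)
Definition vol_ratio q : R := fapp (iso_to (vol G) (wedge5 (factors_ref q))) [args de 0 q; de 0 q; de 0 q].

Lemma vol_scale q c (x : formb Alt 5 (@TM R 5 M) trivb q) :
  iso_to (vol G) (c *: x) = c *: iso_to (vol G) x.
Proof.
have v0 : iso_to (vol G) (0 : formb Alt 5 (@TM R 5 M) trivb q) = 0.
  by have := iso_linear (vol G) (-1) (0 : formb Alt 5 (@TM R 5 M) trivb q) 0; rewrite scaler0
    addr0 scaleN1r addNr.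
by have := iso_linear (vol G) c x 0; rewrite v0 !addr0.
Qed.

(** On the frame formed by the transversal e_4 and the vectors dual to the w_j, the
    matrix is triangular with non-zero diagonal. *)
Lemma wedge5_factors_neq0 q : U q -> wedge5 (factors_ref q) != 0.
Proof.
move=> Uq; apply/eqP => w0.
have d0 := de_neq0 Fd Uq; have B := AB Uq d0.
pose v : 'I_5 -> @TM R 5 M q :=
  vcons (e ord_max q) (fun i : 'I_4 => elt_val (hb (de 0 q) i)).
have : fapp (wedge5 (factors_ref q)) v = 0 by rewrite w0 bfapp0.
rewrite wedge5E det_trig.
  move/eqP; apply/negP; apply/prodf_neq0 => i _; rewrite mxE /v /factors_ref.
  case: (unliftP ord0 i) => [j|] ->.
    rewrite !vconsS /lift_ref happZl -restr1E (lift1E Fr HU) // (lb_dual B).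
    rewrite inord_val eqxx -[_ *: _]/(_ * _) mulr1; exact: cub_neq0.
  rewrite !vcons0; apply/eqP => a0; have := lam_ann_ref Uq.
  have -> : ann_ref q = 0 by apply: sub_eqP; rewrite (ann_line Fr HU _ Uq) a0 scale0r.
  have := lamZ (de 0 q) 0 (0 : Lb H q) Uq; rewrite scale0r mul0r => ->.
  by move/eqP; rewrite eq_sym oner_eq0.
apply/is_trig_mxP => i j ij; rewrite mxE /v /factors_ref.
case: (unliftP ord0 j) ij => [m|] -> //.
rewrite vconsS; case: (unliftP ord0 i) => [l|] ->.
  rewrite /= /bump !leq0n !add1n ltnS => lm; rewrite vconsS /lift_ref happZl -restr1E (lift1E Fr HU) //.
  rewrite (lb_dual B) inord_val -val_eqE (ltn_eqF lm).
  by rewrite -[LHS]/(_ * _) mulr0.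
by rewrite vcons0 => _; apply: (elt_set (ann_ref q)); apply: elt_set.
Qed.

Lemma vol_ratio_neq0 q : U q -> vol_ratio q != 0.
Proof.
move=> Uq; apply/eqP => N0; have := wedge5_factors_neq0 Uq; case/eqP.
apply: (can_inj (@iso_toK _ _ _ _ _ (vol G) q)).
have -> : iso_to (vol G) (0 : formb Alt 5 (@TM R 5 M) trivb q) = 0.
  by have := vol_scale 0 (0 : formb Alt 5 (@TM R 5 M) trivb q); rewrite !scale0r.
apply: form_eqP => z; rewrite bfapp0 (args3E z).
rewrite (dcoordE Fd (z 0) Uq) (dcoordE Fd (z 1) Uq) (dcoordE Fd (z 2) Uq).
rewrite (form3Z _ _ _ _ _ _ (fapp_form _)) -/(vol_ratio q).
by rewrite N0 scaler0.
Qed.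

(** ** Existence of the canonical identification *)

Lemma sym_prod_args q (x y z : S q) : U q ->
  sym_prod [args x; y; z] =
  pol [seq (happ (al 0 q) s : R, happ (al 1 q) s : R) | s : S q <- [:: x; y; z]]
    (fun j => sym_prod (word (f 0 q) (f 1 q) (k := 3) j)).
Proof.
move=> Uq; rewrite -[map _ _]/(map _ [tuple x; y; z]) -pol_args.
rewrite -(sym_form_pol _ _ _ _ (@sym_prod_form q 3)); congr sym_prod.
by apply/funext => i; rewrite -spin2E.
Qed.

Lemma twist_pol q l (d : D q) (u : nat -> L1H H q) :
  twist (pol l u) d d = pol l (fun j => twist (u j) d d).
Proof.
by apply: (pol_linear (g := fun w : L1H H q => twist w d d : homb (Hb H) (tensb 2 D) q)) => a x y;
  apply: twist_lin.
Qed.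

(** This reduces the correspondence between products of sections of S and 1-forms to
    monomials in the frame. *)
Lemma sym_prod_twist q (x y z : S q) : U q ->
  iso_to phi (sym_prod [args x; y; z]) =
  twist (restr1 H (pol [seq (happ (al 0 q) s : R, happ (al 1 q) s : R) | s : S q <- [:: x; y; z]]
    (fun j => lift_ref j q))) (de 0 q) (de 0 q).
Proof.
move=> Uq; rewrite sym_prod_args // (pol_linear (g := fun K : symb 3 S q => iso_to phi K));
  last first.
  by move=> a u v; apply: iso_linear.
rewrite (pol_linear (g := fun u : dualb (@TM R 5 M) q => restr1 H u)); last first.
  by move=> a u v; apply: restr1_lin.
rewrite twist_pol; apply: eq_pol => j j3 /=.
by rewrite restr1_lift_ref // kap_form_ref.
Qed.

Section Coefficients.
Variables (sa sb ta tb : R).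

(** The action on cubic monomials of a change of basis of S. *)
Definition sym3_mx (i j : nat) : R :=
  pol (nth [::] [:: [:: (sa, sb); (sa, sb); (sa, sb)]; [:: (sa, sb); (sa, sb); (ta, tb)];
    [:: (sa, sb); (ta, tb); (ta, tb)]; [:: (ta, tb); (ta, tb); (ta, tb)]] i)
    (fun n => (n == j)%:R : R^o).

Lemma det_sym3 (k : R) :
  \det (\matrix_(i < 4, j < 4) (k * sym3_mx i j)) = k ^+ 4 * (sa * tb - sb * ta) ^+ 6.
Proof.
rewrite (det4_nat (fun i j => k * sym3_mx i j)) /sym3_mx /= /GRing.scale /=.
by ring.
Qed.

Lemma sym3_sum (V : lmodType R) (k : R) (w : nat -> V) (i : nat) : (i < 4)%N ->
  k *: pol (nth [::] [:: [:: (sa, sb); (sa, sb); (sa, sb)]; [:: (sa, sb); (sa, sb); (ta, tb)];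
    [:: (sa, sb); (ta, tb); (ta, tb)]; [:: (ta, tb); (ta, tb); (ta, tb)]] i) w =
  \sum_(j < 4) (k * sym3_mx i j) *: w j.
Proof.
have polF l (F : nat -> nat -> R) : pol l (fun j => \sum_(m < 4) F j m *: w m) =
    \sum_(m < 4) (pol l (fun j => F j m : R^o) : R) *: w m.
  elim: l F => [|ab l IH] F //=.
  rewrite (IH F) (IH (fun j m => F j.+1 m)) !scaler_sumr -big_split /=.
  by apply: eq_bigr => j _; rewrite scalerDl !scalerA.
have polE (l : seq (R * R)) : (size l <= 3)%N ->
    pol l w = \sum_(j < 4) (pol l (fun n => (n == j :> nat)%:R : R^o) : R) *: w j.
  move=> l3; rewrite -(polF l (fun n j => (n == j)%:R)); apply: eq_pol => j jl.
  have j4 : (j < 4)%N by rewrite ltnS (leq_trans jl).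
  rewrite (bigD1 (Ordinal j4)) //= eqxx scale1r.
  rewrite big1 ?addr0 // => m; rewrite -val_eqE /= eq_sym => /negPf ->.
  by rewrite scale0r.
move=> i4; rewrite polE; last by case: i i4 => [|[|[|[|]]]].
rewrite scaler_sumr; apply: eq_bigr => j _; rewrite scalerA.
by [].
Qed.

End Coefficients.

(** Replacing (f_0, f_1) by a basis (s, t) of determinant Dl multiplies d by Dl. The
    w_i undergo the change of basis of Sym^3, of determinant Dl^6, and a division by
    (Dl c)^2; a is divided by Dl c^4. The powers of Dl cancel in the volume of a ^
    w_0 ^ ... ^ w_3 on (d, d, d), and c^-9 remains. *)
Lemma canonical_exists q (c : R) : U q -> c ^+ 9 = vol_ratio q ->
  is_canonical (fun l : extb 2 S q =>
    ((fapp l [args al 0 q; al 1 q] : R) * c) *: de 0 q).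
Proof.
move=> Uq c9; have N0 := vol_ratio_neq0 Uq.
have c0 : c != 0 by apply: contra N0 => /eqP c0; rewrite -c9 c0 expr0n.
split=> [a u v|s t st].
  by rewrite bfappD bfappZ -[_ + _ in LHS]/(a * (_ : R) + (_ : R)) mulrDl scalerDl scalerA -mulrA.
pose sa : R := happ (al 0 q) s; pose sb : R := happ (al 1 q) s.
pose ta : R := happ (al 0 q) t; pose tb : R := happ (al 1 q) t.
pose Dl : R := sa * tb - sb * ta.
have stE : fapp (wedge2 s t) [args al 0 q; al 1 q] = Dl by rewrite wedge2E /Dl [sb * _]mulrC.
have D0 : Dl != 0.
  apply: contra st => /eqP Dl0; apply/eqP; apply: (ext2_eqP Uq).
  by rewrite stE Dl0 bfapp0.
rewrite stE; set m := Dl * c; have m0 : m != 0 by rewrite mulf_neq0.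
pose l i := nth [::] [:: [:: (sa, sb); (sa, sb); (sa, sb)]; [:: (sa, sb); (sa, sb); (ta, tb)];
    [:: (sa, sb); (ta, tb); (ta, tb)]; [:: (ta, tb); (ta, tb); (ta, tb)]] i.
pose w i : dualb (@TM R 5 M) q := m ^- 2 *: pol (l i) (fun j => lift_ref j q).
exists ((Dl * c ^+ 4)^-1 *: ann_ref q), (w 0%N), (w 1%N), (w 2%N), (w 3%N) => corr wdg.
have twE i : twist (restr1 H (w i)) (m *: de 0 q) (m *: de 0 q) =
    twist (restr1 H (pol (l i) (fun j => lift_ref j q))) (de 0 q) (de 0 q).
  by rewrite twist_scale /w restr1Z scalerA mulfV ?scale1r // expf_neq0.
have wE i (X : Hb H q) : happ (restr1 H (w i)) X =
    m ^- 2 * (pol (l i) (fun j => happ (form_ref j q) X : R^o) : R) :> R.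
  rewrite /w restr1Z happZl.
  rewrite (pol_linear (g := fun u : dualb (@TM R 5 M) q => restr1 H u)); last first.
    by move=> a u v; apply: restr1_lin.
  rewrite (pol_linear (g := fun u : L1H H q => happ u X : R^o)) //; congr (_ * _).
  by apply: eq_pol => j _ /=; rewrite restr1_lift_ref.
split.
- by split; rewrite /corr sym_prod_twist // twE.
- move=> X Y; rewrite (leviZ Fr HU) // bfappZ levi_ann_ref // /wdg.
  have PE (x y : nat -> R^o) (x' y' : nat -> R) :
      (forall i, x' i = m ^- 2 * pol (l i) x) ->
      (forall i, y' i = m ^- 2 * pol (l i) y) ->
      (Dl * c ^+ 4)^-1 *
      (x 0%N * y 3%N - y 0%N * x 3%N - 3 * (x 1%N * y 2%N - y 1%N * x 2%N)) =
      x' 0%N * y' 3%N - y' 0%N * x' 3%N - 3 * (x' 1%N * y' 2%N - y' 1%N * x' 2%N) :> R.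
    move=> x'E y'E; rewrite !x'E !y'E /l /= /GRing.scale /=.
    move: (D0); rewrite /m /Dl => D0'.
    by field; rewrite c0.
  exact: (PE (fun j => happ (form_ref j q) X) (fun j => happ (form_ref j q) Y)
    (fun i => happ (restr1 H (w i)) X) (fun i => happ (restr1 H (w i)) Y)
    (wE^~ X) (wE^~ Y)).
rewrite (args5E _ w) subZ.
pose B i j := m ^- 2 * sym3_mx sa sb ta tb i j.
have -> : vcons ((Dl * c ^+ 4)^-1 *: elt_val (ann_ref q)) (fun i : 'I_4 => w i) =
    vcons ((Dl * c ^+ 4)^-1 *: elt_val (ann_ref q))
      (fun i : 'I_4 => (fun=> 0 : R) i *: elt_val (ann_ref q) + \sum_(j < 4) B i j *: lift_ref j q).
  congr vcons; apply/funext => i; rewrite scale0r add0r /w (sym3_sum _ _ _ _ _ (fun j => lift_ref j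
    q)) //.
have -> := wedge5_comb (elt_val (ann_ref q)) (fun j => lift_ref j q) (Dl * c ^+ 4)^-1 (fun=> 0) B.
rewrite vol_scale bfappZ (form3Z _ _ _ _ _ _ (fapp_form _)) -/(factors_ref q).
rewrite -/(vol_ratio q) -c9 det_sym3 -/Dl -[LHS]/(_ * (_ * _)) /m.
by field; rewrite c0 D0.
Qed.

(** ** Uniqueness of the canonical identification *)

Lemma restr1_eq0 q (v : dualb (@TM R 5 M) q) : U q -> restr1 H v = 0 ->
  exists b : R, v = b *: elt_val (ann_ref q).
Proof.
move=> Uq v0.
have va : annihilates H v.
  by move=> x Hx; rewrite -[x in LHS](to_eltK Hx) -restr1E v0 happ0l.
pose a : Lb H q := to_elt _ v.
have av : elt_val a = v by rewrite /a to_eltK.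
have l0 := lam_ann Uq (de_neq0 Fd Uq).
exists ((happ v (e ord_max q) : R) * lam (de 0 q) (ann_sec e 1 q)).
rewrite /ann_ref subZ (ann_secE Fr HU) // scale1r scalerA mulfK //.
by rewrite -{1}av (ann_line Fr HU _ Uq) av.
Qed.

Lemma wedge2_neq0 q : U q -> wedge2 (f 0 q) (f 1 q) != 0.
Proof.
move=> Uq; apply/eqP => w0; have := wedge2_frame Uq.
by rewrite w0 bfapp0 => /eqP; rewrite eq_sym oner_eq0.
Qed.

(** If d is c times de_0, then the w_i are divided by c^2 up to multiples of a, and a
    by c^4; so the volume form is divided by c^12, and its value on (d, d, d) by c^9. *)
Lemma canonical_coord q (th : extb 2 S q -> D q) : U q -> is_canonical th ->
  th (wedge2 (f 0 q) (f 1 q)) != 0 /\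
  dcoord de (th (wedge2 (f 0 q) (f 1 q))) ^+ 9 = vol_ratio q.
Proof.
move=> Uq [_ /(_ _ _ (wedge2_neq0 Uq))].
set d := th _ => -[a [w0 [w1 [w2 [w3 [[cor0 cor1 cor2 cor3] lev vl]]]]]].
have d0 : d != 0.
  apply/eqP => d0; move: vl; rewrite (_ : d = 0 *: d); last by rewrite scale0r.
  rewrite (form3Z _ _ _ _ _ _ (fapp_form _)) !mul0r scale0r.
  by move/eqP; rewrite eq_sym oner_eq0.
split=> //; set c := dcoord de d.
have c0 : c != 0 by apply: (dcoord_neq0 Fd Uq d0).
have dE : d = c *: de 0 q by apply: (dcoordE Fd d Uq).
pose w i := nth 0 [:: w0; w1; w2; w3] i.
have al00 : happ (al 0 q) (f 0 q) = 1 :> R by rewrite alE.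
have al01 : happ (al 0 q) (f 1 q) = 0 :> R by rewrite alE.
have al10 : happ (al 1 q) (f 0 q) = 0 :> R by rewrite alE.
have al11 : happ (al 1 q) (f 1 q) = 1 :> R by rewrite alE.
have rw i : (i < 4)%N -> restr1 H (w i) = c ^- 2 *: form_ref i q.
  have tw (u : dualb (@TM R 5 M) q) (x y z : S q) j :
      iso_to phi (sym_prod [args x; y; z]) = twist (restr1 H u) d d ->
      pol [seq (happ (al 0 q) s : R, happ (al 1 q) s : R) | s : S q <- [:: x; y; z]]
        (fun j => lift_ref j q) = lift_ref j q ->
      restr1 H u = c ^- 2 *: form_ref j q.
    move=> uE pE; have -> : form_ref j q = c ^+ 2 *: restr1 H u.
      apply: (twist_inj Fd Uq (de_neq0 Fd Uq)).
      by rewrite -twist_scale -dE -uE sym_prod_twist // pE restr1_lift_ref.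
    by rewrite scalerA mulVf ?scale1r // expf_neq0.
  have P (V : lmodType R) (W : nat -> V) :
      [/\ pol [:: (1, 0); (1, 0); (1, 0)] W = W 0%N,
          pol [:: (1, 0); (1, 0); (0, 1)] W = W 1%N,
          pol [:: (1, 0); (0, 1); (0, 1)] W = W 2%N &
          pol [:: (0, 1); (0, 1); (0, 1)] W = W 3%N].
    by split=> /=; rewrite !(scale1r, scale0r, addr0, add0r).
  have [P0 P1 P2 P3] := P _ (fun j => lift_ref j q).
  case: i => [|[|[|[|i]]]] // _.
  - by apply: (tw w0 _ _ _ 0%N cor0); rewrite -[RHS]P0; congr pol; rewrite /= al00 al10.
  - by apply: (tw w1 _ _ _ 1%N cor1); rewrite -[RHS]P1; congr pol; rewrite /= al00 al10 al01 al11.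
  - by apply: (tw w2 _ _ _ 2%N cor2); rewrite -[RHS]P2; congr pol; rewrite /= al00 al10 al01 al11.
  - by apply: (tw w3 _ _ _ 3%N cor3); rewrite -[RHS]P3; congr pol; rewrite /= al01 al11.
have aE : a = c ^- 4 *: ann_ref q.
  apply: (lam_inj Uq (de_neq0 Fd Uq)); rewrite lamZ // /lam lev levi_ann_ref //.
  have hw i (i4 : (i < 4)%N) X : happ (restr1 H (w i)) X = c ^- 2 * (happ (form_ref i q) X : R) :> R.
    by rewrite rw.
  set X := hb _ _; set Y := hb _ _.
  have E (x y x' y' : nat -> R) :
    (forall i, (i < 4)%N -> x' i = c ^- 2 * x i) -> (forall i, (i < 4)%N -> y' i = c ^- 2 * y
      i) ->
    x' 0%N * y' 3%N - y' 0%N * x' 3%N - 3 * (x' 1%N * y' 2%N - y' 1%N * x' 2%N) =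
    c ^- 4 * (x 0%N * y 3%N - y 0%N * x 3%N - 3 * (x 1%N * y 2%N - y 1%N * x 2%N)).
    by move=> xE yE; rewrite !xE // !yE //; field.
  exact: (E (fun j => happ (form_ref j q) X) (fun j => happ (form_ref j q) Y)
    (fun j => happ (restr1 H (w j)) X) (fun j => happ (restr1 H (w j)) Y)
    (fun i i4 => hw i i4 X) (fun i i4 => hw i i4 Y)).
have wE i : (i < 4)%N -> exists b : R, w i = b *: elt_val (ann_ref q) + c ^- 2 *: lift_ref i q.
  move=> i4; have : restr1 H (- c ^- 2 *: lift_ref i q + w i) = 0.
    by rewrite restr1_lin restr1_lift_ref // rw // scaleNr addNr.
  case/(restr1_eq0 Uq) => b bE; exists b.
  by rewrite -bE scaleNr addrAC addNr add0r.
have [b' bE] := @choice _ _ (fun (i : 'I_4) b => w i = b *: elt_val (ann_ref q) + c ^- 2 *: lift_ref i q)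
  (fun i => wE i (ltn_ord i)).
pose b i := b' (inord i : 'I_4).
move: vl; rewrite (args5E _ w) aE subZ.
pose B i j : R := if i == j :> nat then c ^- 2 else 0.
have -> : vcons (c ^- 4 *: elt_val (ann_ref q)) (fun i : 'I_4 => w i) =
    vcons (c ^- 4 *: elt_val (ann_ref q))
      (fun i : 'I_4 => b i *: elt_val (ann_ref q) + \sum_(j < 4) B i j *: lift_ref j q).
  congr vcons; apply/funext => i; rewrite bE /b inord_val; congr (_ + _).
  rewrite (bigD1 i) //= /B eqxx big1 ?addr0 // => j /negPf.
  by rewrite -val_eqE /= eq_sym => ->; rewrite scale0r.
have -> := wedge5_comb (elt_val (ann_ref q)) (fun j => lift_ref j q) (c ^- 4) b B.
rewrite vol_scale bfappZ dE (form3Z _ _ _ _ _ _ (fapp_form _)) -/(factors_ref q) -/(vol_ratio q).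
rewrite (det4_nat B) /B /= -[LHS]/(_ * (_ * _)) => vl.
have cE : c ^+ 9 * (c ^- 4 * (c ^- 2 * (c ^- 2 * (c ^- 2 * c ^- 2))) * (c * c * c)) = 1.
  by field.
have c90 : c ^+ 9 != 0 by rewrite expf_neq0.
apply: (mulfI (x := c ^- 4 * (c ^- 2 * (c ^- 2 * (c ^- 2 * c ^- 2))) * (c * c * c))).
  by apply: contraTneq (oner_neq0 R) => z; rewrite -cE z mulr0 eqxx.
rewrite mulrC cE -vl; ring.
Qed.

Lemma theta_canonical q : U q -> is_canonical (@theta R M H G q).
Proof.
move=> Uq; have [c c9] := odd_root_exists (vol_ratio q) (isT : odd 9).
exact: (xgetPex (fun=> 0) (ex_intro _ _ (canonical_exists Uq c9))).
Qed.

Lemma theta_lin q a (l l' : extb 2 S q) : U q ->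
  theta (a *: l + l') = a *: theta l + theta l'.
Proof. by move=> Uq; have [] := theta_canonical Uq. Qed.

Lemma thetaZ q a (l : extb 2 S q) : U q -> theta (a *: l) = a *: theta l.
Proof.
move=> Uq; have t0 : theta (0 : extb 2 S q) = 0.
  by have := theta_lin (-1) 0 (0 : extb 2 S q) Uq; rewrite scaler0 addr0 scaleN1r addNr.
by have := theta_lin a l 0 Uq; rewrite t0 !addr0.
Qed.

Lemma thetaE q (l : extb 2 S q) : U q ->
  theta l = (fapp l [args al 0 q; al 1 q] : R) *: theta (wedge2 (f 0 q) (f 1 q)).
Proof.
move=> Uq; rewrite -thetaZ //; congr theta.
exact: (ext2_line _ Uq (wedge2_frame Uq)).
Qed.

Lemma theta_neq0 q (l : extb 2 S q) : U q -> l != 0 -> theta l != 0.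
Proof.
move=> Uq l0; rewrite thetaE // scaler_eq0 negb_or.
rewrite (canonical_coord Uq (theta_canonical Uq)).1 andbT.
apply: contra l0 => /eqP l0; apply/eqP; apply: (ext2_eqP Uq).
by rewrite l0 bfapp0.
Qed.

(** ** Smoothness of the canonical identification *)

Let Tm q : U q -> smooth_module (dualb (@TM R 5 M)) q.
Proof. by move=> Uq; apply: form_module; apply: triv_module. Qed.

Lemma smooth_ann_ref q : U q -> smooth_sec ann_ref q.
Proof.
move=> Uq; apply: (sm_scale (sub_module _ (Tm Uq))); last exact: (smooth_ann_sec Fr HU).
apply: smooth_inv; last exact: (lam_ann Uq (de_neq0 Fd Uq)).
have sh j : smooth_sec (fun q => hb (de 0 q) j) q.
  exact: (smooth_hb j Uq (smooth_frame Fd 0 Uq)).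
have sH j : smooth_sec (hval (fun q => hb (de 0 q) j)) q := sh j.
apply: (smooth_eq (f := fun q => - happ (annih e q)
    (bracket (hval (fun q => hb (de 0 q) i0)) (hval (fun q => hb (de 0 q) i3)) q))).
  near=> x; have Ux : U x by near: x; apply: frame_nbhs Fr _ Uq.
  rewrite /lam (leviE Fr HU (ann_sec e 1 x) (X := fun q => hb (de 0 q) i0) (Y := fun q => hb
    (de 0 q) i3)) //.
  - by rewrite (ann_secE Fr HU) // scale1r.
  - exact: (smooth_hb _ Ux (smooth_frame Fd 0 Ux)).
  - exact: (smooth_hb _ Ux (smooth_frame Fd 0 Ux)).
apply: smooth_opp; apply: (smooth_happ (F := trivb)).
  exact: (smooth_annih Fr).
exact: (smooth_bracket Fr Uq (sH i0) (sH i3)).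
Unshelve. all: by end_near.
Qed.

Lemma smooth_lift_ref j q : U q -> smooth_sec (lift_ref j) q.
Proof.
move=> Uq; apply: (sm_scale (Tm Uq)); first exact: smooth_cst.
apply: (smooth_lift1 Fr HU Uq).
exact: (smooth_wb _ Uq (smooth_frame Fd 0 Uq) (de_neq0 Fd Uq)).
Qed.

Lemma smooth_det (E : prebundle M) n (w : 'I_n -> section (dualb E)) (v : 'I_n -> section E) q :
  (forall i, smooth_sec (w i) q) -> (forall i, smooth_sec (v i) q) ->
  smooth_fun (fun x => \det (\matrix_(i, j) (happ (w i x) (v j x) : R))) q.
Proof.
move=> sw sv; apply: smooth_sum => s _; apply: smooth_mul; first exact: smooth_cst.
apply: smooth_prod => i _; apply: (@smooth_eq _ _ _ (fun x => happ (w i x) (v (s i) x))).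
  by near=> x; rewrite mxE.
exact: (smooth_happ (F := trivb)).
Unshelve. all: by end_near.
Qed.

Lemma smooth_vol_ratio q : U q -> smooth_fun vol_ratio q.
Proof.
move=> Uq; have sd : smooth_sec (de 0) q := smooth_frame Fd 0 Uq.
suff sW : smooth_sec (fun x => wedge5 (factors_ref x)) q.
  have sW' : smooth_sec (fun x => iso_to (vol G) (wedge5 (factors_ref x))) q by apply/iso_smooth.
  have := sW' (fun i => [args de 0; de 0; de 0] i).
  have s3 i : smooth_sec ([args de 0; de 0; de 0] i) q.
    by case: i => -[|[|[|//]]] ?; rewrite (tnth_nth (de 0)).
  move=> /(_ s3); apply: smooth_eq; near=> x; rewrite /vol_ratio; congr fapp.
  apply/funext => i; rewrite !(tnth_nth (de 0)) !(tnth_nth (de 0 x)).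
  by case: i => -[|[|[|//]]] ?.
move=> v sv; apply: (@smooth_eq _ _ _ (fun x => \det (\matrix_(i, j) (happ (factors_ref x i) (v j x) :
  R)))).
  by near=> x; rewrite wedge5E.
apply: (smooth_det (w := fun i x => factors_ref x i)) => // i; rewrite /factors_ref.
case: (unliftP ord0 i) => [j|] ->.
  apply: (sm_eq (Tm Uq) (s := lift_ref j)); last exact: smooth_lift_ref.
  by near=> x; rewrite vconsS.
apply: (sm_eq (Tm Uq) (s := fun x => elt_val (ann_ref x))); last exact: smooth_ann_ref.
by near=> x; rewrite vcons0.
Unshelve. all: by end_near.
Qed.

(** In the frames, theta is the real ninth root of a smooth function without zeros. *)
Lemma smooth_theta (s : section (extb 2 S)) q : U q -> smooth_sec s q ->
  smooth_sec (fun x => theta (s x)) q.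
Proof.
move=> Uq ss.
have Sm := frame_module Fd Uq.
have sl : smooth_fun (fun x => fapp (s x) [args al 0 x; al 1 x] : R) q.
  exact: (smooth_fapp2 ss (smooth_al 0 Uq) (smooth_al 1 Uq)).
pose c x : R := dcoord de (theta (wedge2 (f 0 x) (f 1 x))).
have sc : smooth_fun c q.
  apply: (smooth_odd_root (k := 9) (f := vol_ratio)) => //.
  - exact: smooth_vol_ratio.
  - exact: vol_ratio_neq0.
  near=> x; have Ux : U x by near: x; apply: frame_nbhs Fr _ Uq.
  exact: (canonical_coord Ux (theta_canonical Ux)).2.
apply: (sm_eq Sm (s := fun x => ((fapp (s x) [args al 0 x; al 1 x] : R) * c x) *: de 0 x)).
  near=> x; have Ux : U x by near: x; apply: frame_nbhs Fr _ Uq.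
  by rewrite [RHS]thetaE // -scalerA /c -(dcoordE Fd).
apply: (sm_scale Sm); last exact: (smooth_frame Fd 0 Uq).
exact: smooth_mul.
Unshelve. all: by end_near.
Qed.

(** ** The isomorphism of H^* with the twisted cubic forms *)

Context {sg : section (extb 2 S)}.
Hypothesis ssg : forall q, U q -> smooth_sec sg q.
Hypothesis sg1 : forall q, U q -> fapp (sg q) [args al 0 q; al 1 q] = 1 :> R.

Let thL q a (l l' : extb 2 S q) (Uq : U q) := theta_lin a l l' Uq.

Lemma psiE q (w : L1H H q) l l' : U q ->
  fapp (psi G w) [args l; l'] = iso_of phi (twist w (theta l) (theta l')).
Proof.
move=> Uq; rewrite mk_formE.
  by congr (iso_of _ (twist _ _ _)); rewrite (tnth_nth l).
apply: (is_form2 (g := fun l l' => iso_of phi (twist w (theta l) (theta l')))) => a x y z.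
  by rewrite thL // twist_linl iso_of_linear.
by rewrite thL // twist_linr iso_of_linear.
Qed.

Lemma sg_neq0 q : U q -> sg q != 0.
Proof.
move=> Uq; apply/eqP => s0; have := sg1 Uq.
by rewrite s0 bfapp0 => /eqP; rewrite eq_sym oner_eq0.
Qed.

Lemma den_neq0 q : U q -> theta (sg q) != 0 :> D q.
Proof. by move=> Uq; apply: (theta_neq0 Uq); apply: sg_neq0. Qed.

Lemma smooth_den q : U q -> smooth_sec (fun x => theta (sg x) : D x) q.
Proof. by move=> Uq; apply: (smooth_theta Uq); apply: ssg. Qed.

Lemma psi_sg q (w : L1H H q) : U q ->
  fapp (psi G w) [args sg q; sg q] = kap (theta (sg q)) w.
Proof. by move=> Uq; rewrite psiE. Qed.

Lemma S32_eqP q (T T' : S32 G q) : U q ->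
  fapp T [args sg q; sg q] = fapp T' [args sg q; sg q] -> T = T'.
Proof.
move=> Uq TT'; apply: form_eqP => z; rewrite (args2E z).
rewrite (ext2_line (z 0) Uq (sg1 Uq)) (ext2_line (z 1) Uq (sg1 Uq)).
rewrite !(form2Zl (fapp_form T)) !(form2Zl (fapp_form T')).
by rewrite !(form2Zr (fapp_form T)) !(form2Zr (fapp_form T')) TT'.
Qed.

Lemma psi_surj q (T : S32 G q) : U q -> exists w, psi G w = T.
Proof.
move=> Uq; exists (untwist de (theta (sg q)) (iso_to phi (fapp T [args sg q; sg q]))).
apply: (S32_eqP Uq); rewrite psi_sg // /kap (untwistK Fd) ?iso_toK //.
exact: den_neq0.
Qed.

Lemma smooth_psi (w : section (L1H H)) q : U q -> smooth_sec w q ->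
  smooth_sec (fun x => psi G (w x) : S32 G x) q.
Proof.
move=> Uq sw.
change (@smooth_sec _ _ _ (formb Any 2 (extb 2 S) (symb 3 S)) (fun x => psi G (w x)) q) => s ss.
have sth i : smooth_sec (fun x => theta (s i x) : D x) q.
  exact: (smooth_theta Uq (ss i)).
have := iso_of_smooth phi (smooth_twist sw (sth 0) (sth 1)).
apply: (sm_eq (form_module _ _ _ (triv_module q))); near=> x.
have Ux : U x by near: x; apply: frame_nbhs Fr _ Uq.
by rewrite (args2E (s^~ x)) psiE.
Unshelve. all: by end_near.
Qed.

Section Induced.
(** ** The partial connections induced by one on S *)

Variable nab : operator H S.
Arguments nab : clear implicits.
Variable p : M.
Hypotheses (Up : U p) (cn : pconn_at nab p).
Implicit Types (X : Hb H p).

(** The entries of the connection matrix. *)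
Definition conn_entry i j X : R := happ (al i p) (nab p X (f j)).

Lemma nab_frame j X : nab p X (f j) = conn_entry 0 j X *: f 0 p + conn_entry 1 j X *: f 1 p.
Proof. exact: spin2E. Qed.

Lemma dual_pconn : pconn_at (dual_op nab) p.
Proof. exact: (form_op_pconn _ _ Fs Up cn (triv_pconn p) (triv_module p)). Qed.

Lemma ext_pconn k : pconn_at (ext_op k nab) p.
Proof.
exact: (form_op_pconn _ _ (coframe_frame Fs) Up dual_pconn (triv_pconn p) (triv_module p)).
Qed.

Lemma sym_pconn k : pconn_at (sym_op k nab) p.
Proof.
exact: (form_op_pconn _ _ (coframe_frame Fs) Up dual_pconn (triv_pconn p) (triv_module p)).
Qed.

Lemma happ_dual_coframe i j X : happ (dual_op nab p X (al i)) (f j p) = - conn_entry i j X :> R.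
Proof.
rewrite (form1_opE Fs Up cn (triv_pconn p) (triv_module p)).
- rewrite -[RHS]add0r; congr (_ - _).
  rewrite -(Hderiv_cst X (j == i)%:R); apply: (at_local (triv_pconn p)).
  + exact: (smooth_happ (F := trivb) (smooth_al _ Up) (smooth_f _ Up)).
  + exact: smooth_cst.
  + by near=> x; apply: alE; near: x; apply: frame_nbhs Fs _ Up.
- exact: (smooth_al _ Up).
- exact: (smooth_f _ Up).
Unshelve. all: by end_near.
Qed.

(** The connection induced on the exterior square is the trace of the connection
    matrix. *)
Lemma ext_op_trace X :
  ext_op 2 nab p X sg = 0 <-> conn_entry 0 0 X + conn_entry 1 1 X = 0.
Proof.
have E : fapp (ext_op 2 nab p X sg) [args al 0 p; al 1 p] = conn_entry 0 0 X + conn_entry 1 1 X :> R.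
  rewrite (form2_opE (coframe_frame Fs) Up dual_pconn (triv_pconn p) (triv_module p)).
  - rewrite (_ : triv_op _ _ = 0); last first.
      rewrite -(Hderiv_cst X 1); apply: (at_local (triv_pconn p)).
      + exact: (smooth_fapp2 (ssg Up) (smooth_al _ Up) (smooth_al _ Up)).
      + exact: smooth_cst.
      + by near=> x; apply: sg1; near: x; apply: frame_nbhs Fs _ Up.
    have E2 x y : fapp (sg p) [args x; y] =
        (happ x (f 0 p) : R) * happ y (f 1 p) - (happ x (f 1 p) : R) * happ y (f 0 p) :> R.
      by rewrite ext2E // sg1 // mulr1.
    rewrite !E2 !happ_dual_coframe !alE //=.
    have A (a b c d : R) : 0 - ((- a * 1 - - b * 0) + (1 * - d - 0 * - c)) = a + d by ring.
    exact: A.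
  - exact: ssg.
  - exact: (smooth_al _ Up).
  - exact: (smooth_al _ Up).
split=> [s0|g0]; first by rewrite -E s0 bfapp0.
by apply: (ext2_eqP Up); rewrite E g0 bfapp0.
Unshelve. all: by end_near.
Qed.

Hypothesis tr0 : forall X, ext_op 2 nab p X sg = 0.

Lemma conn_entry11 X : conn_entry 1 1 X = - conn_entry 0 0 X.
Proof. by apply/eqP; rewrite -addr_eq0 addrC; apply/eqP/ext_op_trace. Qed.

(** As the scale is parallel, evaluation at (sigma, sigma) commutes with the induced
    connections. *)
Lemma L1H_opE X (w : section (L1H H)) : smooth_sec w p ->
  kap (theta (sg p)) (L1H_op nab X w) =
    sym_op 3 nab p X (fun q => kap (theta (sg q)) (w q)).
Proof.
move=> sw.
have : psi G (L1H_op nab X w) =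
    form_op (ext_op 2 nab) (sym_op 3 nab) p X (fun q => psi G (w q)).
  exact: (xgetPex 0 (psi_surj _ Up)).
move/(congr1 (fun T : S32 G p => fapp T [args sg p; sg p])); rewrite psi_sg // => ->.
have sm3 := form_module Defs.Sym 3 (dualb S) (triv_module p).
rewrite (form2_opE (ext2_frame ssg sg1) Up (ext_pconn 2) (sym_pconn 3) sm3).
- rewrite tr0.
  have z0 : (0 : extb 2 S p) = 0 *: sg p by rewrite scale0r.
  rewrite z0 (form2Zl (fapp_form _)) (form2Zr (fapp_form _)) scale0r addr0 subr0.
  apply: (at_local (sym_pconn 3)).
  + exact: (smooth_fapp2 (smooth_psi Up sw) (ssg Up) (ssg Up)).
  + exact: (smooth_kap (smooth_den Up) sw).
  + by near=> x; apply: psi_sg; near: x; apply: frame_nbhs Fs _ Up.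
- exact: smooth_psi.
- exact: ssg.
- exact: ssg.
Unshelve. all: by end_near.
Qed.

Lemma L1H_pconn : pconn_at (L1H_op nab) p.
Proof.
have inj := kap_inj Up (den_neq0 Up).
have sk (w : section (L1H H)) : smooth_sec w p ->
    smooth_sec (fun q => kap (theta (sg q)) (w q)) p.
  exact: (smooth_kap (smooth_den Up)).
have sm : smooth_module (L1H H) p.
  by apply: form_module; apply: triv_module.
split=> [a X Y w sw|X w w' sw sw' ww'|X w w' sw sw'|X g w sg' sw]; apply: inj.
- rewrite (L1H_opE (a *: X + Y) sw) (at_linear (sym_pconn 3) a X Y (sk _ sw)).
  by rewrite -(L1H_opE X sw) -(L1H_opE Y sw) -kap_lin.
- apply: (etrans (L1H_opE X sw)); apply: (etrans _ (esym (L1H_opE X sw'))).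
  apply: (at_local (sym_pconn 3)); try exact: sk.
  by apply: filterS ww' => q ->.
- have E u v : kap (theta (sg p)) (u + v) = kap (theta (sg p)) u + kap (theta (sg p)) v.
    by have := kap_lin (theta (sg p)) 1 u v; rewrite !scale1r.
  apply: (etrans (L1H_opE X (sm_add sm sw sw'))); apply: (etrans _ (esym (E _ _))).
  apply: (etrans _ (esym (congr2 +%R (L1H_opE X sw) (L1H_opE X sw')))).
  apply: (etrans _ (at_add (sym_pconn 3) X (sk _ sw) (sk _ sw'))).
  congr (sym_op 3 nab p X _); apply: functional_extensionality_dep => q.
  by have := kap_lin (theta (sg q)) 1 (w q) (w' q); rewrite !scale1r.
have Z q a u : kap (theta (sg q)) (a *: u) = a *: kap (theta (sg q)) u.
  exact: kapZ.
apply: (etrans (L1H_opE X (sm_scale sm sg' sw))).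
apply: (etrans _ (esym (kap_lin (theta (sg p)) (g p) (L1H_op nab X w) (Hderiv X g *: w p)))).
apply: (etrans _ (esym (congr2 (fun a b => g p *: a + b) (L1H_opE X sw) (Z p _ _)))).
apply: (etrans _ (at_leibniz (sym_pconn 3) X sg' (sk _ sw))).
congr (sym_op 3 nab p X _); apply: functional_extensionality_dep => q.
exact: Z.
Qed.

(** The connection matrix acts on binary cubics through sl(2): j, 3 - 2 j and 3 - j
    are the entries of its three generators. *)
Lemma kco_L1H X (w : section (L1H H)) j : smooth_sec w p -> (j < 4)%N ->
  let k j : R := kco (theta (sg p)) (w p) j in
  kco (theta (sg p)) (L1H_op nab X w) j =
    Hderiv X (fun q => kco (theta (sg q)) (w q) j)
    + j%:R * (conn_entry 1 0 X * k j.-1) + (3 - 2 * j%:R) * conn_entry 0 0 X * k j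
    + (3 - j%:R) * conn_entry 0 1 X * k j.+1.
Proof.
move=> sw j4 k; rewrite {1}/kco L1H_opE //.
pose s : 'I_3 -> section (dualb S) := fun i => if (i < j)%N then al 1 else al 0.
have ss i : smooth_sec (s i) p by rewrite /s; case: ifP => _; apply: smooth_al.
have sE q : s^~ q = dword q j.
  by apply/funext => i; rewrite /s /dword /word; case: ifP.
have := form_opE (coframe_frame Fs) Up dual_pconn (triv_pconn p) (triv_module p) X
  (smooth_kap (smooth_den Up) sw) ss.
rewrite sE => ->.
have -> : triv_op X (fun q => fapp (kap (theta (sg q)) (w q)) (s^~ q)) =
    Hderiv X (fun q => kco (theta (sg q)) (w q) j).
  by rewrite /triv_op; congr (Hderiv X _); apply/funext => q; rewrite sE.
have -> : \sum_i fapp (kap (theta (sg p)) (w p)) (upd (dword p j) i (dual_op nab p X (s i)))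
    = \sum_i fapp (kap (theta (sg p)) (w p)) (upd (dword p j) i
        (if (i < j)%N then dual_op nab p X (al 1) else dual_op nab p X (al 0))).
  by apply: eq_bigr => i _; rewrite /s; case: ifP.
rewrite (sym3_derivation _ _ _ Up j4) /dco !happ_dual_coframe conn_entry11.
have E (h a b c n x y z : R) :
    h - (n * (- b * x + - - a * y) + (3 - n) * (- a * y + - c * z)) =
    h + n * (b * x) + (3 - 2 * n) * a * y + (3 - n) * c * z by ring.
exact: E.
Qed.

End Induced.

Arguments conn_entry nab p i j X : clear implicits.

(** ** Homomorphisms in the symmetric seventh power *)

Lemma kco_wbn q (n j : nat) : U q -> (n < 4)%N -> (j < 4)%N ->
  kco (theta (sg q)) (wb (theta (sg q)) (inord n)) j = (n == j)%:R.
Proof.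
move=> Uq n4 j4; have d0 := den_neq0 Uq.
have := kco_wb (inord n) (inord j) Uq d0; rewrite -val_eqE /= !inordK //.
Qed.

(** The array of the values of t on the coframe w_n, in the basis h_i of H. *)
Definition perp_mx q (t : homb (L1H H) (L2perp H) q) (n i j : nat) : R :=
  fapp (elt_val (happ t (wb (theta (sg q)) (inord n))))
    [args hb (theta (sg q)) (inord i); hb (theta (sg q)) (inord j)].

Lemma perp_mx_anti q (t : homb (L1H H) (L2perp H) q) n i j :
  perp_mx t n i j = - perp_mx t n j i.
Proof. exact: (alt2_anti (fapp_form _)). Qed.

(** The left-hand side of the condition that defines Sym^7, with c times the scale in
    the place of the scale. *)
Lemma perp_eval q (t : homb (L1H H) (L2perp H) q) (k : nat -> R) x0 x1 a0 a1 a0' a1' (c : R)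
    (w : L1H H q) (h h' : Hb H q) : U q ->
  (forall n, (n < 4)%N -> c ^+ 2 * kco (theta (sg q)) w n = c ^+ 3 * k n) ->
  (forall j, (j < 4)%N -> happ (wb (theta (sg q)) (inord j)) h = c ^+ 2 * xxa x0 x1 a0 a1 j) ->
  (forall j, (j < 4)%N -> happ (wb (theta (sg q)) (inord j)) h' = c ^+ 2 * xxa x0 x1 a0' a1' j) ->
  fapp (elt_val (happ t w)) [args h; h'] =
  c ^+ 5 * (a0 * a1' - a1 * a0') * \sum_(n < 4) k n * quartic_eval (quartic (perp_mx t n)) x0
    x1 :> R.
Proof.
move=> Uq kE hE h'E; have d0 := den_neq0 Uq.
have span (v : Hb H q) (x : nat -> R) :
    (forall j, (j < 4)%N -> happ (wb (theta (sg q)) (inord j)) v = x j) ->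
    v = \sum_(j < 4) x j *: hb (theta (sg q)) j.
  move=> vE; rewrite {1}(hb_span v Uq d0); apply: eq_bigr => j _.
  by rewrite -vE // inord_val.
rewrite (span h _ hE) (span h' _ h'E) (wb_sum w Uq d0) happ_sum sub_sum bfapp_sum mulr_sumr.
apply: eq_bigr => n _; rewrite happZ subZ bfappZ form2_exp.
have -> : \sum_(i < 4) \sum_(j < 4) c ^+ 2 * xxa x0 x1 a0 a1 i * (c ^+ 2 * xxa x0 x1 a0' a1' j) *
     (fapp (elt_val (happ t (wb (theta (sg q)) n)))
        [args hb (theta (sg q)) i; hb (theta (sg q)) j] : R) =
    c ^+ 4 * \sum_(i < 4) \sum_(j < 4) xxa x0 x1 a0 a1 i * xxa x0 x1 a0' a1' j * perp_mx t n i j.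
  rewrite mulr_sumr; apply: eq_bigr => i _; rewrite mulr_sumr; apply: eq_bigr => j _.
  rewrite /perp_mx !inord_val.
  have E (x y z : R) : c ^+ 2 * x * (c ^+ 2 * y) * z = c ^+ 4 * (x * y * z) by ring.
  exact: E.
rewrite (xxa_quartic _ _ _ _ _ _ (perp_mx_anti t n)).
have E (x y z : R) : c ^+ 2 * x = c ^+ 3 * y -> x * (c ^+ 4 * z) = c ^+ 5 * (y * z).
  move=> xy; transitivity (c ^+ 2 * (c ^+ 2 * x) * z); first by ring.
  by rewrite xy; ring.
rewrite -[LHS]/(_ * _); apply: (etrans (E _ _ _ (kE n (ltn_ord n)))); ring.
Qed.

Lemma psi_line q (w : L1H H q) c : U q ->
  fapp (psi G w) [args c *: sg q; c *: sg q] = c ^+ 2 *: kap (theta (sg q)) w.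
Proof.
move=> Uq; rewrite (form2Zl (fapp_form _)) (form2Zr (fapp_form _)) scalerA.
by rewrite psi_sg.
Qed.

Lemma kap_xxa q (u : L1H H q) (x a : dualb S q) : U q ->
  let c (x : dualb S q) i := dco x i in
  fapp (kap (theta (sg q)) u) [args x; x; a] =
  \sum_(j < 4) xxa (c x 0) (c x 1) (c a 0) (c a 1) j * kco (theta (sg q)) u j :> R.
Proof.
move=> Uq c; rewrite sym3E // -/(kco (theta (sg q)) u 0) -/(kco (theta (sg q)) u 1).
rewrite -/(kco (theta (sg q)) u 2) -/(kco (theta (sg q)) u 3) sum4 /xxa /=.
have E (x0 x1 a0 a1 k0 k1 k2 k3 : R) :
    x0 * x0 * a0 * k0 + (x1 * x0 * a0 + x0 * x1 * a0 + x0 * x0 * a1) * k1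
    + (x1 * x1 * a0 + x1 * x0 * a1 + x0 * x1 * a1) * k2 + x1 * x1 * a1 * k3 =
    x0 ^+ 2 * a0 * k0 + (2 * x0 * x1 * a0 + x0 ^+ 2 * a1) * k1
    + (x1 ^+ 2 * a0 + 2 * x0 * x1 * a1) * k2 + x1 ^+ 2 * a1 * k3 by ring.
exact: E.
Qed.

Lemma ext_line_coord q (l : extb 2 S q) : U q -> exists c : R, l = c *: sg q.
Proof.
move=> Uq; exists (fapp l [args al 0 q; al 1 q]).
exact: (ext2_line _ Uq (sg1 Uq)).
Qed.

Lemma sg_eval q x y : U q -> fapp (sg q) [args x; y] =
  dco x 0 * dco y 1 - dco x 1 * dco y 0 :> R.
Proof. by move=> Uq; rewrite ext2E // sg1 // mulr1. Qed.

Lemma prod_ycube q (y : dualb S q) c j : U q -> (j < 4)%N ->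
  \prod_(i < 3) (fapp (c *: sg q) [args y; dword q j i] : R) =
  c ^+ 3 * ycube (dco y 0) (dco y 1) j.
Proof.
move=> Uq j4; have E i : fapp (c *: sg q) [args y; dword q (k := 3) j i] =
    c * (if (i < j)%N then dco y 0 else - dco y 1) :> R.
  rewrite bfappZ sg_eval // /dword /word; case: ifP => _.
    by rewrite !dco_al //= mulr1 mulr0 subr0.
  by rewrite !dco_al //= mulr1 mulr0 sub0r.
under eq_bigr do rewrite E.
rewrite !big_ord_recl big_ord0 /ycube /=.
by case: j j4 {E} => [|[|[|[|//]]]] _ /=; ring.
Qed.

Lemma sym7_word q (K : symb 7 S q) (y x : dualb S q) : U q ->
  fapp K [args y; y; y; x; x; x; x] =
  pol [:: (dco y 0, dco y 1); (dco y 0, dco y 1); (dco y 0, dco y 1);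
    (dco x 0, dco x 1); (dco x 0, dco x 1); (dco x 0, dco x 1); (dco x 0, dco x 1)]
    (fun j => fapp K (dword q j)).
Proof. by move=> Uq; rewrite sym_args. Qed.

(** In coordinates, both sides of the condition carry the factor a ^ a' and the same
    power of the multiple c of the scale; what remains is an identity of forms of
    bidegree (3, 4) in (y, x). *)
Lemma in_sym7E q (t : homb (L1H H) (L2perp H) q) : U q ->
  in_sym7 G t <-> exists k, sym7_eqs (fun n => quartic (perp_mx t n)) k.
Proof.
move=> Uq; have d0 := den_neq0 Uq; split.
  case/(_ (sg q)) => K hK; exists (fun j => fapp K (dword q j)).
  apply/sym7_eqsP => y0 y1 x0 x1.
  pose y : dualb S q := y0 *: al 0 q + y1 *: al 1 q.
  pose x : dualb S q := x0 *: al 0 q + x1 *: al 1 q.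
  have dc z0 z1 : dco (z0 *: al 0 q + z1 *: al 1 q) 0 = z0 /\
      dco (z0 *: al 0 q + z1 *: al 1 q) 1 = z1.
    rewrite /dco !happDl !happZl !alE //= -![_ *: _]/(_ * _).
    by rewrite !(mulr0, mulr1, addr0, add0r).
  have [y0E y1E] := dc y0 y1; have [x0E x1E] := dc x0 x1.
  pose w : L1H H q := \sum_(j < 4) ycube y0 y1 j *: wb (theta (sg q)) j.
  pose h (a : dualb S q) : Hb H q := \sum_(j < 4) xxa x0 x1 (dco a 0) (dco a 1) j *: hb
    (theta (sg q)) j.
  have kw n : (n < 4)%N -> kco (theta (sg q)) w n = ycube y0 y1 n.
    move=> n4; rewrite kco_sum (bigD1 (Ordinal n4)) //= big1 => [|j /negPf jn].
      by rewrite (kco_wb (Ordinal n4) (Ordinal n4)) // eqxx mulr1 addr0.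
    by rewrite (kco_wb j (Ordinal n4)) // jn mulr0.
  have hw a (u : L1H H q) :
      happ u (h a) = fapp (fapp (psi G u) [args sg q; sg q]) [args x; x; a].
    rewrite psi_sg // kap_xxa // x0E x1E /h happ_sum.
    by apply: eq_bigr => j _; rewrite happZ happ_hb.
  have := hK y x (al 0 q) (al 1 q) w (h (al 0 q)) (h (al 1 q)) _ (hw _) (hw _).
  have s1 : sg q = 1 *: sg q by rewrite scale1r.
  have -> : fapp (sg q) [args al 0 q; al 1 q] = 1 :> R := sg1 Uq.
  rewrite mul1r sym7_word // y0E y1E x0E x1E => <-.
    rewrite (@perp_eval q t (ycube y0 y1) x0 x1 1 0 0 1 1 w) //.
    - by rewrite expr1n mul1r mulr1 mul0r subr0 mul1r.
    - by move=> n n4; rewrite !expr1n !mul1r kw.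
    - move=> j j4; rewrite expr1n mul1r hw psi_sg // kap_xxa // x0E x1E.
      rewrite !dco_al //= (bigD1 (Ordinal j4)) //= big1 => [|i /negPf ij].
        by rewrite kco_wbn // eqxx mulr1 addr0.
      by rewrite kco_wbn // eq_sym; move: ij; rewrite -val_eqE /= => ->; rewrite mulr0.
    - move=> j j4; rewrite expr1n mul1r hw psi_sg // kap_xxa // x0E x1E.
      rewrite !dco_al //= (bigD1 (Ordinal j4)) //= big1 => [|i /negPf ij].
        by rewrite kco_wbn // eqxx mulr1 addr0.
      by rewrite kco_wbn // eq_sym; move: ij; rewrite -val_eqE /= => ->; rewrite mulr0.
  move=> z; rewrite psi_sg // (args3E z) sym3E //.
  rewrite -!/(kco (theta (sg q)) w _) !kw //.
  rewrite !big_ord_recl big_ord0 !sg_eval // y0E y1E.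
  rewrite /ycube; set z0 := z 0; set z1 := z 1; set z2 := z 2.
  by rewrite !(tnth_nth z0) /=; ring.
case=> k /sym7_eqsP hk l; have [c ->] := ext_line_coord l Uq.
exists (c ^+ 4 *: symk q 7 k) => y x a a' w h h' hw hh hh'.
have Kw n : (n < 8)%N -> fapp (symk q 7 k) (dword q n) = k n.
  by move=> n8; rewrite symk_word.
have hE (g : Hb H q) b : (forall u : L1H H q, happ u g =
      fapp (fapp (psi G u) [args c *: sg q; c *: sg q]) [args x; x; b]) ->
    forall j, (j < 4)%N -> happ (wb (theta (sg q)) (inord j)) g =
      c ^+ 2 * xxa (dco x 0) (dco x 1) (dco b 0) (dco b 1) j.
  move=> gE j j4; rewrite gE psi_line // bfappZ kap_xxa // -[LHS]/(_ * _); congr (_ * _).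
  rewrite (bigD1 (Ordinal j4)) //= big1 => [|i /negPf ij].
    by rewrite kco_wbn // eqxx mulr1 addr0.
  by rewrite kco_wbn // eq_sym; move: ij; rewrite -val_eqE /= => ->; rewrite mulr0.
rewrite (@perp_eval q t (ycube (dco y 0) (dco y 1)) (dco x 0) (dco x 1)
  (dco a 0) (dco a 1) (dco a' 0) (dco a' 1) c w h h' Uq _ (hE _ _ hh) (hE _ _ hh')).
  rewrite !bfappZ sg_eval // sym7_word // hk.
  have -> : pol [:: (dco y 0, dco y 1); (dco y 0, dco y 1); (dco y 0, dco y 1);
      (dco x 0, dco x 1); (dco x 0, dco x 1); (dco x 0, dco x 1); (dco x 0, dco x 1)]
      (fun j => fapp (symk q 7 k) (dword q j)) =
    pol [:: (dco y 0, dco y 1); (dco y 0, dco y 1); (dco y 0, dco y 1);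
      (dco x 0, dco x 1); (dco x 0, dco x 1); (dco x 0, dco x 1); (dco x 0, dco x 1)]
      (k : nat -> R^o).
    by apply: eq_pol => j j7; rewrite Kw.
  set P := pol _ _.
  have E (u v : R) : c ^+ 5 * u * v = c * u * (c ^+ 4 * v) by ring.
  exact: E.
move=> n n4; have := hw (dword q n); rewrite psi_line // bfappZ prod_ycube //.
Qed.

(** ** The connection in an adapted frame *)

Definition wsec (n : nat) : section (L1H H) := fun q => wb (theta (sg q)) (inord n).
Definition hsec (i : nat) : section (Hb H) := fun q => hb (theta (sg q)) (inord i).

Let d0 q (Uq : U q) := den_neq0 Uq.
Let sd q (Uq : U q) := smooth_den Uq.
Let Bs q (Uq : U q) := adapted_basis Uq (d0 Uq).

Lemma smooth_wsec n q : U q -> smooth_sec (wsec n) q.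
Proof. by move=> Uq; apply: (smooth_wb _ Uq (sd Uq) (d0 Uq)). Qed.

Lemma smooth_hsec i q : U q -> smooth_sec (hsec i) q.
Proof. by move=> Uq; apply: (smooth_hb _ Uq (sd Uq)). Qed.

(** The structure functions of the coframe: the entries of d w_n on H. *)
Definition struct_coef q (n i j : nat) : R :=
  dform (lift1 e (wsec n)) q (hval (hsec i)) (hval (hsec j)).

Definition struct_quartic q (n m : nat) : R := quartic (struct_coef q n) m.

Lemma smooth_struct_quartic n m q : U q -> smooth_fun (fun x => struct_quartic x n m) q.
Proof.
move=> Uq; have s i j : smooth_fun (fun x => struct_coef x n i j) q.
  apply: (smooth_dform Fr Uq); last exact: (smooth_hsec j Uq).
    exact: (smooth_lift1 Fr HU Uq (smooth_wsec n Uq)).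
  exact: (smooth_hsec i Uq).
have sc (g : M -> R) (c : R) : smooth_fun g q -> smooth_fun (fun x => g x / c) q.
  by move=> sg'; apply: smooth_mul => //; apply: smooth_cst.
rewrite /struct_quartic /quartic; case: (m == 0%N) => //; case: (m == 1%N); first exact: sc.
case: (m == 2%N); last by case: (m == 3%N) => //; apply: sc.
by apply: sc; apply: smooth_add => //; apply: smooth_mul => //; apply: smooth_cst.
Qed.

(** The solution: the covariant derivative of f_j along h_k is the combination of the
    f_i with these coefficients. *)
Definition conn_coef (i j : 'I_2) (phi : nat -> nat -> R) (k : nat) : R :=
  if i == 0 then (if j == 0 then conn_a phi k else conn_c phi k)
  else (if j == 0 then conn_b phi k else - conn_a phi k).

Definition conn_form i j q (X : Hb H q) : R :=
  \sum_(k < 4) (happ (wsec k q) X : R) * conn_coef i j (struct_quartic q) k.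

Section AtPoint.
Variable nab : operator H S.
Arguments nab : clear implicits.
Variable p : M.
Hypotheses (Up : U p) (cn : pconn_at nab p).
Implicit Types (X : Hb H p).

Lemma conn_entry_sum i j X :
  conn_entry nab p i j X = \sum_(k < 4) (happ (wsec k p) X : R) * conn_entry nab p i j (hsec k p).
Proof.
rewrite {1}(hb_span X Up (d0 Up)) /conn_entry.
rewrite (at_suml cn) ?happ_sum; last exact: smooth_f.
apply: eq_bigr => k _; rewrite happZ /wsec /hsec inord_val.
by [].
Qed.

(** By the Leibniz rule, a partial connection is determined by its connection forms. *)
Lemma nab_comb X (s : section S) : smooth_sec s p ->
  nab p X s = \sum_i (\sum_j coord f (s p) j * conn_entry nab p i j X
    + Hderiv X (fun q => coord f (s q) i)) *: f i p.
Proof.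
move=> ss; have sc i : smooth_fun (fun q => coord f (s q) i) p.
  by move: i; apply/(smooth_coord Fs s Up).
have sf i := smooth_f i Up.
have -> : nab p X s = nab p X (fun q => \sum_i coord f (s q) i *: f i q).
  apply: (at_local cn) => //; first exact: (smooth_comb Fs).
  by near=> q; rewrite (coordK Fs) //; near: q; apply: frame_nbhs Fs _ Up.
rewrite (at_sum cn (frame_module Fs Up)).
  rewrite !sum2 !(at_leibniz cn) // !(nab_frame nab Up).
  have E (V : lmodType R) (u v : V) (c0 c1 h0 h1 g00 g01 g10 g11 : R) :
        c0 *: (g00 *: u + g10 *: v) + h0 *: u + (c1 *: (g01 *: u + g11 *: v) + h1 *: v) =
        (c0 * g00 + c1 * g01 + h0) *: u + (c0 * g10 + c1 * g11 + h1) *: v.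
      by rewrite !scalerDr !scalerA !scalerDl (AC (3*3) ((1*4*3)*(2*5*6))).
  exact: E.
by move=> i; apply: (sm_scale (frame_module Fs Up)).
Unshelve. all: by end_near.
Qed.

Hypothesis tr0 : forall X, ext_op 2 nab p X sg = 0.

Let DH := L1H_op nab.
Let a k := conn_entry nab p 0 0 (hsec k p).
Let b k := conn_entry nab p 1 0 (hsec k p).
Let c k := conn_entry nab p 0 1 (hsec k p).

Lemma conn_mxE n i j : (n < 4)%N -> (j < 4)%N ->
  happ (DH (hsec i p) (wsec n)) (hsec j p) = conn_mx a b c n i j :> R.
Proof.
move=> n4 j4; rewrite /hsec happ_hb // inordK //.
rewrite (kco_L1H Up cn tr0) //; last exact: smooth_wsec.
have kw m : (m < 4)%N -> kco (theta (sg p)) (wsec n p) m = (n == m)%:R.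
  by move=> m4; apply: kco_wbn.
have hd : Hderiv (hb (theta (sg p)) (inord i))
    (fun q => kco (theta (sg q)) (wsec n q) j) = 0.
  rewrite -(Hderiv_cst (hb (theta (sg p)) (inord i)) (n == j)%:R).
  apply: (at_local (triv_pconn p)).
  - exact: (smooth_kco j Up (sd Up) (smooth_wsec n Up)).
  - exact: smooth_cst.
  - near=> q; have Uq : U q by near: q; apply: frame_nbhs Fr _ Up.
    exact: kco_wbn.
have jj : (j.-1 < 4)%N by apply: leq_ltn_trans (leq_pred j) j4.
have E (h x1 x2 x3 l k1 k2 k3 k1' k2' k3' : R) : h = 0 -> k1 = k1' -> k2 = k2' ->
    (3 - l) * k3 = (3 - l) * k3' ->
    h + l * (x1 * k1) + (3 - 2 * l) * x2 * k2 + (3 - l) * x3 * k3 =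
    l * (x1 * k1') + (3 - 2 * l) * x2 * k2' + (3 - l) * x3 * k3'.
  by move=> -> -> -> e3; rewrite add0r [_ * x3]mulrC -!mulrA e3.
apply: E => //; [exact: kw|exact: kw|].
case: (ltnP j 3) => j3; first by rewrite kw.
(* The coefficient of the undefined entry 4 vanishes. *)
have -> : j = 3%N by apply/eqP; rewrite eqn_leq j3 -ltnS j4.
by rewrite subrr !mul0r.
Unshelve. all: by end_near.
Qed.

(** The projection along the Levi form does not change the quartic. *)
Lemma torsion_quartic n m : (n < 4)%N -> (m < 5)%N ->
  quartic (perp_mx (torsion DH p) n) m = conn_quartic a b c n m - struct_quartic p n m.
Proof.
move=> n4 m5.
have cD : pconn_at DH p := L1H_pconn Up cn tr0.
pose T := torsion_form DH (wsec n) (lift1 e (wsec n)) : L2H H p.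
have TE i j : (i < 4)%N -> (j < 4)%N -> fapp T [args hsec i p; hsec j p] =
    conn_mx a b c n i j - conn_mx a b c n j i - struct_coef p n i j :> R.
  move=> i4 j4; rewrite torsion_formE (alt_formE cD); last exact: smooth_wsec.
  congr (_ - _ - _); [exact: conn_mxE|exact: conn_mxE|].
  apply: (extd_restr Fr Up); [|exact: smooth_hsec|exact: smooth_hsec].
  by apply: (smooth_lift1 Fr HU Up); apply: smooth_wsec.
have PE i j : (i < 4)%N -> (j < 4)%N ->
    perp_mx (torsion DH p) n i j =
    conn_mx a b c n i j - conn_mx a b c n j i - struct_coef p n i j
    - omega_part (h := hb (theta (sg p))) T * omega_mx (inord i) (inord j).
  move=> i4 j4; rewrite -TE // /perp_mx.
  rewrite (torsionE Fr HU Up (Bs Up) cD (u := wsec n) (u' := lift1 e (wsec n))).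
  - exact: (proj_perpE (Bs Up)).
  - exact: smooth_wsec.
  - by apply: (smooth_lift1 Fr HU Up); apply: smooth_wsec.
  - by near=> q; apply: (lift1E Fr HU); near: q; apply: frame_nbhs Fr _ Up.
exact: (quartic_perp _ PE).
Unshelve. all: by end_near.
Qed.

Lemma in_sym7_torsion :
  in_sym7 G (torsion DH p) <->
  exists k, sym7_eqs (fun n m => conn_quartic a b c n m - struct_quartic p n m) k.
Proof.
have E k : sym7_eqs (fun n => quartic (perp_mx (torsion DH p) n)) k <->
    sym7_eqs (fun n m => conn_quartic a b c n m - struct_quartic p n m) k.
  have i3 i : (i < 4)%N -> (3 - i < 4)%N by move=> _; rewrite ltnS leq_subr.
  by split=> E i m i4 m5; rewrite -(E i m i4 m5) torsion_quartic // i3.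
split=> [/(in_sym7E _ Up) [k /E kE]|[k /E kE]]; first by exists k.
by apply/(in_sym7E _ Up); exists k.
Qed.

End AtPoint.

Lemma conn_form_frame i j k q : U q -> (k < 4)%N ->
  conn_form i j (hsec k q) = conn_coef i j (struct_quartic q) k.
Proof.
move=> Uq k4; rewrite /conn_form (bigD1 (Ordinal k4)) //= big1 => [|l /negPf lk].
  by rewrite /wsec /hsec (lb_dual (Bs Uq)) eqxx mul1r addr0.
rewrite /wsec /hsec (lb_dual (Bs Uq)) -val_eqE /= !inordK //.
by move: lk; rewrite -val_eqE /= => ->; rewrite mul0r.
Qed.

(** The first condition fixes one of the four connection forms; the second is the
    linear system for the values of the other three on the h_k. *)
Lemma adaptedE (nab : operator H S) p : U p -> pconn_at nab p ->
  ((forall X : Hb H p, ext_op 2 nab p X sg = 0) /\ in_sym7 G (torsion (L1H_op nab) p)) <->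
  forall i j (X : Hb H p), conn_entry nab p i j X = conn_form i j X.
Proof.
move=> Up cn; split=> [[tr0 t7] i j X|E].
  have [k /sym7_unique kE] := (in_sym7_torsion Up cn tr0).1 t7.
  rewrite (conn_entry_sum Up cn); apply: eq_bigr => l _; congr (_ * _).
  have [Ea Eb Ec] := kE l (ltn_ord l).
  have ord2 (m : 'I_2) : m = 0 \/ m = 1.
    by case: m => -[|[|//]] ?; [left|right]; apply: val_inj.
  have [->|->] := ord2 i; have [->|->] := ord2 j.
  - exact: Ea.
  - exact: Ec.
  - exact: Eb.
  by rewrite (conn_entry11 Up cn tr0) Ea.
have tr0 (X : Hb H p) : ext_op 2 nab p X sg = 0.
  apply/(ext_op_trace Up cn); rewrite !E /conn_form -big_split /= big1 // => l _.
  by rewrite /conn_coef /= -mulrDr subrr mulr0.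
split=> //; apply/(in_sym7_torsion Up cn tr0); exists (sym7_k (struct_quartic p)).
have -> : (fun n m => conn_quartic (fun k => conn_entry nab p 0 0 (hsec k p))
    (fun k => conn_entry nab p 1 0 (hsec k p)) (fun k => conn_entry nab p 0 1 (hsec k p)) n m - struct_quartic p n m) =
    (fun n m => conn_quartic (fun k => conn_form 0 0 (hsec k p))
    (fun k => conn_form 1 0 (hsec k p)) (fun k => conn_form 0 1 (hsec k p)) n m - struct_quartic p n m).
  apply/funext => n; apply/funext => m; congr (conn_quartic _ _ _ n m - _);
    by apply/funext => k; rewrite E.
move=> i m i4 m5; rewrite -(sym7_exists (struct_quartic p) i4 m5); congr (_ * (_ - _)).
apply: conn_quartic_eq => k k4.
by split; rewrite conn_form_frame.
Qed.

(** ** The solution as a partial connection *)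

Definition conn_loc : operator H S := fun q X s =>
  \sum_i (\sum_j coord f (s q) j * conn_form i j X
    + Hderiv X (fun x => coord f (s x) i)) *: f i q.

Lemma conn_form_lin i j q a (X Y : Hb H q) :
  conn_form i j (a *: X + Y) = a * conn_form i j X + conn_form i j Y.
Proof.
rewrite /conn_form mulr_sumr -big_split /=; apply: eq_bigr => k _.
by rewrite happ_lin mulrDl mulrA.
Qed.

Lemma conn_loc_pconn q : U q -> pconn_at conn_loc q.
Proof.
move=> Uq; have sc (s : section S) i : smooth_sec s q -> smooth_fun (fun x => coord f (s x) i) q.
  by move=> ss; move: i; apply/(smooth_coord Fs s Uq).
have cT := triv_pconn (H := H) q.
split=> [a X Y s ss|X s t ss st e'|X s t ss st|X g s sg' ss]; rewrite /conn_loc.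
- rewrite scaler_sumr -big_split /=; apply: eq_bigr => i _.
  rewrite scalerA -scalerDl !sum2 !conn_form_lin Hderiv_lin; congr (_ *: _); ring.
- apply: eq_bigr => i _; rewrite (nbhs_singleton e'); congr ((_ + _) *: _).
  apply: (at_local cT); try exact: sc.
  by apply: filterS e' => x ->.
- rewrite -big_split /=; apply: eq_bigr => i _; rewrite -scalerDl !sum2.
  have cD j : coord f (s q + t q) j = coord f (s q) j + coord f (t q) j.
    by have := coord_lin Fs 1 (s q) (t q) j Uq; rewrite scale1r mul1r.
  have -> : Hderiv X (fun x => coord f (s x + t x) i) =
      Hderiv X (fun x => coord f (s x) i) + Hderiv X (fun x => coord f (t x) i).
    rewrite -(tapp_add (elt_val X) (sc s i ss) (sc t i st)).
    apply: (at_local cT).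
    + by apply: sc; apply: (sm_add (frame_module Fs Uq)).
    + by apply: smooth_add; apply: sc.
    near=> x; have Ux : U x by near: x; apply: frame_nbhs Fr _ Uq.
    by have := coord_lin Fs 1 (s x) (t x) i Ux; rewrite scale1r mul1r.
  by rewrite !cD; congr (_ *: _); ring.
have cZ x a (v : S x) j : U x -> coord f (a *: v) j = a * coord f v j.
  move=> Ux; have c0 : coord f (0 : S x) j = 0.
    by have := coord_lin Fs (-1) (0 : S x) 0 j Ux; rewrite scaler0 addr0 mulN1r addNr.
  by have := coord_lin Fs a v 0 j Ux; rewrite c0 !addr0.
rewrite -{3}(coordK Fs (s q) Uq) !scaler_sumr -big_split /=; apply: eq_bigr => i _.
rewrite !scalerA -scalerDl !sum2 !cZ //.
have -> : Hderiv X (fun x => coord f (g x *: s x) i) =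
    g q * Hderiv X (fun x => coord f (s x) i) + coord f (s q) i * Hderiv X g.
  rewrite -(tapp_mul (elt_val X) sg' (sc s i ss)).
  apply: (at_local cT).
  + by apply: sc; apply: (sm_scale (frame_module Fs Uq)).
  + by apply: smooth_mul => //; apply: sc.
  by near=> x; apply: cZ; near: x; apply: frame_nbhs Fr _ Uq.
by congr (_ *: _); ring.
Unshelve. all: by end_near.
Qed.

Lemma conn_entry_loc i j q (X : Hb H q) : U q -> conn_entry conn_loc q i j X = conn_form i j X.
Proof.
move=> Uq; rewrite /conn_entry /conn_loc happ_sum.
have hd k : Hderiv X (fun x => coord f (f j x) k) = 0.
  rewrite -(Hderiv_cst X (j == k)%:R); apply: (at_local (triv_pconn q)).
  - by move: k; apply/(smooth_coord Fs (f j) Uq); apply: smooth_f.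
  - exact: smooth_cst.
  - by near=> x; apply: (coord_frame Fs); near: x; apply: frame_nbhs Fr _ Uq.
have cf k : \sum_l coord f (f j q) l * conn_form k l X = conn_form k j X.
  rewrite (bigD1 j) //= (coord_frame Fs) // eqxx mul1r big1 ?addr0 // => l /negPf lj.
  by rewrite (coord_frame Fs) // eq_sym lj mul0r.
rewrite (bigD1 i) //= [X in _ + X]big1 => [|k /negPf ki].
  by rewrite addr0 happZ alE // eqxx hd cf addr0 -[LHS]/(_ * _) mulr1.
by rewrite happZ alE // ki -[LHS]/(_ * _) mulr0.
Unshelve. all: by end_near.
Qed.

Lemma smooth_conn_form i j (X : section (Hb H)) q : U q -> smooth_sec X q ->
  smooth_fun (fun x => conn_form i j (X x)) q.
Proof.
move=> Uq sX; apply: smooth_sum => k _; apply: smooth_mul.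
  exact: (smooth_happ (F := trivb) (smooth_wsec k Uq) sX).
have s n m := smooth_struct_quartic n m Uq.
have sl (g : M -> R) (c : R) : smooth_fun g q -> smooth_fun (fun x => c * g x) q.
  by move=> sg'; apply: smooth_mul => //; apply: smooth_cst.
have sr (g : M -> R) (c : R) : smooth_fun g q -> smooth_fun (fun x => g x / c) q.
  by move=> sg'; apply: smooth_mul => //; apply: smooth_cst.
have si (b : bool) (g h : M -> R) : smooth_fun g q -> smooth_fun h q ->
  smooth_fun (fun x => if b then g x else h x) q by case: b.
have sa : smooth_fun (fun x => conn_a (struct_quartic x) k) q.
  rewrite /conn_a.
  by do !(exact: s || apply: (si) || apply: (sr) || apply: smooth_opp || apply: smooth_sub ||
    apply: smooth_add || apply: (sl)).
have sb : smooth_fun (fun x => conn_b (struct_quartic x) k) q.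
  rewrite /conn_b.
  by do !(exact: s || apply: (si) || apply: (sr) || apply: smooth_opp || apply: smooth_sub ||
    apply: smooth_add || apply: (sl)).
have sc : smooth_fun (fun x => conn_c (struct_quartic x) k) q.
  rewrite /conn_c.
  by do !(exact: s || apply: (si) || apply: (sr) || apply: smooth_opp || apply: smooth_sub ||
    apply: smooth_add || apply: (sl)).
by apply: (si); apply: (si) => //; apply: smooth_opp.
Qed.

Lemma smooth_conn_loc (X : section (Hb H)) (s : section S) q : U q ->
  smooth_sec X q -> smooth_sec s q -> smooth_sec (fun x => conn_loc (X x) s) q.
Proof.
move=> Uq sX ss; have sc i : smooth_fun (fun x => coord f (s x) i) q.
  by move: i; apply/(smooth_coord Fs s Uq).
apply: (smooth_comb Fs Uq) => i; apply: smooth_add.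
  by apply: smooth_sum => j _; apply: smooth_mul => //; apply: smooth_conn_form.
by apply: smooth_tapp.
Qed.

End Adapted.

Arguments conn_entry {R M H G} f nab p i j X.
Arguments conn_loc {R M H G} e f de sg p X s.

(** * Existence of adapted frames *)

Section Frames.
Context {R : realType} {M : manifold R 5}.
Variable H : forall p : M, lin_subspace (@TM R 5 M p).
Variable G : g2_contact H.
Variable sg : section (extb 2 (spin G)).
Notation S := (spin G).

Record adapted_frame (U : set M) (e : 'I_5 -> section (@TM R 5 M))
    (f : 'I_2 -> section S) (de : 'I_1 -> section (dens G)) : Prop := AdaptedFrame {
  af_tangent : is_frame U e;
  af_contact : forall q, U q -> forall v : @TM R 5 M q,
    H q v <-> exists c : 'I_4 -> R,
      v = \sum_i c i *: e (widen_ord (leqnSn 4) i) q;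
  af_spin : is_frame U f;
  af_dens : is_frame U de;
  af_unit : forall q, U q ->
    fapp (sg q) [args coframe f 0 q; coframe f 1 q] = 1 :> R }.

Hypothesis ssg : forall q, smooth_sec sg q.
Hypothesis sg_neq0 : forall q, sg q != 0.

(** A frame (f_0, f_1) of S becomes adapted once f_1 is multiplied by the component
    of the scale along f_0 ^ f_1. *)
Lemma adapted_frame_exists p : is_distribution4 H ->
  exists U e f de, adapted_frame U e f de /\ U p.
Proof.
move=> /(_ p) [U1 [e [Fr U1p] HU]].
have [U2 [f Fs U2p]] := spin_bundle G p; have [U3 [de Fd U3p]] := dens_bundle G p.
have o1 : open U1 by case: Fr.
have o2 : open U2 by case: Fs.
have o3 : open U3 by case: Fd.
pose U := U1 `&` U2 `&` U3.
have oU : open U by apply: openI => //; apply: openI.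
have UU1 : U `<=` U1 by move=> x [[]].
have UU2 : U `<=` U2 by move=> x [[]].
have UU3 : U `<=` U3 by move=> x [].
have {}Fr := is_frame_sub oU UU1 Fr; have {}Fs := is_frame_sub oU UU2 Fs.
have {}Fd := is_frame_sub oU UU3 Fd.
pose g q : R := fapp (sg q) [args coframe f 0 q; coframe f 1 q].
have g0 q : U q -> g q != 0.
  move=> Uq; apply: contra (sg_neq0 q) => /eqP g0; apply/eqP.
  by apply: (ext2_eqP Fs Uq); rewrite -/(g q) g0 bfapp0.
pose gg (i : 'I_2) q : R := if i == 0 then 1 else g q.
have sgg i q : U q -> smooth_fun (gg i) q.
  move=> Uq; rewrite /gg; case: (i == 0); first exact: smooth_cst.
  change (smooth_fun (fun x => fapp (sg x) [args coframe f 0 x; coframe f 1 x] : R) q).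
  exact: (smooth_fapp2 (@ssg q) (smooth_al Fs 0 Uq) (smooth_al Fs 1 Uq)).
have gg0 i q : U q -> gg i q != 0.
  by move=> Uq; rewrite /gg; case: (i == 0); [apply: oner_neq0|apply: g0].
have Fs' := frame_scale Fs sgg gg0.
exists U, e, (fun i q => gg i q *: f i q), de; split; last by [].
split=> // [q /UU1 Uq|q Uq]; first exact: HU.
have := ext2E Fs' (sg q) (coframe f 0 q) (coframe f 1 q) Uq.
rewrite -/(g q) !happZ !(alE Fs) // /gg /= => gE.
apply: (mulfI (g0 q Uq)); rewrite mulr1 {2}gE.
set x := fapp _ _; have E (a b : R) : a * b = (1 * 1 * (a * 1) - a * 0 * (1 * 0)) * b by ring.
exact: E.
Qed.

End Frames.

(** * Existence and uniqueness of the partial connection *)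

Theorem proposition7p1 (R : realType) (M : manifold R 5)
    (H : forall p : M, lin_subspace (@TM R 5 M p)) (hH : is_contact H)
    (G : g2_contact H)
    (sigma : section (extb 2 (spin G)))
    (sigma_smooth : forall p, smooth_sec sigma p)
    (sigma_neq0 : forall p, sigma p != 0) :
  let adapted (nabla : operator H (spin G)) : Prop :=
    is_pconn nabla /\
    (forall (p : M) (X : Hb H p), ext_op 2 nabla p X sigma = 0) /\
    (forall p : M, in_sym7 G (torsion (L1H_op nabla) p)) in
  exists nabla : operator H (spin G),
    adapted nabla /\
    forall nabla' : operator H (spin G), adapted nabla' ->
    forall (p : M) (X : Hb H p) (s : section (spin G)),
      smooth_sec s p -> nabla' p X s = nabla p X s.
Proof.
case: hH => dist nondeg adapted.
have frame p : exists D : operator H (spin G),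
    exists U, exists e : 'I_5 -> section (@TM R 5 M), exists f : 'I_2 -> section (spin G),
      exists de,
    [/\ adapted_frame sigma U e f de, U p & D = conn_loc e f de sigma].
  have [U [e [f [de [AF Up]]]]] := adapted_frame_exists sigma_smooth sigma_neq0 p dist.
  by exists (conn_loc e f de sigma), U, e, f, de.
have [D DE] := choice frame.
(* Frames are chosen point by point; by uniqueness the choice is immaterial. *)
pose nabla : operator H (spin G) := fun p => D p p.
have ssU U q (_ : U q) := sigma_smooth q.
have at_p p : pconn_at nabla p.
  have [U [e [f [de [[Fr HU Fs Fd s1] Up DpE]]]]] := DE p.
  have [c1 c2 c3 c4] : pconn_at (D p) p.
    by rewrite DpE; apply: (conn_loc_pconn Fr Fs).
  by split.
have gam_p p : (forall X : Hb H p, ext_op 2 nabla p X sigma = 0) /\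
    in_sym7 G (torsion (L1H_op nabla) p).
  have [U [e [f [de [[Fr HU Fs Fd s1] Up DpE]]]]] := DE p.
  apply/(adaptedE nondeg Fr HU Fs Fd (ssU U) s1 Up (at_p p)) => i j X.
  rewrite -[LHS]/(conn_entry f (D p) p i j X) DpE.
  exact: (conn_entry_loc Fr Fs).
have uniq (nab nab' : operator H (spin G)) p (X : Hb H p) s : pconn_at nab p -> pconn_at nab' p ->
    (forall X : Hb H p, ext_op 2 nab p X sigma = 0) /\ in_sym7 G (torsion (L1H_op nab) p) ->
    (forall X : Hb H p, ext_op 2 nab' p X sigma = 0) /\ in_sym7 G (torsion (L1H_op nab') p) ->
    smooth_sec s p -> nab p X s = nab' p X s.
  move=> cn cn' an an' ss.
  have [U [e [f [de [[Fr HU Fs Fd s1] Up DpE]]]]] := DE p.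
  rewrite (nab_comb Fs Up cn X ss) (nab_comb Fs Up cn' X ss).
  apply: eq_bigr => i _; congr ((_ + _) *: _); apply: eq_bigr => j _; congr (_ * _).
  have E := (adaptedE nondeg Fr HU Fs Fd (ssU U) s1 Up cn).1 an.
  have E' := (adaptedE nondeg Fr HU Fs Fd (ssU U) s1 Up cn').1 an'.
  by rewrite E E'.
exists nabla; split.
  split; last by split=> p; have [] := gam_p p.
  split=> [p|p|p|p|p X s sX ss].
  - exact: (at_linear (at_p p)).
  - exact: (at_local (at_p p)).
  - exact: (at_add (at_p p)).
  - exact: (at_leibniz (at_p p)).
  have [U [e [f [de [[Fr HU Fs Fd s1] Up DpE]]]]] := DE p.
  apply: (sm_eq (frame_module Fs Up) (s := fun q => conn_loc e f de sigma q (X q) s)); last first.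
    exact: (smooth_conn_loc nondeg Fr HU Fs Fd (ssU U) s1).
  near=> q; have Uq : U q by near: q; apply: frame_nbhs Fr _ Up.
  have cq : pconn_at (conn_loc e f de sigma) q := conn_loc_pconn Fr Fs Uq.
  apply: uniq => //.
    apply/(adaptedE nondeg Fr HU Fs Fd (ssU U) s1 Uq cq) => i j Y.
    exact: (conn_entry_loc Fr Fs).
  by near: q; apply: (smooth_sec_near Fs).
move=> nabla' [pc' [tr' s7']] p X s ss.
by apply: uniq => //; apply: is_pconn_at.
Unshelve. all: by end_near.
Qed.
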